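(* Let $\mathcal{H}$ be a finite-dimensional complex Hilbert space, $P\in\mathscr{B}(\mathcal{H})$ a positive operator, $\mathcal{A}$ a unital $C^*$-algebra and $\Phi\in\mathrm{CP}^{(P)}(\mathcal{A},\mathscr{B}(\mathcal{H}))$. Then $\Phi$ is a $P$-$C^*$-extreme point of $\mathrm{CP}^{(P)}(\mathcal{A},\mathscr{B}(\mathcal{H}))$ if and only if there exist finitely many (none if $P=0$) pairwise non-equivalent irreducible representations $\pi_1,\dots,\pi_k$ of $\mathcal{A}$, Hilbert spaces $\{\mathcal{H}_j^i:1\leq i\leq k,\ 1\leq j\leq n_i\}$, and pure UCP maps $\Phi_j^{\pi_i}:\mathcal{A}\to\mathscr{B}(\mathcal{H}_j^i)$ such that, for each $1\leq i\leq k$, $\{\Phi_j^{\pi_i}\}_{j=1}^{n_i}$ is a nested sequence of compressions of the representation $\pi_i$, and $$\mathcal{H}=\Big(\bigoplus_{i=1}^k\bigoplus_{j=1}^{n_i}\mathcal{H}_j^i\Big)\oplus\mathrm{range}(P)^\perp,\qquad \Phi(\cdot)=S^*\Big(\Big(\bigoplus_{i=1}^k\bigoplus_{j=1}^{n_i}\Phi_j^{\pi_i}(\cdot)\Big)\oplus 0\Big)S$$ for some invertible operator $S\in\mathscr{B}(\mathcal{H})$, where $0:\mathcal{A}\to\mathscr{B}(\mathrm{range}(P)^\perp)$ is the zero map.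
   Context: $\mathscr{B}(\mathcal{H})$ is the algebra of bounded linear operators on $\mathcal{H}$; $1$ is the unit of $\mathcal{A}$. ''CP'' means completely positive (linear), ''UCP'' means unital CP. Representations of $\mathcal{A}$ are unital $*$-homomorphisms $\pi:\mathcal{A}\to\mathscr{B}(\mathcal{K})$, $\mathcal{K}$ a (not necessarily finite-dimensional) Hilbert space; $\pi$ is irreducible if $\pi(\mathcal{A})'=\mathbb{C}I$; (non-)equivalence means unitary (in)equivalence. A CP map $\Phi$ is pure if the only CP maps $\Psi$ for which $\Phi-\Psi$ is CP are those of the form $t\Phi$, $t\in[0,1]$. The direct sums are orthogonal direct sums, so that $\bigoplus_{i,j}\mathcal{H}_j^i=\mathrm{range}(P)$ (the $\mathcal{H}_j^i$ are mutually orthogonal subspaces of $\mathcal{H}$), and the direct sum of maps acts block-diagonally. For $T\in\mathscr{B}(\mathcal{H})$, $\mathrm{Ad}_T(X):=T^*XT$; the same notation is used for $T$ between two Hilbert spaces. A UCP map $\Psi:\mathcal{A}\to\mathscr{B}(\mathcal{G})$ is a compression of a UCP map $\Theta:\mathcal{A}\to\mathscr{B}(\mathcal{K})$ if there is an isometry $W:\mathcal{G}\to\mathcal{K}$ with $\Psi(a)=W^*\Theta(a)W$ for all $a$. A nested sequence of compressions of a representation $\pi$ is a sequence $\{\Phi_j\}_j$ of UCP maps such that $\Phi_1$ is a compression of $\pi$ and $\Phi_{j+1}$ is a compression of $\Phi_j$ for each $j\geq1$. For a positive operator $P$, $\mathrm{CP}^{(P)}(\mathcal{A},\mathscr{B}(\mathcal{H}))$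 is the set of all CP maps $\Phi:\mathcal{A}\to\mathscr{B}(\mathcal{H})$ with $\Phi(1)=P$. A map $\Phi\in\mathrm{CP}^{(P)}(\mathcal{A},\mathscr{B}(\mathcal{H}))$ is a $P$-$C^*$-extreme point of this set if whenever $\Phi=\sum_{j=1}^n\mathrm{Ad}_{T_j}\circ\Phi_j$ with $n\ge 1$, $\Phi_j\in\mathrm{CP}^{(P)}(\mathcal{A},\mathscr{B}(\mathcal{H}))$ and $T_j\in\mathscr{B}(\mathcal{H})$ invertible with $\sum_{j=1}^nT_j^*PT_j=P$, there exist invertible $S_j\in\mathscr{B}(\mathcal{H})$ such that $\Phi_j=\mathrm{Ad}_{S_j}\circ\Phi$ for all $1\leq j\leq n$. *)

(* Defs.v *)
From HB Require Import structures.
From mathcomp Require Import all_boot all_order all_algebra.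
From mathcomp Require Import complex.
From mathcomp Require Import boolp classical_sets functions filter reals.
From mathcomp Require Import topology normedtype sequences.
From mathcomp Require Import ring.

Set Implicit Arguments.
Unset Strict Implicit.
Unset Printing Implicit Defensive.

Import Order.TTheory GRing.Theory Num.Theory.
Import numFieldNormedType.Exports.

Local Open Scope classical_set_scope.
Local Open Scope ring_scope.

(* The complex numbers R[i] as a rigid structure: with R[i] itself as the scalar
   field, elaboration leaves reverse coercions in the terms, which block
   rewriting. *)
Definition cplx (R : realType) : numClosedFieldType := R[i].

(* Forms of type {dot _ for conj} are positive definite, linear in the first
   argument and conjugate-linear in the second. *)
HB.mixin Record isHilbert (R : realType) H
    & CompleteNormedModule (cplx R) H := {
  inner : {dot H for (@Num.conj (cplx R))};
  normr_inner : forall x : H, `|x| ^+ 2 = inner x x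
}.

#[short(type="hilbertType")]
HB.structure Definition Hilbert (R : realType) :=
  {H of isHilbert R H & CompleteNormedModule (cplx R) H}.

Notation "''[' x , y ]" := (inner x y) : ring_scope.

(* Unital C*-algebras. Hierarchy Builder rejects a common substructure of
   algType and normedModType (there is no declared join below numDomainType),
   so the norm and its completeness are fields. As for normedModType over
   cplx R, the norm takes its values in cplx R; the axioms make it real and
   nonnegative. *)
HB.mixin Record isCStarAlgebra (R : realType) A
    & GRing.Algebra (cplx R) A := {
  star : A -> A;
  starD : {morph star : a b / a + b};
  starZ : forall (c : cplx R) (a : A), star (c *: a) = c^* *: star a;
  starM : forall a b : A, star (a * b) = star b * star a;
  starK : involutive star;
  cnorm : A -> cplx R;
  cnorm_eq0 : forall a : A, cnorm a = 0 -> a = 0;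
  cnormD_le : forall a b : A, cnorm (a + b) <= cnorm a + cnorm b;
  cnormZ : forall (c : cplx R) (a : A), cnorm (c *: a) = `|c| * cnorm a;
  cnormM_le : forall a b : A, cnorm (a * b) <= cnorm a * cnorm b;
  cnorm_star : forall a : A, cnorm (star a * a) = cnorm a ^+ 2;
  cnorm_complete : forall u : nat -> A,
    (forall e : cplx R, 0 < e -> exists N, forall m n,
       (N <= m)%N -> (N <= n)%N -> cnorm (u m - u n) < e) ->
    exists l : A, forall e : cplx R, 0 < e -> exists N, forall n,
       (N <= n)%N -> cnorm (u n - l) < e
}.

#[short(type="cstarAlgType")]
HB.structure Definition CStarAlgebra (R : realType) :=
  {A of isCStarAlgebra R A & GRing.Algebra (cplx R) A}.

Section HilbertTheory.
Context {R : realType}.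
Implicit Types H : hilbertType R.

Lemma innerC H (x y : H) : '[x, y] = '[y, x]^*.
Proof. by rewrite hermC expr0 mul1r. Qed.

Lemma cauchy_schwarz H (x y : H) : `|'[x, y]| <= `|x| * `|y|.
Proof.
have [->|y0] := eqVneq y 0; first by rewrite linear0r !normr0 mulr0.
have ny0 : 0 < `|y| by rewrite normr_gt0.
rewrite -ler_pdivrMr// -(@ler_pXn2r _ 2)// ?nnegrE ?divr_ge0//.
set a := '[x, y] / `|y| ^+ 2.
have : 0 <= '[x - a *: y, x - a *: y] by exact: dnorm_ge0.
rewrite dnormB dnormZ -!normr_inner linearZr_LR/=.
have -> : a^* * '[x, y] = (`|'[x, y]| / `|y|) ^+ 2.
  rewrite /a rmorphM fmorphV rmorphXn/= (conj_Creal (normr_real y)).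
  rewrite mulrAC. by rewrite -normCKC exprMn exprVn.
have -> : `|a| ^+ 2 * `|y| ^+ 2 = (`|'[x, y]| / `|y|) ^+ 2.
  rewrite -exprMn /a normrM normfV normrX normr_id; congr (_ ^+ 2).
  by rewrite expr2 invfM mulrA mulfVK// gt_eqF.
rewrite conj_Creal ?rpredX ?rpredM ?rpredV ?normr_real//.
by rewrite opprD addrA addrK subr_ge0.
Qed.

End HilbertTheory.

Section BoundedOperators.
Context {R : realType}.
Implicit Types H K L : hilbertType R.

Definition bounded_linear H K (f : H -> K) : bool :=
  `[< linear f /\
      exists2 M : (cplx R), 0 <= M & forall x, `|f x| <= M * `|x| >].

Record bop H K := Bop { bop_val :> H -> K ; _ : bounded_linear bop_val }.

Lemma bounded_linear_submod H K : submod_closed (@bounded_linear H K).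
Proof.
split=> [|c f g]; rewrite !unfold_in.
  apply/asboolP; split=> [a x y|].
    by rewrite /GRing.zero/= scaler0 addr0.
  by exists 0 => // x; rewrite normr0 mul0r.
move=> /asboolP[lf [M M0 fM]] /asboolP[lg [N N0 gN]].
apply/asboolP; split=> [a x y|].
  have E z : (c *: f + g) z = c *: f z + g z by [].
  rewrite !E lf lg !scalerDr !scalerA mulrC !addrA; congr (_ + _).
  exact: addrAC.
exists (`|c| * M + N) => [|x]; first by rewrite addr_ge0// mulr_ge0.
rewrite (le_trans (ler_normD _ _))// mulrDl lerD// normrZ -mulrA.
by rewrite ler_wpM2l.
Qed.
HB.instance Definition _ H K := GRing.isSubmodClosed.Build (cplx R) (H -> K)
  (@bounded_linear H K)
  (GRing.submod_closed_semi (@bounded_linear_submod H K)).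
HB.instance Definition _ H K := [isSub for @bop_val H K].
HB.instance Definition _ H K := [Choice of bop H K by <:].
HB.instance Definition _ H K := [SubChoice_isSubLmodule of bop H K by <:].

Lemma bop_linear H K (T : bop H K) : linear T.
Proof. by case: T => f /= /asboolP[]. Qed.
HB.instance Definition _ H K (T : bop H K) :=
  GRing.isLinear.Build (cplx R) H K *:%R (bop_val T) (bop_linear T).

Lemma bop_bounded H K (T : bop H K) :
  exists2 M : (cplx R), 0 <= M & forall x, `|T x| <= M * `|x|.
Proof. by case: T => f /= /asboolP[]. Qed.

Lemma bop_eqP H K (S T : bop H K) : S =1 T <-> S = T.
Proof. by split=> [ST|->//]; apply/val_inj/funext. Qed.

Lemma bopDE H K (S T : bop H K) x : (S + T) x = S x + T x.
Proof. by []. Qed.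

Lemma bopZE H K c (T : bop H K) x : (c *: T) x = c *: T x.
Proof. by []. Qed.

Lemma bop0E H K x : (0 : bop H K) x = 0.
Proof. by []. Qed.

Fact id_bounded_linear H : bounded_linear (@idfun H).
Proof. by apply/asboolP; split=> //; exists 1 => // x; rewrite mul1r. Qed.
Definition bop_id H : bop H H := Bop (id_bounded_linear H).

Fact comp_bounded_linear H K L (S : bop K L) (T : bop H K) :
  bounded_linear (S \o T).
Proof.
have [M M0 SM] := bop_bounded S; have [N N0 TN] := bop_bounded T.
apply/asboolP; split=> [c x y|]; first by rewrite /= !linearP.
exists (M * N) => [|x]; first exact: mulr_ge0.
by rewrite (le_trans (SM _))// -mulrA ler_wpM2l.
Qed.
Definition bop_comp H K L (S : bop K L) (T : bop H K) : bop H L :=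
  Bop (comp_bounded_linear S T).

End BoundedOperators.

Section Riesz.
Context {R : realType}.
Local Notation C := (cplx R).

Lemma Creal_Re (s : C) : s \is Num.real -> s = (complex.Re s)%:C%C.
Proof.
rewrite realE => s0; suff : complex.Im s = 0 by case: s {s0} => x y /= ->.
by case/orP: s0; rewrite lecE/= => /andP[/eqP->].
Qed.

Lemma cplx_inf (S : set C) (b : C) : S !=set0 -> (forall s, S s -> b <= s) ->
    (forall s, S s -> s \is Num.real) ->
  exists m : C, (forall s, S s -> m <= s) /\
                forall e, 0 < e -> exists2 s, S s & s < m + e.
Proof.
move=> [s0 Ss0] bS realS.
have ReS s : S s -> s = (complex.Re s)%:C%C by move=> /realS/Creal_Re.
have lbS : has_inf [set @complex.Re R s | s in S].
  split; first by exists (complex.Re s0), s0.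
  exists (complex.Re b) => _ [s Ss <-].
  by move: (bS _ Ss); rewrite lecE => /andP[].
exists (inf [set @complex.Re R s | s in S])%:C%C; split=> [s Ss|e e0].
  rewrite [leRHS]ReS// lecR; apply: ge_inf; first exact: lbS.2.
  by exists s.
have eE := Creal_Re (gtr0_real e0).
have e'0 : 0 < complex.Re e by move: e0; rewrite eE ltcR.
have [_ [s Ss <-] lts] := inf_adherent e'0 lbS.
by exists s => //; rewrite eE -rmorphD [ltLHS]ReS// ltcR.
Qed.

Variables (H : hilbertType R) (f : H -> C).
Hypotheses (lf : forall c x y, f (c *: x + y) = c * f x + f y).
Hypothesis bf : exists2 M : C, 0 <= M & forall x, `|f x| <= M * `|x|.
Let J x : C := `|x| ^+ 2 - (f x + (f x)^*).

Let J_real x : J x \is Num.real.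
Proof.
by rewrite rpredB ?rpredX ?normr_real// CrealE rmorphD/= conjCK addrC.
Qed.

Let J_bound : exists b, forall x, b <= J x.
Proof.
have [M M0 fM] := bf; exists (- M ^+ 2) => x.
have : f x + (f x)^* <= 2 * (M * `|x|).
  rewrite (le_trans (real_ler_norm _))//.
    by rewrite CrealE rmorphD/= conjCK addrC.
  by rewrite (le_trans (ler_normD _ _))// norm_conjC mulr2n mulrDl mul1r lerD.
move=> h; rewrite -subr_ge0.
have -> : J x - - M ^+ 2 =
    (`|x| - M) ^+ 2 + (2 * (M * `|x|) - (f x + (f x)^*)) by rewrite /J; ring.
rewrite addr_ge0 ?subr_ge0// -realEsqr.
by rewrite rpredB ?normr_real ?ger0_real.
Qed.

Let JE x v t : J (x + t *: v) = J x + `|t| ^+ 2 * `|v| ^+ 2 +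
  (t * ('[v, x] - f v) + (t * ('[v, x] - f v))^*).
Proof.
rewrite /J !normr_inner [x + _]addrC lf [t *: v + x]addrC dnormD dnormZ.
rewrite linearZr_LR/= (innerC x v).
rewrite !rmorphM !rmorphB !rmorphD !rmorphM/= !conjCK; ring.
Qed.

Let J_parallelogram x y :
  `|x - y| ^+ 2 = 2 * (J x + J y - 2 * J (2^-1 *: (x + y))).
Proof.
have fD : f (2^-1 *: (x + y)) = 2^-1 * (f x + f y).
  have f0 : f 0 = 0.
    have := lf 1 0 0; rewrite scale1r addr0 mul1r => /eqP.
    by rewrite -subr_eq subrr => /eqP <-.
  rewrite -[2^-1 *: _]addr0 lf f0 addr0; congr (_ * _).
  by rewrite -[x in LHS]scale1r lf mul1r.
rewrite /J !normr_inner fD dnormB dnormZ dnormD rmorphM rmorphD/=.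
rewrite fmorphV rmorph_nat normfV normr_nat.
by field.
Qed.

Lemma riesz : exists z, forall x, f x = '[x, z].
Proof.
have [b bJ] := J_bound.
have [|||m [mJ Jm]] := @cplx_inf (range J) b.
- by exists (J 0), 0.
- by move=> _ [x _ <-].
- by move=> _ [x _ <-].
have {}mJ x : m <= J x by apply: mJ; exists x.
have {}Jm e : 0 < e -> exists x, J x < m + e.
  by move=> /Jm[_ [x _ <-]]; exists x.
pose F := filter_from [set e : C | 0 < e] (fun e => [set x | J x < m + e]).
have FF : ProperFilter F.
  apply: filter_from_proper; last by move=> e /Jm.
  apply: filter_from_filter; first by exists 1 => /=.
  move=> e e' /= e0 e'0; have [ee'|ee'] := real_leP (gtr0_real e0) (gtr0_real e'0).
    by exists e => // x /= Jx; split=> //; apply: lt_le_trans Jx _; rewrite lerD2l.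
  exists e' => // x /= Jx; split=> //; apply: lt_le_trans Jx _.
  by rewrite lerD2l ltW.
have : cauchy F.
  apply: cauchy_exP => e e0; have d0 : 0 < (e / 2) ^+ 2 by rewrite exprn_gt0 ?divr_gt0.
  have [x Jx] := Jm _ d0; exists x; exists ((e / 2) ^+ 2) => // y /= Jy.
  rewrite -ball_normE/= -(@ltr_pXn2r _ 2) ?nnegrE ?(ltW e0)//.
  rewrite J_parallelogram.
  have -> : e ^+ 2 = 2 * ((m + (e / 2) ^+ 2) + (m + (e / 2) ^+ 2) - 2 * m) by field.
  rewrite ltr_pM2l//; apply: ltr_leD; first exact: ltrD.
  by rewrite lerN2 ler_pM2l.
move=> /cauchy_cvg/cvg_ex[z Fz]; exists z => v.
apply/eqP; rewrite eq_sym -subr_eq0 -normr_le0; apply/ler_addgt0Pl => e e0.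
rewrite addr0.
pose s := (1 + `|v| ^+ 2)^-1; have s0 : 0 < s by rewrite invr_gt0 ltr_pwDl ?exprn_ge0.
pose d := s * (e / 2) ^+ 2; have d0 : 0 < d by rewrite mulr_gt0 ?exprn_gt0 ?divr_gt0.
have v1 : 0 < 1 + `|v| by rewrite ltr_pwDl.
pose e' := e / 2 / (1 + `|v|); have e'0 : 0 < e' by rewrite !divr_gt0.
have [x [/= zx Jx]] : exists x, `|z - x| < e' /\ J x < m + d.
  apply: (@filter_ex _ F); apply: filterI; last by exists d.
  by have := Fz _ (nbhsx_ballx z e' e'0); rewrite -ball_normE.
have -> : '[v, z] - f v = '[v, z - x] + ('[v, x] - f v).
  by rewrite linearBr addrA subrK.
rewrite (splitr e) (le_trans (ler_normD _ _))// lerD//.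
  rewrite (le_trans (cauchy_schwarz _ _))//.
  rewrite (le_trans (ler_wpM2l _ (ltW zx)))// /e' mulrC mulrAC ler_pdivrMr//.
  by rewrite ler_wpM2l ?lerDr// ltW// divr_gt0.
set g := '[v, x] - f v.
have := mJ (x + (- s * g^*) *: v); rewrite JE -/g.
have -> : J x + `|- s * g^*| ^+ 2 * `|v| ^+ 2 + (- s * g^* * g + (- s * g^* * g)^*)
   = J x - s * `|g| ^+ 2 * (2 - s * `|v| ^+ 2).
  rewrite normrM normrN norm_conjC (gtr0_norm s0) !rmorphM rmorphN/= conjCK.
  rewrite (conj_Creal (gtr0_real s0)) exprMn normCK; ring.
have sv : s * `|v| ^+ 2 <= 1.
  by rewrite mulrC ler_pdivrMr ?mul1r ?lerDr// ltr_pwDl ?exprn_ge0.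
move=> mle; have : s * `|g| ^+ 2 < d.
  rewrite -(ltrD2l m) (le_lt_trans _ Jx)// -lerBrDr (le_trans mle)//.
  rewrite lerD2l lerN2 ler_peMr ?mulr_ge0 ?exprn_ge0 ?(ltW s0)//.
  by rewrite lerBrDr (le_trans (lerD (lexx 1) sv)).
by rewrite ltr_pM2l// ltr_pXn2r ?nnegrE ?divr_ge0 ?(ltW e0)// => /ltW.
Qed.

End Riesz.

Section Adjoint.
Context {R : realType}.
Implicit Types H K L : hilbertType R.

Lemma inner_eq H (x y : H) : (forall z, '[z, x] = '[z, y]) -> x = y.
Proof.
move=> xy; apply/eqP; rewrite -subr_eq0 -normr_eq0 -sqrf_eq0 normr_inner.
by rewrite linearBr/= (xy (x - y)) subrr.
Qed.

Definition is_adjoint H K (T : bop H K) (T' : bop K H) : Prop :=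
  forall x y, '[T x, y] = '[x, T' y].

Lemma adjoint_exists H K (T : bop H K) : exists T', is_adjoint T T'.
Proof.
have [M M0 TM] := bop_bounded T.
have /choice[f fP] : forall y, exists z, forall x, '[T x, y] = '[x, z].
  move=> y; apply: riesz => [c x x'|].
    by rewrite linearP/= linearDl linearZl_LR.
  exists (M * `|y|) => [|x]; first exact: mulr_ge0.
  rewrite (le_trans (cauchy_schwarz _ _))// mulrAC.
  by rewrite ler_wpM2r.
have fb : bounded_linear f.
  apply/asboolP; split=> [c y y'|].
    apply: inner_eq => x; rewrite -fP linearDr linearZr_LR/= !fP.
    by rewrite linearDr linearZr_LR.
  exists M => // y; have [->|fy0] := eqVneq (f y) 0.
    by rewrite normr0 mulr_ge0.
  rewrite -(@ler_pM2r _ `|f y|) ?normr_gt0// -expr2 normr_inner -fP.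
  have /real_ler_norm : '[T (f y), y] \is Num.real.
    by rewrite fP -normr_inner rpredX ?normr_real.
  move=> /le_trans; apply; rewrite (le_trans (cauchy_schwarz _ _))// mulrAC.
  by rewrite ler_wpM2r.
by exists (Bop fb) => x y /=; rewrite fP.
Qed.

(* By adjoint_exists and inner_eq, this is the unique T' with
   '[T x, y] = '[x, T' y]; the default value 0 is never used. *)
Definition adj H K (T : bop H K) : bop K H := xget 0 (is_adjoint T).

Lemma adjP H K (T : bop H K) x y : '[T x, y] = '[x, adj T y].
Proof.
have [T' TT'] := adjoint_exists T.
by rewrite /adj; case: xgetP => [? _|/(_ T')].
Qed.

Lemma adj_unique H K (T : bop H K) (T' : bop K H) :
  is_adjoint T T' -> T' = adj T.
Proof.
by move=> TT'; apply/bop_eqP => y; apply: inner_eq => x; rewrite -TT' adjP.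
Qed.

End Adjoint.

Section Subspaces.
Context {R : realType}.
Implicit Types H : hilbertType R.

Definition closed_linear H (S : pred H) : Prop :=
  submod_closed S /\ closed [set x | S x].

(* In finite dimension every linear subspace is closed. *)
Record csubspace H :=
  Csubspace { csubspace_pred :> pred H ; _ : closed_linear csubspace_pred }.

Section SubspaceHilbert.
Variables (H : hilbertType R) (S : csubspace H).

Lemma csubspace_submod : submod_closed (csubspace_pred S).
Proof. by case: S => p []. Qed.

Lemma csubspace_closed : closed [set x | csubspace_pred S x].
Proof. by case: S => p []. Qed.

HB.instance Definition _ := GRing.isSubmodClosed.Build (cplx R) H
  (csubspace_pred S) (GRing.submod_closed_semi csubspace_submod).

Record csubspace_sort := CsubspaceVec {
  csubspace_val :> H ; _ : csubspace_pred S csubspace_val }.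

HB.instance Definition _ := [isSub for csubspace_val].
HB.instance Definition _ := [Choice of csubspace_sort by <:].
HB.instance Definition _ := [SubChoice_isSubLmodule of csubspace_sort by <:].

Implicit Types x y : csubspace_sort.

Fact csubspace_normD x y : `|val (x + y)| <= `|val x| + `|val y|.
Proof. by rewrite linearD ler_normD. Qed.
Fact csubspace_normZ (c : cplx R) x : `|val (c *: x)| = `|c| * `|val x|.
Proof. by rewrite linearZ normrZ. Qed.
Fact csubspace_norm_eq0 x : `|val x| = 0 -> x = 0.
Proof. by move=> /normr0_eq0 x0; apply: val_inj; rewrite x0 linear0. Qed.

HB.instance Definition _ := Lmodule_isNormed.Build (cplx R) csubspace_sort
  csubspace_normD csubspace_normZ csubspace_norm_eq0.

Fact csubspace_ballE x e : ball x e = val @^-1` (ball (val x) e).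
Proof.
have E y : `|x - y| = `|val x - val y| by rewrite -linearB.
by rewrite -!ball_normE; apply/seteqP; split=> y; rewrite /= E.
Qed.

Fact csubspace_complete (F : set_system csubspace_sort) :
  ProperFilter F -> cauchy F -> cvg F.
Proof.
move=> FF /cauchyP cF.
have : cauchy (val @ F : set_system H).
  apply: cauchy_exP => e e0; have [x Fx] := cF e e0; exists (val x).
  by move: Fx; rewrite csubspace_ballE.
move=> /cauchy_cvg/cvg_ex[l Fl].
have Sl : csubspace_pred S l.
  apply: (@closed_cvg _ _ F _ val _ csubspace_closed _ _ Fl).
  by apply: nearW => x; exact: valP.
apply/cvg_ex; exists (CsubspaceVec Sl); apply/cvg_ballP => e e0.
have := Fl _ (nbhsx_ballx l e e0).
by rewrite near_simpl csubspace_ballE.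
Qed.

HB.instance Definition _ :=
  Uniform_isComplete.Build csubspace_sort csubspace_complete.

Definition csubspace_inner x y : cplx R := '[val x, val y].

Fact csubspace_inner_linearl y : linear_for ( *%R : cplx R -> cplx R -> cplx R) (csubspace_inner ^~ y).
Proof. by move=> c x x'; rewrite /csubspace_inner linearP linearDl linearZl_LR. Qed.
Fact csubspace_inner_linearr x :
  linear_for (@Num.conj (cplx R) \; *%R) (csubspace_inner x).
Proof. by move=> c y y'; rewrite /csubspace_inner linearP. Qed.
Fact csubspace_inner_herm x y :
  csubspace_inner x y = (-1) ^+ false * (csubspace_inner y x)^*.
Proof. by rewrite expr0 mul1r [LHS]innerC. Qed.
Fact csubspace_inner_gt0 x : x != 0 -> 0 < csubspace_inner x x.
Proof. by move=> x0; apply: neq0_dnorm_gt0; rewrite -(inj_eq val_inj) in x0. Qed.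

HB.instance Definition _ := isBilinear.Build (cplx R) csubspace_sort csubspace_sort
  (cplx R) *%R (@Num.conj (cplx R) \; *%R) csubspace_inner
  (fun y => zmod_morphism_linear (csubspace_inner_linearl y))
  (fun x => zmod_morphism_linear (csubspace_inner_linearr x))
  (fun y => scalable_linear (csubspace_inner_linearl y))
  (fun x => scalable_linear (csubspace_inner_linearr x)).
HB.instance Definition _ := isHermitianSesquilinear.Build (cplx R)
  csubspace_sort false (@Num.conj (cplx R)) csubspace_inner csubspace_inner_herm.
HB.instance Definition _ := isDotProduct.Build (cplx R) csubspace_sort
  csubspace_inner csubspace_inner_gt0.

Fact csubspace_norm_inner x : `|x| ^+ 2 = csubspace_inner x x.
Proof. exact: (normr_inner (val x)). Qed.

HB.instance Definition _ := isHilbert.Build R csubspace_sort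
  (csubspace_norm_inner : forall x, `|x| ^+ 2 =
    (csubspace_inner : {dot csubspace_sort for (@Num.conj (cplx R))}) x x).

Fact csubspace_incl_bounded : bounded_linear (csubspace_val : csubspace_sort -> H).
Proof.
apply/asboolP; split=> [c x y|]; first exact: (linearP (val : csubspace_sort -> H)).
by exists 1 => // x; rewrite mul1r.
Qed.
Definition csubspace_incl : bop csubspace_sort H := Bop csubspace_incl_bounded.

End SubspaceHilbert.

Section OrthogonalComplement.
Variables (H : hilbertType R) (E : set H).

Definition orthc_pred : pred H := fun x => `[< forall y, E y -> '[y, x] = 0 >].

Fact orthc_closed_linear : closed_linear orthc_pred.
Proof.
split; first split=> [|c x y]; rewrite ?unfold_in.
- by apply/asboolP => y _; rewrite linear0r.
- move=> /asboolP xE /asboolP yE; apply/asboolP => z Ez.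
  by rewrite linearDr linearZr_LR/= xE// yE// mulr0 addr0.
move=> x clx; apply/asboolP => y Ey.
apply/eqP; rewrite -normr_le0; apply/ler_addgt0Pl => e e0; rewrite addr0.
have y1 : 0 < 1 + `|y| by rewrite ltr_pwDl.
have e'0 : 0 < e / (1 + `|y|) by rewrite divr_gt0.
have [z [/asboolP zE]] := clx _ (nbhsx_ballx x _ e'0).
rewrite -ball_normE/= => xz.
rewrite -(subrK z x) linearDr/= (zE _ Ey) addr0.
rewrite (le_trans (cauchy_schwarz _ _))//.
rewrite (le_trans (ler_wpM2l _ (ltW xz)))// mulrA ler_pdivrMr// mulrC.
by rewrite ler_wpM2l ?lerDr// ltW.
Qed.

Definition orthc : csubspace H := Csubspace orthc_closed_linear.

End OrthogonalComplement.
End Subspaces.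

Coercion csubspace_sort : csubspace >-> Sortclass.

Notation "''B' ( H , K )" := (bop H K)
  (at level 8, format "''B' ( H ,  K )") : type_scope.
Notation "''B' ( H )" := (bop H H)
  (at level 8, format "''B' ( H )") : type_scope.
Notation "S \oB T" := (bop_comp S T)
  (at level 40, left associativity) : ring_scope.

Section Operators.
Context {R : realType}.
Implicit Types G H K L : hilbertType R.

Definition finite_dimensional H : Prop :=
  exists (d : nat) (e : 'I_d -> H), forall x,
    exists c : 'I_d -> cplx R, x = \sum_i c i *: e i.

Definition positive_op H (T : 'B(H)) : Prop := forall x, 0 <= '[T x, x].

Definition invertible_op H (T : 'B(H)) : Prop :=
  exists T' : 'B(H), T \oB T' = bop_id H /\ T' \oB T = bop_id H.

Definition isometric H K (W : 'B(H, K)) : Prop := forall x, `|W x| = `|x|.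

Definition unitary_op H K (U : 'B(H, K)) : Prop :=
  adj U \oB U = bop_id H /\ U \oB adj U = bop_id K.

Definition Ad H K (T : 'B(H, K)) (X : 'B(K)) : 'B(H) := adj T \oB X \oB T.

Definition commutant H (E : set 'B(H)) : set 'B(H) :=
  [set T | forall X, E X -> T \oB X = X \oB T].

Definition orthogonal_dsum H (I : finType) (S : I -> csubspace H) : Prop :=
  (forall i j, i != j -> forall (x : S i) (y : S j), '[val x, val y] = 0) /\
  (forall x : H, exists y : forall i, S i, x = \sum_i val (y i)).

(* The block-diagonal operator with blocks T i; see dsum_opE below. *)
Definition dsum_op H (I : finType) (S : I -> csubspace H)
    (T : forall i, 'B(S i)) : 'B(H) :=
  \sum_i csubspace_incl (S i) \oB T i \oB adj (csubspace_incl (S i)).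

Lemma dsum_opE H (I : finType) (S : I -> csubspace H)
    (T : forall i, 'B(S i)) (i : I) (x : S i) :
  orthogonal_dsum S -> dsum_op T (val x) = val (T i x).
Proof.
move=> [oS _].
have aS j (y : S j) (z : H) : '[y, adj (csubspace_incl (S j)) z] = '[val y, z].
  by rewrite -adjP.
have E : forall (J : seq I) (F : I -> 'B(H)) z,
    (\sum_(j <- J) F j) z = \sum_(j <- J) F j z.
  by move=> J F z; elim/big_rec2: _ => // j u v _ <-.
rewrite /dsum_op E (bigD1 i)//= big1 ?addr0 => [|j ji].
  congr (val (T i _)); apply: inner_eq => y; exact: aS.
suff -> : adj (csubspace_incl (S j)) (val x) = 0 by rewrite !linear0.
by apply: inner_eq => y; rewrite aS (oS _ _ ji) linear0r.
Qed.

(* A family of subspaces completed by one more subspace Q (index None), and a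
   family of operators completed by the zero operator on Q. *)
Definition extend_blocks H (I : finType) (S : I -> csubspace H)
    (Q : csubspace H) (o : option I) : csubspace H :=
  if o is Some i then S i else Q.

Definition extend_by0 H (I : finType) (S : I -> csubspace H)
    (Q : csubspace H) (T : forall i, 'B(S i)) (o : option I) :
    'B(extend_blocks S Q o) :=
  match o with Some i => T i | None => 0 end.

End Operators.

Section CompletelyPositive.
Context {R : realType} {A : cstarAlgType R}.
Implicit Types G H K L : hilbertType R.

(* The positive elements of the C*-algebra M_n(A) are the X^* X. *)
Definition mx_positive n (M : 'M[A]_n) : Prop :=
  exists X : 'M[A]_n, M = (\matrix_(i, j) star (X j i)) *m X.

(* Positivity in M_n(B(H)) = B(H^n). *)
Definition op_mx_positive H n (T : 'M['B(H)]_n) : Prop :=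
  forall x : 'I_n -> H, 0 <= \sum_i \sum_j '[T i j (x j), x i].

Definition completely_positive H (Phi : A -> 'B(H)) : Prop :=
  linear Phi /\
  forall n (M : 'M[A]_n), mx_positive M -> op_mx_positive (map_mx Phi M).

Definition UCP H (Phi : A -> 'B(H)) : Prop :=
  completely_positive Phi /\ Phi 1 = bop_id H.

Definition CP_with_unit H (P : 'B(H)) : set (A -> 'B(H)) :=
  [set Phi | completely_positive Phi /\ Phi 1 = P].

Definition pure_map H (Phi : A -> 'B(H)) : Prop :=
  completely_positive Phi /\
  forall Psi : A -> 'B(H), completely_positive Psi ->
    completely_positive (Phi - Psi) ->
    exists2 t : cplx R, 0 <= t <= 1 & Psi = t *: Phi.

Definition representation K (pi : A -> 'B(K)) : Prop :=
  [/\ linear pi, pi 1 = bop_id K,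
      forall a b, pi (a * b) = pi a \oB pi b
    & forall a, pi (star a) = adj (pi a)].

Definition irreducible K (pi : A -> 'B(K)) : Prop :=
  representation pi /\
  commutant (range pi) = range (fun c : cplx R => c *: bop_id K).

Definition equivalent K L (pi : A -> 'B(K)) (rho : A -> 'B(L)) : Prop :=
  exists2 U : 'B(K, L), unitary_op U &
    forall a, rho a = U \oB pi a \oB adj U.

Definition compression G K (Psi : A -> 'B(G)) (Theta : A -> 'B(K)) : Prop :=
  exists2 W : 'B(G, K), isometric W & forall a, Psi a = Ad W (Theta a).

Definition nested_compressions n (G : 'I_n -> hilbertType R)
    (Phi : forall j, A -> 'B(G j)) K (pi : A -> 'B(K)) : Prop :=
  [/\ forall j, UCP (Phi j),
      forall j : 'I_n, j = 0%N :> nat -> compression (Phi j) pi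
    & forall j j' : 'I_n, j' = j.+1 :> nat -> compression (Phi j') (Phi j)].

Definition cstar_extreme H (P : 'B(H)) (Phi : A -> 'B(H)) : Prop :=
  CP_with_unit P Phi /\
  forall n (Phis : 'I_n -> A -> 'B(H)) (T : 'I_n -> 'B(H)),
    (0 < n)%N ->
    (forall j, CP_with_unit P (Phis j)) ->
    (forall j, invertible_op (T j)) ->
    \sum_j Ad (T j) P = P ->
    (forall a, Phi a = \sum_j Ad (T j) (Phis j a)) ->
    exists S : 'I_n -> 'B(H), forall j,
      invertible_op (S j) /\ forall a, Phis j a = Ad (S j) (Phi a).

End CompletelyPositive.

(* Main.v *)
(* Let Phi = V^* pi V be the minimal Stinespring dilation. If Phi is extreme, every
   CP map dominated by Phi has the form Ad_Q o Phi. Read in the commutant of pi(A),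
   this says that each positive element is Z^* Z for some Z in the algebra of those
   commutant elements that leave the range of V invariant. Hence the commutant is
   finite-dimensional and pi is a finite sum of irreducible representations; on the
   multiplicity space of each irreducible, an algebra with this factorization
   property contains all upper triangular matrices for a suitable orthonormal basis.
   Compressing pi_i to the parts of range V cut out by this basis gives the nested
   sequences.

   Conversely, if Psi is dominated by a sum of nested compressions, the intertwiners
   C_t from pi_i to the dilation of Psi satisfy C_s^* C_t = d_st 1. Gram-Schmidt
   factors d as z^* z with z triangular, and because the compressions are nested z
   is implemented by an operator Q on H, so that Psi = Ad_Q o Phi; Q is invertible
   when Psi = Ad_T o Phi' with T invertible and Phi'(1) = P. *)

Require Import Defs.
From HB Require Import structures.
From mathcomp Require Import all_boot all_order all_algebra spectral sesquilinear.
From mathcomp Require Import complex.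
From mathcomp Require Import boolp classical_sets functions filter reals.
From mathcomp Require Import topology normedtype sequences.
From mathcomp Require Import ring.

Set Implicit Arguments.
Unset Strict Implicit.
Unset Printing Implicit Defensive.

Import Order.TTheory GRing.Theory Num.Theory.
Import numFieldNormedType.Exports.

Local Open Scope classical_set_scope.
Local Open Scope ring_scope.

(** * Limits of complex sequences *)

(** Two difficulties shape the argument. The definition of an extreme point only concerns
    decompositions with invertible coefficients, and [Ad] of an invertible operator preserves the
    dimension of a kernel; it therefore applies directly to a dominated [Psi] only when [Psi 1] and
    [(Phi - Psi) 1] both have the kernel of [P], and the general case is a limit of perturbed ones.
    Moreover [P] may be singular. Then [V] is not injective, an operator on [H] matters only modulo
    the kernel of [P], and a partial isometry with the range of [V] takes the place of [V]. The
    commutant is finite-dimensional because an element [Z] with [Z V = V Q] is determined by [Q],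
    the range of [V] being cyclic. The factorization property is the one that Cholesky factorization
    gives to triangular matrices; conversely it forces an algebra of matrices to contain triangular
    matrix units, and the triangular order of these units is the order of nesting. *)

Section ComplexLimits.
Variable R : realType.
Local Notation C := (cplx R).

Lemma cplx_norm_le (z : C) : `|z| <= (`|complex.Re z| + `|complex.Im z|)%:C%C.
Proof.
rewrite {1}[z]complexE (le_trans (ler_normD _ _))// normrM.
rewrite rmorphD/= lerD//.
  by rewrite normc_def/= expr0n/= addr0 sqrtr_sqr.
rewrite normc_def/= expr0n/= expr1n add0r sqrtr1 mul1r.
by rewrite normc_def/= expr0n/= addr0 sqrtr_sqr.
Qed.

Lemma cvg_complex (T : Type) (F : set_system T) {FF : Filter F} (f : T -> C) (a b : R) :
  complex.Re (f x) @[x --> F] --> a -> complex.Im (f x) @[x --> F] --> b ->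
  f x @[x --> F] --> ((a +i* b)%C : C).
Proof.
move=> /cvgrPdist_lt fa /cvgrPdist_lt fb; apply/cvgrPdist_lt => e e0.
have eE := Defs.Creal_Re (gtr0_real e0); set e' := complex.Re e in eE.
have e'0 : 0 < e' / 2 by rewrite divr_gt0// -ltcR -eE.
near=> x; rewrite (le_lt_trans (cplx_norm_le _))// eE ltcR (splitr e').
apply: ltrD.
  have -> : complex.Re ((a +i* b)%C - f x) = a - complex.Re (f x) by case: (f x).
  by near: x; exact: fa.
have -> : complex.Im ((a +i* b)%C - f x) = b - complex.Im (f x) by case: (f x).
by near: x; exact: fb.
Unshelve. all: by end_near. Qed.

Lemma cplx_Re_le (z : C) : (`|complex.Re z|)%:C%C <= `|z|.
Proof. by rewrite (le_trans _ (normc_ge_Re z))// normc_def/= expr0n/= addr0 sqrtr_sqr. Qed.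

Lemma cplx_Im_le (z : C) : (`|complex.Im z|)%:C%C <= `|z|.
Proof.
rewrite normc_def lecR -sqrtr_sqr ler_sqrt ?addr_ge0 ?sqr_ge0//.
by rewrite lerDr sqr_ge0.
Qed.

Lemma real_cauchy_cvg (u : nat -> R) :
  (forall e, 0 < e -> exists N, forall m n, (N <= m)%N -> (N <= n)%N -> `|u m - u n| < e) ->
  exists l : R, u n @[n --> \oo] --> l.
Proof.
move=> uC; suff : cvg (u @ \oo) by move=> /cvg_ex.
apply: R_complete; apply: cauchy_exP => e e0; have [N NC] := uC e e0.
exists (u N); exists N => // n /= Nn; rewrite -ball_normE /=; exact: NC.
Qed.

Lemma cplx_cauchy_cvg (u : nat -> C) :
  (forall e : C, 0 < e -> exists N, forall m n, (N <= m)%N -> (N <= n)%N -> `|u m - u n| < e) ->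
  exists l : C, u n @[n --> \oo] --> l.
Proof.
move=> uC.
have [a ua] : exists l : R, complex.Re (u n) @[n --> \oo] --> l.
  apply: real_cauchy_cvg => e e0; have [|N NC] := uC e%:C%C; first by rewrite ltcR.
  exists N => m n Nm Nn; rewrite -ltcR; apply: le_lt_trans (NC _ _ Nm Nn).
  have -> : complex.Re (u m) - complex.Re (u n) = complex.Re (u m - u n).
    by case: (u m) (u n) => ? ? [].
  exact: cplx_Re_le.
have [b ub] : exists l : R, complex.Im (u n) @[n --> \oo] --> l.
  apply: real_cauchy_cvg => e e0; have [|N NC] := uC e%:C%C; first by rewrite ltcR.
  exists N => m n Nm Nn; rewrite -ltcR; apply: le_lt_trans (NC _ _ Nm Nn).
  have -> : complex.Im (u m) - complex.Im (u n) = complex.Im (u m - u n).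
    by case: (u m) (u n) => ? ? [].
  exact: cplx_Im_le.
by exists ((a +i* b)%C : C); exact: cvg_complex.
Qed.

(** Compactness of a closed segment, applied to the real and the imaginary part. *)
Lemma ultra_cvg (T : Type) (F : set_system T) (FU : UltraFilter F) (f : T -> C) (m : C) :
  (forall x, `|f x| <= m) -> exists l : C, f x @[x --> F] --> l.
Proof.
move=> fm; have FF : ProperFilter F by exact: ultra_proper.
have real_case (g : T -> R) (k : R) : (forall x, `|g x| <= k) -> exists l : R, g x @[x --> F] --> l.
  move=> gk; have := segment_compact (a := - k) (b := k).
  rewrite compact_ultra => /(_ (g x @[x --> F])) [].
    (* The image of an ultrafilter is an ultrafilter: if the preimage of [B] is not in [F], its
       complement is, and a finer filter cannot contain [B]. *)
    apply: Build_UltraFilter => G GF FG; apply/seteqP; split=> // B GB.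
    have [//|nB] := in_ultra_setVsetC (g @^-1` B) FU.
    have : G (B `&` ~` B) by apply: filterI => //; apply: FG.
    by rewrite setICr => /filter_not_empty.
    by apply: nearW => x; rewrite /= in_itv/= -ler_norml.
  by move=> l [_ gl]; exists l.
have m0 (x : T) : m = (complex.Re m)%:C%C.
  apply: Defs.Creal_Re; apply: ger0_real; exact: le_trans (fm x).
have [a fa] : exists l : R, complex.Re (f x) @[x --> F] --> l.
  apply: (real_case _ (complex.Re m)) => x.
  by rewrite -lecR -(m0 x); apply: le_trans (fm x); exact: cplx_Re_le.
have [b fb] : exists l : R, complex.Im (f x) @[x --> F] --> l.
  apply: (real_case _ (complex.Re m)) => x.
  by rewrite -lecR -(m0 x); apply: le_trans (fm x); exact: cplx_Im_le.
by exists ((a +i* b)%C : C); exact: cvg_complex.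
Qed.

(** Near [F] the values equal their moduli, which converge to [|l|]; uniqueness of the limit gives
    [l = |l|]. *)
Lemma cvg_ge0 (T : Type) (F : set_system T) {FF : ProperFilter F} (f : T -> C) (l : C) :
  f x @[x --> F] --> l -> (\forall x \near F, 0 <= f x) -> 0 <= l.
Proof.
move=> fl f0; suff -> : l = `|l| by [].
have H : `|f x| @[x --> F] --> l.
  move: (fl) => /cvgrPdist_lt fl'; apply/cvgrPdist_lt => e e0; near=> x.
  have fx0 : 0 <= f x by near: x; exact: f0.
  by rewrite (ger0_norm fx0); near: x; exact: fl'.
exact: (cvg_unique (@norm_hausdorff _ _) H (cvg_norm fl)).
Unshelve. all: by end_near. Qed.

End ComplexLimits.

(** * Semi-inner products and their Cauchy-Schwarz inequality *)

Record semi_inner (R : realType) (V : lmodType (cplx R)) := SemiInner {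
  sip :> V -> V -> cplx R;
  sip_linear : forall c x y z, sip (c *: x + y) z = c * sip x z + sip y z;
  sip_antilinear : forall c x y z, sip z (c *: x + y) = c^* * sip z x + sip z y;
  sip_ge0 : forall x, 0 <= sip x x
}.

Section SemiInnerTheory.
Variables (R : realType) (V : lmodType (cplx R)) (h : semi_inner V).
Local Notation C := (cplx R).
Implicit Types x y z : V.

Lemma sipDl x y z : h (x + y) z = h x z + h y z.
Proof. by rewrite -[x]scale1r sip_linear mul1r scale1r. Qed.
Lemma sipDr x y z : h z (x + y) = h z x + h z y.
Proof. by rewrite -[x]scale1r sip_antilinear rmorph1 mul1r scale1r. Qed.
Lemma sip0l z : h 0 z = 0.
Proof. by apply: (addrI (h 0 z)); rewrite -sipDl !addr0. Qed.
Lemma sip0r z : h z 0 = 0.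
Proof. by apply: (addrI (h z 0)); rewrite -sipDr !addr0. Qed.
Lemma sipZl c x z : h (c *: x) z = c * h x z.
Proof. by rewrite -[c *: x]addr0 sip_linear sip0l addr0. Qed.
Lemma sipZr c x z : h z (c *: x) = c^* * h z x.
Proof. by rewrite -[c *: x]addr0 sip_antilinear sip0r addr0. Qed.
Lemma sipNl x z : h (- x) z = - h x z.
Proof. by rewrite -scaleN1r sipZl mulN1r. Qed.
Lemma sipNr x z : h z (- x) = - h z x.
Proof. by rewrite -scaleN1r sipZr rmorphN1 mulN1r. Qed.
Lemma sipBl x y z : h (x - y) z = h x z - h y z.
Proof. by rewrite sipDl sipNl. Qed.
Lemma sipBr x y z : h z (x - y) = h z x - h z y.
Proof. by rewrite sipDr sipNr. Qed.

Lemma sip_real x : (h x x)^* = h x x.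
Proof. exact/conj_Creal/ger0_real/sip_ge0. Qed.

(** Polarization: positive numbers are real, and this at [x + y] and at ['i *: x + y] determines the
    sum and the difference of [h x y] and [h y x]. *)
Lemma sipC x y : h x y = (h y x)^*.
Proof.
have e1 := sip_real (x + y); have e2 := sip_real ('i *: x + y).
move: e1 e2; rewrite !(sipDl, sipDr, sipZl, sipZr) !rmorphD !rmorphM /=.
rewrite ?conjCK ?conjCi !sip_real => e1 e2.
have i2 : ('i : C) * 'i = -1 by rewrite -expr2 sqrCi.
have e3 : h x y - h y x = (h y x)^* - (h x y)^*.
  apply: (mulfI (neq0Ci C)); apply/eqP; rewrite -subr_eq0.
  move/eqP: e2; rewrite -subr_eq0 => /eqP e2; apply/eqP.
  by rewrite -[RHS]oppr0 -e2; ring.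
have e4 : h x y + h y x = (h y x)^* + (h x y)^*.
  move/eqP: e1; rewrite -subr_eq0 => /eqP e1; apply/eqP; rewrite -subr_eq0; apply/eqP.
  by rewrite -[RHS]oppr0 -e1; ring.
have : 2 * h x y = 2 * (h y x)^*.
  transitivity (h x y - h y x + (h x y + h y x)); first by ring.
  by rewrite e3 e4; ring.
by move/mulfI; apply; rewrite pnatr_eq0.
Qed.

(** Positivity at [x - (s * a) *: y] for real [s]. If [b] is nonzero, [s = b^-1] gives the
    inequality. The form may be degenerate; if [b = 0] and [a] is nonzero, the chosen [s] makes the
    value equal to -1, a contradiction. *)
Lemma sip_cauchy_schwarz x y : `|h x y| ^+ 2 <= h x x * h y y.
Proof.
set a := h x y; set b := h y y.
have aE : h y x = a^* by rewrite sipC.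
have b0 : 0 <= b := sip_ge0 h y.
have bC : b^* = b by exact: sip_real.
have key (s : C) : s \is Num.real -> 0 <= h x x - 2 * s * `|a| ^+ 2 + s ^+ 2 * `|a| ^+ 2 * b.
  move=> sr; have := sip_ge0 h (x - (s * a) *: y).
  rewrite !(sipDl, sipDr, sipNl, sipNr, sipZl, sipZr) -/a -/b aE.
  rewrite rmorphM/= (conj_Creal sr) normCK => H; apply: le_trans H _.
  by rewrite le_eqVlt; apply/orP; left; apply/eqP; ring.
have [b_eq0|bn0] := eqVneq b 0.
  rewrite b_eq0 mulr0; apply: contraT; rewrite -real_ltNge ?rpredX ?normr_real ?real0// => a0.
  have := key ((h x x + 1) / (2 * `|a| ^+ 2)).
  rewrite b_eq0 mulr0 addr0.
  have -> : 2 * ((h x x + 1) / (2 * `|a| ^+ 2)) * `|a| ^+ 2 = h x x + 1.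
    have a_neq0 : `|a| != 0 by apply: contraTneq a0 => ->; rewrite expr0n/= ltxx.
    by field.
  rewrite opprD addrA subrr add0r => /(_ _)/negP H.
  exfalso; apply: H => //; last by rewrite ler0N1.
  rewrite rpred_div//; last by rewrite rpredM ?rpredX ?normr_real ?realn.
  by rewrite rpredD ?real1// ger0_real// sip_ge0.
have bp : 0 < b by rewrite lt_def bn0.
have := key b^-1; rewrite rpredV => /(_ (gtr0_real bp)).
have -> : h x x - 2 * b^-1 * `|a| ^+ 2 + b^-1 ^+ 2 * `|a| ^+ 2 * b = h x x - `|a| ^+ 2 / b.
  by field.
by rewrite subr_ge0 ler_pdivrMr.
Qed.

Definition sinorm x : C := sqrtC (h x x).

Lemma sinorm_ge0 x : 0 <= sinorm x.
Proof. by rewrite sqrtC_ge0 sip_ge0. Qed.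

Lemma sinormK x : sinorm x ^+ 2 = h x x.
Proof. exact: sqrtCK. Qed.

Lemma sip_le x y : `|h x y| <= sinorm x * sinorm y.
Proof.
rewrite -(@ler_pXn2r _ 2) ?nnegrE ?mulr_ge0 ?sinorm_ge0//.
by rewrite exprMn !sinormK sip_cauchy_schwarz.
Qed.

Lemma sinormZ c x : sinorm (c *: x) = `|c| * sinorm x.
Proof.
apply: (@pexpIrn _ 2); rewrite ?nnegrE ?mulr_ge0 ?sinorm_ge0//.
by rewrite exprMn !sinormK sipZl sipZr mulrA normCK.
Qed.

Lemma sinormD x y : sinorm (x + y) <= sinorm x + sinorm y.
Proof.
rewrite -(@ler_pXn2r _ 2) ?nnegrE ?addr_ge0 ?sinorm_ge0//.
rewrite sinormK sqrrD !sinormK !(sipDl, sipDr) (sipC y x).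
have : h x y + (h x y)^* <= (sinorm x * sinorm y) *+ 2.
  rewrite (le_trans (real_ler_norm _))//.
    by rewrite CrealE rmorphD/= conjCK addrC.
  by rewrite (le_trans (ler_normD _ _))// norm_conjC mulr2n lerD// sip_le.
move=> H; rewrite -subr_ge0.
have -> : h x x + (sinorm x * sinorm y) *+ 2 + h y y - (h x x + h x y + ((h x y)^* + h y y)) =
  (sinorm x * sinorm y) *+ 2 - (h x y + (h x y)^* ) by ring.
by rewrite subr_ge0.
Qed.

End SemiInnerTheory.

(** * Completion of a semi-inner product space *)

Lemma cplx_invn_lt (R : realType) (e : cplx R) : 0 < e ->
  exists N, forall n, (N <= n)%N -> n.+1%:R^-1 < e.
Proof.
move=> e0; have eE := Defs.Creal_Re (gtr0_real e0); set e' := complex.Re e in eE.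
have e'0 : 0 < e' by rewrite -ltcR -eE.
have e1 : 0 <= e'^-1 by rewrite invr_ge0 ltW.
exists (Num.truncn e'^-1) => n Nn; rewrite eE.
have -> : (n.+1%:R^-1 : cplx R) = (n.+1%:R^-1)%:C%C by rewrite fmorphV rmorph_nat.
rewrite ltcR invf_plt ?posrE//; have /andP[_ /lt_le_trans] := truncn_itv e1; apply.
by rewrite ler_nat ltnS.
Qed.

(** A Cauchy filter is followed by a sequence [v] in the dense set such that the filter contains the
    ball of radius [2 / (n + 1)] around [v n]; the limit of this sequence is a limit of the
    filter. *)
Lemma complete_of_dense_seq (R : realType) (W : normedModType (cplx R)) (D : set W) :
  (forall (x : W) (e : cplx R), 0 < e -> exists2 v, D v & `|x - v| < e) ->
  (forall u : nat -> W, (forall n, D (u n)) ->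
    (forall e : cplx R, 0 < e -> exists N, forall m n, (N <= m)%N -> (N <= n)%N -> `|u m - u n| < e) ->
    exists g, forall e : cplx R, 0 < e -> exists N, forall n, (N <= n)%N -> `|g - u n| < e) ->
  forall F : set_system W, ProperFilter F -> cauchy F -> cvg F.
Proof.
move=> dD seqD F FF /cauchyP cF.
have i0 (n : nat) : (0 : cplx R) < n.+1%:R^-1 by rewrite invr_gt0.
have /choice[v vP] : forall n : nat, exists v, D v /\ F [set y | `|v - y| < 2 * n.+1%:R^-1].
  move=> n; have [x Fx] := cF _ (i0 n); have [v Dv xv] := dD x _ (i0 n).
  exists v; split=> //; apply: filterS Fx => y; rewrite -ball_normE /= => xy.
  rewrite -[v](subrK x) -addrA (le_lt_trans (ler_normD _ _))//.
  have -> : 2 * n.+1%:R^-1 = n.+1%:R^-1 + n.+1%:R^-1 :> cplx R by rewrite mulr_natl.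
  by apply: ltrD => //; rewrite distrC.
have vC e : 0 < e -> exists N, forall m n, (N <= m)%N -> (N <= n)%N -> `|v m - v n| < e.
  move=> e0; have e4 : 0 < e / 4 by rewrite divr_gt0.
  have [N NP] := cplx_invn_lt e4; exists N => m n Nm Nn.
  have [y [/= my ny]] := filter_ex (filterI (vP m).2 (vP n).2).
  rewrite -[v m](subrK y) -addrA.
  rewrite (le_lt_trans (ler_normD _ _))// [X in _ + X]distrC (lt_le_trans (ltrD my ny))//.
  rewrite -mulrDr (le_trans (ler_wpM2l _ (lerD (ltW (NP _ Nm)) (ltW (NP _ Nn)))))//.
  by rewrite le_eqVlt; apply/orP; left; apply/eqP; field.
have [g gP] := seqD v (fun n => (vP n).1) vC.
apply/cvg_ex; exists g; apply/cvg_ballP => e e0; rewrite near_simpl.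
have e2 : 0 < e / 2 by rewrite divr_gt0.
have e4 : 0 < e / 4 by rewrite divr_gt0.
have [N NP] := cplx_invn_lt e4.
have [N' N'P] := gP _ e2.
pose n := maxn N N'.
apply: filterS (vP n).2 => y /= ny; rewrite -ball_normE/=.
rewrite -[g](subrK (v n)) -addrA (le_lt_trans (ler_normD _ _))//.
rewrite (splitr e) ltrD ?N'P ?leq_maxr// (lt_le_trans ny)//.
rewrite (le_trans (ler_wpM2l _ (ltW (NP _ (leq_maxl _ _)))))//.
by rewrite le_eqVlt; apply/orP; left; apply/eqP; field.
Qed.

Section Completion.
Variables (R : realType) (V : lmodType (cplx R)) (h : semi_inner V).
Local Notation C := (cplx R).
Local Notation q := (sinorm h).

Definition sicauchy (u : nat -> V) := forall e : C, 0 < e ->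
  exists N, forall m n, (N <= m)%N -> (N <= n)%N -> q (u m - u n) < e.

Definition sinull (u : nat -> V) := forall e : C, 0 < e ->
  exists N, forall n, (N <= n)%N -> q (u n) < e.

Definition sirep (u : nat -> V) (f : V -> C) :=
  sicauchy u /\ forall w, h (u n) w @[n --> \oo] --> f w.

Lemma sicauchy_cst v : sicauchy (fun=> v).
Proof.
by move=> e e0; exists 0%N => m n _ _; rewrite subrr /sinorm sip0l sqrtC0.
Qed.

Lemma sicauchy_lin c u v : sicauchy u -> sicauchy v -> sicauchy (fun n => c *: u n + v n).
Proof.
move=> uC vC e e0; have e2 : 0 < e / 2 by rewrite divr_gt0.
have c0 : 0 < 1 + `|c| by rewrite ltr_pwDl.
have [N NC] := uC _ (divr_gt0 e2 c0); have [N' NC'] := vC _ e2.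
exists (maxn N N') => m n; rewrite !geq_max => /andP[Nm N'm] /andP[Nn N'n].
have -> : c *: u m + v m - (c *: u n + v n) = c *: (u m - u n) + (v m - v n).
  by rewrite scalerBr opprD addrACA.
rewrite (le_lt_trans (sinormD _ _ _))// (splitr e) sinormZ ler_ltD//; last exact: NC'.
have /ltW := NC _ _ Nm Nn; rewrite ler_pdivlMr// mulrC; apply: le_trans.
by rewrite ler_wpM2r ?sinorm_ge0// lerDr.
Qed.

Lemma sicauchy_bounded u : sicauchy u ->
  exists (N : nat) (B : C), 0 < B /\ forall n, (N <= n)%N -> q (u n) <= B.
Proof.
move=> /(_ 1 ltr01)[N NC]; exists N, (1 + q (u N)).
split=> [|n Nn]; first by rewrite ltr_pwDl ?sinorm_ge0.
rewrite -[u n](subrK (u N)) (le_trans (sinormD _ _ _))// lerD2r ltW//; exact: NC.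
Qed.

Lemma sinull_sip u v : sinull u -> sicauchy v ->
  h (u n) (v n) @[n --> \oo] --> (0 : C) /\ h (v n) (u n) @[n --> \oo] --> (0 : C).
Proof.
move=> u0 /sicauchy_bounded[N [B [B0 vB]]].
have K e : 0 < e -> exists N', forall n, (N' <= n)%N -> q (u n) * q (v n) < e.
  move=> e0; have [N' uN'] := u0 _ (divr_gt0 e0 B0).
  exists (maxn N N') => n; rewrite geq_max => /andP[Nn N'n].
  rewrite (le_lt_trans (ler_wpM2l (sinorm_ge0 _ _) (vB _ Nn)))// -ltr_pdivlMr//; exact: uN'.
split; apply/cvgrPdist_lt => e e0; have [N' KN'] := K e e0; exists N' => // n /= N'n;
  rewrite sub0r normrN (le_lt_trans (sip_le _ _ _))//; last rewrite mulrC; exact: KN'.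
Qed.

Lemma sip_cvg u v : sicauchy u -> sicauchy v ->
  exists l : C, h (u n) (v n) @[n --> \oo] --> l.
Proof.
move=> uC vC; apply: cplx_cauchy_cvg => e e0.
have [N [B [B0 uB]]] := sicauchy_bounded uC; have [N' [B' [B'0 vB]]] := sicauchy_bounded vC.
have e2 : 0 < e / 2 by rewrite divr_gt0.
have [M MC] := uC _ (divr_gt0 e2 B'0); have [M' MC'] := vC _ (divr_gt0 e2 B0).
exists (maxn (maxn N N') (maxn M M')) => m n.
rewrite !geq_max => /andP[/andP[Nm N'm] /andP[Mm M'm]] /andP[/andP[Nn N'n] /andP[Mn M'n]].
have -> : h (u m) (v m) - h (u n) (v n) = h (u m - u n) (v m) + h (u n) (v m - v n).
  by rewrite sipBl sipBr addrA subrK.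
rewrite (le_lt_trans (ler_normD _ _))// (splitr e) ltrD// (le_lt_trans (sip_le _ _ _))//.
  rewrite (le_lt_trans (ler_wpM2l (sinorm_ge0 _ _) (vB _ N'm)))// -ltr_pdivlMr//; exact: MC.
rewrite (le_lt_trans (ler_wpM2r (sinorm_ge0 _ _) (uB _ Nn)))// mulrC -ltr_pdivlMr//; exact: MC'.
Qed.

(** A Cauchy sequence that tends weakly to 0 is null: split [h (u n) (u n)] as
    [h (u n - u m) (u n) + h (u m) (u n)]. The first term is small by the Cauchy property, the
    second by weak convergence against the fixed vector [u n]. *)
Lemma sirep_sinull u : sirep u (fun=> 0) -> sinull u.
Proof.
move=> [uC u0] e e0; have [N [B [B0 uB]]] := sicauchy_bounded uC.
have d0 : 0 < e ^+ 2 / 2 by rewrite divr_gt0 ?exprn_gt0.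
have [M MC] := uC _ (divr_gt0 d0 B0).
exists (maxn N M) => n; rewrite geq_max => /andP[Nn Mn].
have /cvgrPdist_lt/(_ _ d0)[M' _ H] := u0 (u n).
rewrite -(@ltr_pXn2r _ 2) ?nnegrE ?sinorm_ge0 ?(ltW e0)// sinormK.
rewrite -(ger0_norm (sip_ge0 h _)).
pose m := maxn M M'.
have -> : h (u n) (u n) = h (u n - u m) (u n) + h (u m) (u n) by rewrite sipBl subrK.
rewrite (le_lt_trans (ler_normD _ _))// (splitr (e ^+ 2)) ltrD//.
  rewrite (le_lt_trans (sip_le _ _ _))//.
  rewrite (le_lt_trans (ler_wpM2l (sinorm_ge0 _ _) (uB _ Nn)))// -ltr_pdivlMr//; apply: MC => //.
  exact: leq_maxl.
by have := H m (leq_maxr _ _); rewrite /= sub0r normrN.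
Qed.

Lemma sirep_lin c u v f g : sirep u f -> sirep v g ->
  sirep (fun n => c *: u n + v n) (fun w => c * f w + g w).
Proof.
move=> [uC uf] [vC vg]; split=> [|w]; first exact: sicauchy_lin.
under eq_fun do rewrite sip_linear.
by apply: cvgD => //; apply: cvgM => //; exact: cvg_cst.
Qed.

(** Representatives of the same functional differ by a null sequence, and a null sequence pairs to 0
    with a Cauchy one. This makes the inner product of the completion independent of
    representatives. *)
Lemma sirep_sip_unique u u' v v' f g (l : C) : sirep u f -> sirep u' f -> sirep v g -> sirep v' g ->
  h (u n) (v n) @[n --> \oo] --> l -> h (u' n) (v' n) @[n --> \oo] --> l.
Proof.
have diff w w' k : sirep w k -> sirep w' k -> sinull (fun n => - 1 *: w' n + w n).
  move=> wk w'k; apply: sirep_sinull.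
  have -> : (fun=> 0 : C) = (fun x => -1 * k x + k x).
    by apply/funext => x; rewrite mulN1r addNr.
  exact: sirep_lin.
move=> uf u'f vg v'g ul.
have [H1 _] := sinull_sip (diff _ _ _ uf u'f) vg.1.
have [_ H2] := sinull_sip (diff _ _ _ vg v'g) u'f.1.
rewrite -[l]subr0 -[l - 0]subr0.
have -> : (fun n => h (u' n) (v' n)) =
   (fun n => h (u n) (v n) - h (- 1 *: u' n + u n) (v n) - h (u' n) (- 1 *: v' n + v n)).
  apply/funext => n; rewrite !(sipDl, sipDr, scaleN1r, sipNl, sipNr); ring.
exact: (cvgB (cvgB ul H1) H2).
Qed.

(* Cauchy sequences u with null difference define the same functional
   w |-> lim_n h (u n) w, so taking these functionals as points avoids a quotient. *)
Definition hcompl_pred : pred (V -> C) := fun f => `[< exists u, sirep u f >].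

Lemma hcompl_submod : submod_closed hcompl_pred.
Proof.
split=> [|c f g]; rewrite ?unfold_in.
  apply/asboolP; exists (fun=> 0); split; first exact: sicauchy_cst.
  by move=> w; under eq_fun do rewrite sip0l; exact: cvg_cst.
move=> /asboolP[u uf] /asboolP[v vg]; apply/asboolP.
by exists (fun n => c *: u n + v n); exact: sirep_lin.
Qed.
HB.instance Definition _ := GRing.isSubmodClosed.Build C (V -> C) hcompl_pred
  (GRing.submod_closed_semi hcompl_submod).

Record hcompl := Hcompl { hcompl_val :> V -> C; _ : hcompl_pred hcompl_val }.
HB.instance Definition _ := [isSub for hcompl_val].
HB.instance Definition _ := [Choice of hcompl by <:].
HB.instance Definition _ := [SubChoice_isSubLmodule of hcompl by <:].

Lemma hcompl_repP (f : hcompl) : exists u, sirep u f.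
Proof. by case: f => f /= /asboolP. Qed.
Definition hcompl_rep (f : hcompl) : nat -> V := projT1 (cid (hcompl_repP f)).
Lemma hcompl_repE (f : hcompl) : sirep (hcompl_rep f) f.
Proof. exact: projT2 (cid (hcompl_repP f)). Qed.

Definition hcompl_inner (f g : hcompl) : C :=
  projT1 (cid (sip_cvg (hcompl_repE f).1 (hcompl_repE g).1)).

Lemma hcompl_inner_cvg u v (f g : hcompl) : sirep u f -> sirep v g ->
  h (u n) (v n) @[n --> \oo] --> hcompl_inner f g.
Proof.
move=> uf vg; apply: (sirep_sip_unique (hcompl_repE f) uf (hcompl_repE g) vg).
by rewrite /hcompl_inner; case: cid.
Qed.

Lemma hcompl_innerE u v (f g : hcompl) (l : C) : sirep u f -> sirep v g ->
  h (u n) (v n) @[n --> \oo] --> l -> hcompl_inner f g = l.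
Proof.
move=> uf vg ul; apply: cvg_unique ul => //; exact: hcompl_inner_cvg.
Qed.

Lemma hcompl_rep_lin c u v (x y : hcompl) : sirep u x -> sirep v y ->
  sirep (fun n => c *: u n + v n) (c *: x + y : hcompl).
Proof.
move=> ux vy; have -> : hcompl_val (c *: x + y) = (fun w => c * x w + y w) by [].
exact: sirep_lin.
Qed.

Lemma hcompl_inner_linear c (x y z : hcompl) :
  hcompl_inner (c *: x + y) z = c * hcompl_inner x z + hcompl_inner y z.
Proof.
have [xE yE zE] := And3 (hcompl_repE x) (hcompl_repE y) (hcompl_repE z).
refine (hcompl_innerE (hcompl_rep_lin c xE yE) zE _).
under eq_fun do rewrite sip_linear.
exact: (cvgD (cvgM (cvg_cst c) (hcompl_inner_cvg xE zE)) (hcompl_inner_cvg yE zE)).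
Qed.

Lemma cvg_conjC (T : Type) (F : set_system T) {FF : Filter F} (f : T -> C) (l : C) :
  f x @[x --> F] --> l -> (f x)^* @[x --> F] --> l^*.
Proof.
move=> /cvgrPdist_lt fl; apply/cvgrPdist_lt => e e0.
by near=> x; rewrite -rmorphB norm_conjC; near: x; exact: fl.
Unshelve. all: by end_near. Qed.

Lemma hcompl_innerC x y : hcompl_inner x y = (hcompl_inner y x)^*.
Proof.
have [xE yE] := conj (hcompl_repE x) (hcompl_repE y).
refine (hcompl_innerE xE yE _); under eq_fun do rewrite sipC.
exact: (cvg_conjC (hcompl_inner_cvg yE xE)).
Qed.

Lemma hcompl_inner_antilinear c (x y z : hcompl) :
  hcompl_inner z (c *: x + y) = c^* * hcompl_inner z x + hcompl_inner z y.
Proof.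
rewrite hcompl_innerC hcompl_inner_linear rmorphD rmorphM/=.
by rewrite [hcompl_inner z x]hcompl_innerC [hcompl_inner z y]hcompl_innerC.
Qed.

Lemma hcompl_inner_ge0 x : 0 <= hcompl_inner x x.
Proof.
have H := hcompl_inner_cvg (hcompl_repE x) (hcompl_repE x).
by refine (cvg_ge0 H _); apply: nearW => n; exact: sip_ge0.
Qed.

Definition hcompl_si : semi_inner hcompl :=
  SemiInner hcompl_inner_linear hcompl_inner_antilinear hcompl_inner_ge0.

Fact hcompl_in_pred v : hcompl_pred (h v).
Proof.
by apply/asboolP; exists (fun=> v); split=> [|w]; [exact: sicauchy_cst | exact: cvg_cst].
Qed.
Definition hcompl_in v : hcompl := Hcompl (hcompl_in_pred v).

Lemma hcompl_in_rep v : sirep (fun=> v) (hcompl_in v).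
Proof. by split=> [|w]; [exact: sicauchy_cst | exact: cvg_cst]. Qed.

Lemma hcompl_in_linear : linear hcompl_in.
Proof.
move=> c x y; apply: val_inj; apply/funext => w /=.
by rewrite sip_linear.
Qed.

Lemma hcompl_inner_in v w : hcompl_inner (hcompl_in v) (hcompl_in w) = h v w.
Proof. exact: (hcompl_innerE (hcompl_in_rep v) (hcompl_in_rep w) (cvg_cst _)). Qed.

Lemma hcompl_inner_inr (f : hcompl) w : hcompl_inner f (hcompl_in w) = f w.
Proof.
exact: (hcompl_innerE (hcompl_repE f) (hcompl_in_rep w) ((hcompl_repE f).2 w)).
Qed.

Lemma hcompl_inner_eq0 x : hcompl_inner x x = 0 -> x = 0.
Proof.
move=> x0; apply: val_inj; apply/funext => w /=.
have := sip_cauchy_schwarz hcompl_si x (hcompl_in w).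
rewrite /= x0 mul0r hcompl_inner_inr => H; apply/eqP.
by rewrite -normr_eq0 -sqrf_eq0 eq_le H exprn_ge0.
Qed.

Fact hcompl_norm_eq0 x : sinorm hcompl_si x = 0 -> x = 0.
Proof. by move=> x0; apply: hcompl_inner_eq0; rewrite -[LHS](sinormK hcompl_si x) x0 expr0n. Qed.

HB.instance Definition _ := Lmodule_isNormed.Build C hcompl
  (sinormD hcompl_si) (sinormZ hcompl_si) hcompl_norm_eq0.

Lemma hcompl_normE x : `|x| = sinorm hcompl_si x.
Proof. by []. Qed.

Lemma hcompl_norm2 (x : hcompl) : `|x| ^+ 2 = hcompl_inner x x.
Proof. exact: (sinormK hcompl_si x). Qed.

Lemma hcompl_norm_in v : `|hcompl_in v| = q v.
Proof. by rewrite hcompl_normE /sinorm /= hcompl_inner_in. Qed.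

Lemma hcompl_inB v w : hcompl_in (v - w) = hcompl_in v - hcompl_in w.
Proof. by rewrite addrC -scaleN1r hcompl_in_linear scaleN1r addrC. Qed.

(** For fixed [n] the difference [f - hcompl_in (u n)] is represented by [u m - u n] in the variable
    [m], so its norm is the limit of seminorms that the Cauchy property bounds. *)
Lemma sirep_dist u (f : hcompl) (e : C) : sirep u f -> 0 < e ->
  exists N, forall n, (N <= n)%N -> `|f - hcompl_in (u n)| < e.
Proof.
move=> uf e0; have e2 : 0 < e / 2 by rewrite divr_gt0.
have [N NC] := uf.1 _ e2; exists N => n Nn.
have H : sirep (fun m => - 1 *: u n + u m) (f - hcompl_in (u n)).
  have -> : hcompl_val (f - hcompl_in (u n)) = (fun w => -1 * hcompl_in (u n) w + f w).
    by apply/funext => w /=; rewrite mulN1r addrC.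
  exact: (sirep_lin (-1) (hcompl_in_rep (u n)) uf).
have Hc := hcompl_inner_cvg H H.
suff : hcompl_inner (f - hcompl_in (u n)) (f - hcompl_in (u n)) <= (e / 2) ^+ 2.
  rewrite -hcompl_norm2 ler_pXn2r ?nnegrE ?(ltW e2)// => /le_lt_trans; apply.
  by rewrite ltr_pdivrMr// ltr_pMr// ltr1n.
have Hd := cvgB (cvg_cst (F := \oo) ((e / 2) ^+ 2)) Hc.
rewrite -subr_ge0; refine (cvg_ge0 (Hd _ _) _); exists N => // m /= Nm.
rewrite /= subr_ge0 -sinormK ler_pXn2r ?nnegrE ?sinorm_ge0 ?(ltW e2)//.
by rewrite scaleN1r addrC ltW//; exact: NC.
Qed.

Lemma hcompl_dense (f : hcompl) (e : C) : 0 < e -> exists v, `|f - hcompl_in v| < e.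
Proof.
by move=> e0; have [N /(_ N (leqnn N))] := sirep_dist (hcompl_repE f) e0; exists (hcompl_rep f N).
Qed.

Fact hcompl_complete (F : set_system hcompl) : ProperFilter F -> cauchy F -> cvg F.
Proof.
apply: (@complete_of_dense_seq _ _ (range hcompl_in)).
- by move=> x e /hcompl_dense-/(_ x)[v xv]; exists (hcompl_in v) => //; exists v.
move=> u Du uC; have /choice[v vP] : forall n, exists v, hcompl_in v = u n.
  by move=> n; have [v _ <-] := Du n; exists v.
have vC : sicauchy v.
  move=> e e0; have [N NC] := uC e e0; exists N => m n Nm Nn.
  by rewrite -hcompl_norm_in hcompl_inB !vP; exact: NC.
(* The preimages [v] form a Cauchy sequence, and the functional that it represents is the limit. *)
have /choice[g gP] : forall w, exists l : C, h (v n) w @[n --> \oo] --> l.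
  by move=> w; apply: sip_cvg => //; exact: sicauchy_cst.
have vg : sirep v g by [].
have gp : hcompl_pred g by apply/asboolP; exists v.
exists (Hcompl gp) => e e0; have [N NP] := @sirep_dist v (Hcompl gp) _ vg e0.
by exists N => n /NP; rewrite vP.
Qed.

HB.instance Definition _ := Uniform_isComplete.Build hcompl hcompl_complete.

Fact hcompl_linearl y : linear_for ( *%R : C -> C -> C) (hcompl_inner ^~ y).
Proof. by move=> c x x'; exact: hcompl_inner_linear. Qed.
Fact hcompl_linearr x : linear_for (@Num.conj C \; *%R) (hcompl_inner x).
Proof. by move=> c y y'; exact: hcompl_inner_antilinear. Qed.
Fact hcompl_herm x y : hcompl_inner x y = (-1) ^+ false * (hcompl_inner y x)^*.
Proof. by rewrite expr0 mul1r hcompl_innerC. Qed.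
Fact hcompl_gt0 x : x != 0 -> 0 < hcompl_inner x x.
Proof.
move=> x0; rewrite lt_def hcompl_inner_ge0 andbT.
by apply: contraNneq x0 => /hcompl_inner_eq0 ->.
Qed.

HB.instance Definition _ := isBilinear.Build C hcompl hcompl
  C *%R (@Num.conj C \; *%R) hcompl_inner
  (fun y => zmod_morphism_linear (hcompl_linearl y))
  (fun x => zmod_morphism_linear (hcompl_linearr x))
  (fun y => scalable_linear (hcompl_linearl y))
  (fun x => scalable_linear (hcompl_linearr x)).
HB.instance Definition _ := isHermitianSesquilinear.Build C
  hcompl false (@Num.conj C) hcompl_inner hcompl_herm.
HB.instance Definition _ := isDotProduct.Build C hcompl hcompl_inner hcompl_gt0.

HB.instance Definition _ := isHilbert.Build R hcompl
  (hcompl_norm2 : forall x, `|x| ^+ 2 =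
    (hcompl_inner : {dot hcompl for (@Num.conj C)}) x x).

HB.instance Definition _ := GRing.isLinear.Build C V hcompl *:%R hcompl_in hcompl_in_linear.

End Completion.

Lemma hilbert_completion (R : realType) (V : lmodType (cplx R)) (h : semi_inner V) :
  exists (K : hilbertType R) (i : {linear V -> K}),
    (forall v w, '[i v, i w] = h v w) /\
   
    (forall (x : K) (e : cplx R), 0 < e -> exists v, `|x - i v| < e).
Proof.
exists (hcompl h : hilbertType R), (@hcompl_in R V h : {linear V -> hcompl h}); split.
- exact: hcompl_inner_in.
- exact: hcompl_dense.
Qed.

(** * Square roots in C*-algebras *)

Section CStarSquareRoot.
Variables (R : realType) (A : cstarAlgType R).
Local Notation C := (cplx R).
Implicit Types a b x y : A.

Lemma cnorm0 : cnorm (0 : A) = 0.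
Proof. by rewrite -(scale0r (1 : A)) cnormZ normr0 mul0r. Qed.

Lemma cnormN x : cnorm (- x) = cnorm x.
Proof. by rewrite -scaleN1r cnormZ normrN1 mul1r. Qed.

Lemma cnorm_ge0 x : 0 <= cnorm x.
Proof.
have := cnormD_le x (- x); rewrite subrr cnorm0 cnormN -mulr2n.
by rewrite pmulrn_lge0.
Qed.

Lemma cnormB_le x y z : cnorm (x - z) <= cnorm (x - y) + cnorm (y - z).
Proof. by have -> : x - z = (x - y) + (y - z); [rewrite addrA subrK | exact: cnormD_le]. Qed.

Lemma cnorm_starE x : cnorm (star x) = cnorm x.
Proof.
have le x' : cnorm x' <= cnorm (star x').
  have [->|x0] := eqVneq (cnorm x') 0; first exact: cnorm_ge0.
  have xp : 0 < cnorm x' by rewrite lt_def x0 cnorm_ge0.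
  by rewrite -(ler_pM2r xp) -expr2 -cnorm_star cnormM_le.
by apply/eqP; rewrite eq_le le andbT -{2}[x]starK le.
Qed.

Lemma star1 : star (1 : A) = 1.
Proof. by have := starM (star (1 : A)) 1; rewrite !mulr1 !starK mulr1. Qed.

Lemma star0 : star (0 : A) = 0.
Proof. by apply: (addrI (star 0)); rewrite -starD !addr0. Qed.

Lemma starN x : star (- x) = - star x.
Proof. by apply: (addrI (star x)); rewrite -starD !subrr star0. Qed.

Section Iteration.
Variable h : A.
Hypotheses (hs : star h = h) (hn : cnorm h <= 3 / 4).

(* A fixed point l = (h + l^2) / 2 satisfies (1 - l)^2 = 1 - h. *)
Fixpoint sqrt_iter (n : nat) : A :=
  if n is m.+1 then 2^-1 *: (h + sqrt_iter m * sqrt_iter m) else 0.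
Local Notation y := sqrt_iter.

Lemma sqrt_iter_star n : star (y n) = y n.
Proof.
elim: n => [|n IH] /=; first exact: star0.
by rewrite starZ starD starM IH hs fmorphV rmorph_nat.
Qed.

(** The constant [3 / 4] is chosen so that the ball of radius [1 / 2] is preserved:
    [(3/4 + 1/4) / 2 = 1/2]. *)
Lemma sqrt_iter_norm n : cnorm (y n) <= 2^-1.
Proof.
elim: n => [|n IH] /=; first by rewrite cnorm0 invr_ge0.
rewrite cnormZ normfV normr_nat -[leRHS]mulr1 ler_wpM2l ?invr_ge0//.
have -> : 1 = 3 / 4 + 2^-1 * 2^-1 :> C by field.
rewrite (le_trans (cnormD_le _ _))// lerD// (le_trans (cnormM_le _ _))//.
by rewrite ler_pM ?cnorm_ge0.
Qed.

Lemma cnorm_sqrB_le x x' (m m' : C) : cnorm x <= m -> cnorm x' <= m' ->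
  cnorm (x * x - x' * x') <= (m + m') * cnorm (x - x').
Proof.
move=> xm x'm.
have -> : x * x - x' * x' = x * (x - x') + (x - x') * x'.
  by rewrite mulrBr mulrBl addrA subrK.
rewrite (le_trans (cnormD_le _ _))// [leRHS]mulrDl lerD// (le_trans (cnormM_le _ _))//.
  by rewrite ler_wpM2r ?cnorm_ge0.
by rewrite mulrC ler_wpM2r ?cnorm_ge0.
Qed.

(** On the ball of radius [1 / 2] squaring is Lipschitz with constant 1, so that the iteration
    contracts by [1 / 2]. *)
Lemma sqrt_iter_step n : cnorm (y n.+1 - y n) <= 2^-1 ^+ n.+1.
Proof.
elim: n => [|n IH].
  rewrite /= mulr0 addr0 subr0 cnormZ normfV normr_nat expr1 ler_piMr ?invr_ge0//.
  by rewrite (le_trans hn)// ler_pdivrMr// mul1r ler_nat.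
have -> : y n.+2 - y n.+1 = 2^-1 *: (y n.+1 * y n.+1 - y n * y n).
  by rewrite [in LHS]/= -scalerBr opprD addrACA subrr add0r.
rewrite cnormZ normfV normr_nat exprS ler_wpM2l ?invr_ge0//.
rewrite (le_trans (cnorm_sqrB_le (sqrt_iter_norm _) (sqrt_iter_norm _)))//.
by rewrite (_ : 2^-1 + 2^-1 = 1 :> C) ?mul1r//; field.
Qed.

Lemma sqrt_iter_dist n k : cnorm (y (n + k)%N - y n) <= 2^-1 ^+ n.
Proof.
(* The sharper bound, a partial geometric sum, is the one that passes through the induction on
   [k]. *)
suff : cnorm (y (n + k)%N - y n) <= 2^-1 ^+ n - 2^-1 ^+ (n + k)%N.
  by move/le_trans; apply; rewrite gerBl exprn_ge0 ?invr_ge0.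
elim: k => [|k IH]; first by rewrite addn0 !subrr cnorm0.
rewrite addnS (le_trans (cnormB_le _ (y (n + k)%N) _))//.
rewrite (le_trans (lerD (sqrt_iter_step _) IH))// exprS.
by rewrite le_eqVlt; apply/orP; left; apply/eqP; field.
Qed.

Lemma half_expn_le n : 2^-1 ^+ n <= n.+1%:R^-1 :> C.
Proof.
rewrite exprVn lef_pV2 ?posrE ?exprn_gt0// -natrX ler_nat.
exact: ltn_expl.
Qed.

Lemma cstar_sqrt : exists b, star b = b /\ b * b = 1 - h.
Proof.
have yC e : 0 < e -> exists N, forall m n, (N <= m)%N -> (N <= n)%N -> cnorm (y m - y n) < e.
  move=> e0; have [N NP] := cplx_invn_lt e0; exists N.
  have K m n : (N <= n)%N -> (n <= m)%N -> cnorm (y m - y n) < e.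
    move=> Nn nm; rewrite -(subnKC nm) (le_lt_trans (sqrt_iter_dist _ _))//.
    by rewrite (le_lt_trans (half_expn_le _))// NP.
  move=> m n Nm Nn; have [nm|/ltnW mn] := leqP n m; first exact: K.
  by rewrite -cnormN opprB; exact: K.
have [l lP] := cnorm_complete y yC.
(* An element whose norm is at most a fixed multiple of the distance from [y n] to [l], for all
   large [n], is zero. *)
have small x (M : C) : (forall e, 0 < e -> exists N, forall n, (N <= n)%N -> cnorm (y n - l) < e ->
     cnorm x <= M * e) -> x = 0.
  move=> H; apply: cnorm_eq0; apply/eqP; rewrite eq_le cnorm_ge0 andbT.
  have [M0|M0] : M <= 0 \/ 0 < M.
    have [N NP] := H 1 ltr01; have [N' N'P] := lP 1 ltr01.
    have : 0 <= M.
      have := NP _ (leq_maxl N N') (N'P _ (leq_maxr N N')); rewrite mulr1; apply: le_trans.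
      exact: cnorm_ge0.
    by rewrite le_eqVlt => /orP[/eqP <-|]; [left|right].
    have [N NP] := H 1 ltr01; have [N' N'P] := lP 1 ltr01.
    have := NP _ (leq_maxl N N') (N'P _ (leq_maxr N N')); rewrite mulr1 => /le_trans; apply.
    exact: M0.
  apply/ler_addgt0Pl => e e0; rewrite addr0.
  have d0 : 0 < e / M by rewrite divr_gt0.
  have [N NP] := H _ d0; have [N' N'P] := lP _ d0.
  have := NP _ (leq_maxl N N') (N'P _ (leq_maxr N N')).
  by rewrite mulrC divfK// gt_eqF.
have ls : star l = l.
  apply/eqP; rewrite -subr_eq0; apply/eqP; apply: (small _ 2) => e e0; exists 0%N => n _ /ltW yl.
  rewrite (le_trans (cnormB_le _ (y n) _))// mulr_natl mulr2n lerD//.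
  have -> : star l - y n = star (l - y n) by rewrite starD starN sqrt_iter_star.
  by rewrite cnorm_starE -cnormN opprB.
(* The fixed point equation in the limit. The constant [3 + cnorm l] covers [cnorm (y n.+1 - l)] and
   half the Lipschitz constant [cnorm l + 2^-1] of squaring. *)
have ly : 2^-1 *: (h + l * l) = l.
  apply/eqP; rewrite -subr_eq0; apply/eqP; apply: (small _ (3 + cnorm l)) => e e0.
  have [N NP] := lP e e0; exists N => n Nn /ltW yl.
  rewrite (le_trans (cnormB_le _ (y n.+1) _))//.
  have y1 : cnorm (y n.+1 - l) <= e by rewrite ltW// NP// leqW.
  rewrite mulrDl addrC (_ : 3 * e = e + 2 * e :> C); last by ring.
  rewrite -addrA lerD//= -scalerBr opprD addrACA subrr add0r cnormZ normfV normr_nat.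
  rewrite (le_trans (ler_wpM2l _ (cnorm_sqrB_le (lexx (cnorm l)) (sqrt_iter_norm n)))) ?invr_ge0//.
  rewrite -(cnormN (l - y n)) opprB mulrA (le_trans (ler_wpM2l _ yl))//.
    by rewrite mulr_ge0 ?invr_ge0// addr_ge0 ?cnorm_ge0 ?invr_ge0.
  rewrite -mulrDl ler_wpM2r// ?(ltW e0)// mulrDr [leRHS]addrC lerD//.
    by rewrite ler_piMl ?cnorm_ge0// invf_le1// ler1n.
  by rewrite -subr_ge0 (_ : 2 - 2^-1 * 2^-1 = 7 / 4 :> C) ?divr_ge0//; field.
exists (1 - l); rewrite starD starN star1 ls; split=> //.
have hl : h = l + l - l * l.
  have : h + l * l = l + l.
    by rewrite -mulr2n -scaler_nat -[in RHS]ly scalerA mulfV ?scale1r// pnatr_eq0.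
  by move=> <-; rewrite addrK.
by rewrite hl mulrBr mulr1 mulrBl mul1r !opprB opprD !addrA; congr (_ - _); rewrite addrAC.
Qed.

End Iteration.

(** Scaling [star a * a] by [s] brings it into the ball of radius [3 / 4], where [cstar_sqrt]
    applies; the summand 1 in [k] keeps it nonzero. Positivity of [M - a^* a] in this explicit form
    bounds left multiplication by [a] in the Stinespring space. *)
Lemma cstar_dominated a : exists (M : C) b, 0 < M /\ M *: 1 - star a * a = star b * b.
Proof.
pose k : C := 1 + cnorm a ^+ 2.
have k0 : 0 < k by rewrite ltr_pwDl// exprn_ge0// cnorm_ge0.
pose s : C := 3 / 4 / k; have s0 : 0 < s by rewrite !divr_gt0.
have [||b [bs bb]] := @cstar_sqrt (s *: (star a * a)).
- by rewrite starZ starM starK (conj_Creal (gtr0_real s0)).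
- rewrite cnormZ cnorm_star (gtr0_norm s0) /s mulrAC ler_pdivrMr// ler_wpM2l ?divr_ge0//.
  by rewrite /k lerDr.
exists s^-1, (sqrtC s^-1 *: b); split; first by rewrite invr_gt0.
have q0 : 0 <= sqrtC s^-1 by rewrite sqrtC_ge0 invr_ge0 ltW.
rewrite starZ (conj_Creal (ger0_real q0)) -scalerAl -scalerAr scalerA bs bb -expr2 sqrtCK.
by rewrite scalerBr scalerA mulVf ?scale1r// gt_eqF.
Qed.

End CStarSquareRoot.

(** * Operators on Hilbert spaces *)

Section BoundedOperatorTheory.
Variable R : realType.
Local Notation C := (cplx R).
Implicit Types G H K L : hilbertType R.

Lemma bop_sumE (I : Type) (r : seq I) (P : pred I) H K (F : I -> 'B(H, K)) x :
  (\sum_(i <- r | P i) F i) x = \sum_(i <- r | P i) F i x.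
Proof. by elim/big_rec2: _ => // i y1 y2 _ <-. Qed.

Lemma bopD H K (T : 'B(H, K)) x y : T (x + y) = T x + T y.
Proof. exact: linearD. Qed.

Lemma bopB H K (T : 'B(H, K)) x y : T (x - y) = T x - T y.
Proof. exact: linearB. Qed.

Lemma bopZ H K (T : 'B(H, K)) c x : T (c *: x) = c *: T x.
Proof. exact: linearZ. Qed.

Lemma bop0 H K (T : 'B(H, K)) : T 0 = 0.
Proof. exact: linear0. Qed.

Lemma bop_sum (I : Type) (r : seq I) (P : pred I) H K (T : 'B(H, K)) (F : I -> H) :
  T (\sum_(i <- r | P i) F i) = \sum_(i <- r | P i) T (F i).
Proof. exact: linear_sum. Qed.

Lemma bop_compE H K L (S : 'B(K, L)) (T : 'B(H, K)) x : (S \oB T) x = S (T x).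
Proof. by []. Qed.

Lemma bopBE H K (S T : 'B(H, K)) x : (S - T) x = S x - T x.
Proof. by []. Qed.

Lemma bopP H K (S T : 'B(H, K)) : (forall x, S x = T x) -> S = T.
Proof. by move=> /bop_eqP. Qed.

Lemma adjE H K (T : 'B(H, K)) x y : '[adj T x, y] = '[x, T y].
Proof. by rewrite innerC -adjP -innerC. Qed.

Lemma adjK H K (T : 'B(H, K)) : adj (adj T) = T.
Proof. by apply/esym/adj_unique => x y; rewrite adjE. Qed.

Lemma adjD H K (S T : 'B(H, K)) : adj (S + T) = adj S + adj T.
Proof.
by apply/esym/adj_unique => x y; rewrite !bopDE linearDl linearDr /= !adjP.
Qed.

Lemma adjZ H K c (T : 'B(H, K)) : adj (c *: T) = c^* *: adj T.
Proof.
by apply/esym/adj_unique => x y; rewrite !bopZE linearZl_LR linearZr_LR /= conjCK adjP.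
Qed.

Lemma adj0 H K : adj (0 : 'B(H, K)) = 0.
Proof. by apply/esym/adj_unique => x y; rewrite !bop0E linear0l linear0r. Qed.

Lemma adjN H K (T : 'B(H, K)) : adj (- T) = - adj T.
Proof. by rewrite -scaleN1r adjZ rmorphN1 scaleN1r. Qed.

Lemma adjB H K (S T : 'B(H, K)) : adj (S - T) = adj S - adj T.
Proof. by rewrite adjD adjN. Qed.

Lemma adj_comp H K L (S : 'B(K, L)) (T : 'B(H, K)) : adj (S \oB T) = adj T \oB adj S.
Proof. by apply/esym/adj_unique => x y; rewrite /= !adjP. Qed.

Lemma adj_id H : adj (bop_id H) = bop_id H.
Proof. by apply/esym/adj_unique. Qed.

Lemma adj_sum (I : Type) (r : seq I) (P : pred I) H K (F : I -> 'B(H, K)) :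
  adj (\sum_(i <- r | P i) F i) = \sum_(i <- r | P i) adj (F i).
Proof. by elim/big_rec2: _ => [|i y1 y2 _ <-]; [exact: adj0 | exact: adjD]. Qed.

Lemma inner_suml (I : Type) (r : seq I) (P : pred I) H (F : I -> H) y :
  '[\sum_(i <- r | P i) F i, y] = \sum_(i <- r | P i) '[F i, y].
Proof. by elim/big_rec2: _ => [|i y1 y2 _ <-]; [exact: linear0l | exact: linearDl]. Qed.

Lemma inner_sumr (I : Type) (r : seq I) (P : pred I) H (F : I -> H) y :
  '[y, \sum_(i <- r | P i) F i] = \sum_(i <- r | P i) '[y, F i].
Proof. by elim/big_rec2: _ => [|i y1 y2 _ <-]; [exact: linear0r | exact: linearDr]. Qed.

Lemma innerZl H c (x y : H) : '[c *: x, y] = c * '[x, y].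
Proof. exact: linearZl_LR. Qed.

Lemma innerZr H c (x y : H) : '[x, c *: y] = c^* * '[x, y].
Proof. exact: linearZr_LR. Qed.

Lemma innerDl H (x y z : H) : '[x + y, z] = '[x, z] + '[y, z].
Proof. exact: linearDl. Qed.

Lemma innerDr H (x y z : H) : '[z, x + y] = '[z, x] + '[z, y].
Proof. exact: linearDr. Qed.

Lemma innerBl H (x y z : H) : '[x - y, z] = '[x, z] - '[y, z].
Proof. exact: linearBl. Qed.

Lemma innerBr H (x y z : H) : '[z, x - y] = '[z, x] - '[z, y].
Proof. exact: linearBr. Qed.

Lemma inner0l H (x : H) : '[0, x] = 0.
Proof. exact: linear0l. Qed.

Lemma inner0r H (x : H) : '[x, 0] = 0.
Proof. exact: linear0r. Qed.

Lemma inner_ge0 H (x : H) : 0 <= '[x, x].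
Proof. by rewrite -normr_inner exprn_ge0. Qed.

Lemma inner_eq0 H (x : H) : '[x, x] = 0 -> x = 0.
Proof. by rewrite -normr_inner => /eqP; rewrite sqrf_eq0 normr_eq0 => /eqP. Qed.

Lemma normr_sqr_le H K (x : H) (y : K) (M : C) : 0 <= M ->
  '[x, x] <= M ^+ 2 * '[y, y] -> `|x| <= M * `|y|.
Proof. by move=> M0; rewrite -!normr_inner -exprMn ler_pXn2r ?nnegrE ?mulr_ge0. Qed.

Lemma bop_ext H K (S T : 'B(H, K)) : (forall x y, '[S x, y] = '[T x, y]) -> S = T.
Proof.
move=> ST; apply: bopP => x; apply: inner_eq => z.
by rewrite innerC ST -innerC.
Qed.

Lemma adj_comp_eq0 H K (T : 'B(H, K)) x : adj T (T x) = 0 -> T x = 0.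
Proof. by move=> T0; apply: inner_eq0; rewrite adjP T0 inner0r. Qed.

Lemma bop_form_eq0 H (T : 'B(H)) : (forall x, '[T x, x] = 0) -> T = 0.
Proof.
move=> T0; apply: bop_ext => x y; rewrite bop0E inner0l.
have e c : c^* * '[T x, y] + c * '[T y, x] = 0.
  have := T0 (x + c *: y).
  have -> : T (x + c *: y) = T x + c *: T y by rewrite linearD linearZ.
  by rewrite !(innerDl, innerDr, innerZl, innerZr) !T0 !mulr0 addr0 add0r.
have := e 1; have := e 'i; rewrite rmorph1 !mul1r conjCi mulNr => /eqP.
rewrite addrC subr_eq0 => /eqP/(mulfI (neq0Ci _)) -> /eqP.
by rewrite -mulr2n mulrn_eq0 /= => /eqP.
Qed.

Lemma bop_eq_form H (S T : 'B(H)) : (forall x, '[S x, x] = '[T x, x]) -> S = T.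
Proof.
move=> ST; apply/eqP; rewrite -subr_eq0; apply/eqP/bop_form_eq0 => x.
by rewrite bopBE innerBl ST subrr.
Qed.

Lemma isometricP H K (W : 'B(H, K)) : isometric W <-> adj W \oB W = bop_id H.
Proof.
split=> [iW|WW x].
  by apply: bop_eq_form => x; rewrite /= adjE -!normr_inner iW.
apply/eqP; rewrite -(@eqrXn2 _ 2)// !normr_inner adjP.
by move/bop_eqP: WW => /(_ x) /= ->.
Qed.

(** The map is given by its graph because it will be prescribed on formal combinations of vectors:
    the bound, applied to differences, is also what makes the graph single-valued. *)
Lemma bop_extend K L (Gr : K -> L -> Prop) (M : C) : 0 <= M ->
  (forall c x y x' y', Gr x y -> Gr x' y' -> Gr (c *: x + x') (c *: y + y')) ->
  (forall x y, Gr x y -> `|y| <= M * `|x|) ->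
  (forall x e, 0 < e -> exists x' y', Gr x' y' /\ `|x - x'| < e) ->
  exists F : 'B(K, L), forall x y, Gr x y -> F x = y.
Proof.
move=> M0 GrL GrM GrD.
have GrB x y x' y' : Gr x y -> Gr x' y' -> `|y' - y| <= M * `|x' - x|.
  move=> xy x'y'; have := GrL (-1) _ _ _ _ xy x'y'; rewrite !scaleN1r => /GrM.
  by rewrite ![- _ + _]addrC.
have M1 : 0 < M + 1 by rewrite ltr_wpDl.
(* The value at [x] is the limit of the Cauchy filter of the values taken at points near [x]. *)
have near_graph x : exists y, forall e, 0 < e ->
    exists x' y', [/\ Gr x' y', `|x - x'| < e & `|y - y'| < e].
  pose F := filter_from [set e : C | 0 < e]
    (fun e => [set y | exists2 x', Gr x' y & `|x - x'| < e]).
  have FF : ProperFilter F.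
    apply: filter_from_proper; last first.
      by move=> e e0; have [x' [y' [xy' xx']]] := GrD x e e0; exists y', x'.
    apply: filter_from_filter; first by exists 1 => /=.
    move=> e e' /= e0 e'0; have [ee'|ee'] := real_leP (gtr0_real e0) (gtr0_real e'0).
      by exists e => // y [x' G xx']; split; exists x' => //; apply: lt_le_trans ee'.
    by exists e' => // y [x' G xx']; split; exists x' => //; apply: lt_trans ee'.
  have : cauchy F.
    apply: cauchy_exP => e e0.
    have d0 : 0 < e / 2 / (M + 1) by rewrite !divr_gt0.
    have [x0 [y0 [G0 x00]]] := GrD x _ d0.
    exists y0; exists (e / 2 / (M + 1)) => // y [x' G xx'].
    rewrite -ball_normE /= (le_lt_trans (GrB _ _ _ _ G G0))//.
    rewrite (@le_lt_trans _ _ ((M + 1) * `|x0 - x'|))//.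
      by rewrite ler_wpM2r// lerDl.
    rewrite -ltr_pdivlMl// mulrC -[x0](subrK x) -addrA (le_lt_trans (ler_normD _ _))//.
    rewrite (_ : e / (M + 1) = e / 2 / (M + 1) + e / 2 / (M + 1)); last first.
      by rewrite -mulrDl -splitr.
    by rewrite ltrD// distrC.
  move=> /cauchy_cvg/cvg_ex[y Fy]; exists y => e e0.
  have FB : F [set z | `|y - z| < e].
    by have := Fy _ (nbhsx_ballx y e e0); rewrite -ball_normE.
  have Fe : F [set z | exists2 x', Gr x' z & `|x - x'| < e] by exists e.
  have [y' [/= yy' [x' G xx']]] := filter_ex (filterI FB Fe).
  by exists x', y'.
have approx0 x y : (forall e, 0 < e -> exists x' y', [/\ Gr x' y', `|x - x'| < e & `|y - y'| < e]) ->
    `|y| <= M * `|x|.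
  move=> H; apply/ler_addgt0Pl => e e0.
  have d0 : 0 < e / (M + 1) by rewrite divr_gt0.
  have [x' [y' [G xx' yy']]] := H _ d0.
  rewrite -[y](subrK y') (le_trans (ler_normD _ _))//.
  rewrite (le_trans (lerD (ltW yy') (GrM _ _ G)))//.
  rewrite -[x'](subrK x) (le_trans (lerD (lexx _) (ler_wpM2l M0 (ler_normD _ _))))//.
  rewrite mulrDr addrA lerD2r distrC.
  rewrite (le_trans (lerD (lexx _) (ler_wpM2l M0 (ltW xx'))))//.
  by rewrite -[X in X + _]mul1r -mulrDl [1 + M]addrC mulrC divfK// gt_eqF.
have [f fP] := choice near_graph.
have approx_lin c x y x' y' :
   (forall e, 0 < e -> exists z w, [/\ Gr z w, `|x - z| < e & `|y - w| < e]) ->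
   (forall e, 0 < e -> exists z w, [/\ Gr z w, `|x' - z| < e & `|y' - w| < e]) ->
   forall e, 0 < e -> exists z w, [/\ Gr z w, `|(c *: x + x') - z| < e & `|(c *: y + y') - w| < e].
  move=> H H' e e0; have c1 : 0 < 1 + `|c| by rewrite ltr_pwDl.
  have e2 : 0 < e / 2 by rewrite divr_gt0.
  have [z [w [G1 xz yw]]] := H _ (divr_gt0 e2 c1).
  have [z' [w' [G2 xz' yw']]] := H' _ e2.
  have est (U : hilbertType R) (a b a' b' : U) : `|a - b| < e / 2 / (1 + `|c|) -> `|a' - b'| < e / 2 ->
     `|(c *: a + a') - (c *: b + b')| < e.
    move=> h1 h2; have -> : (c *: a + a') - (c *: b + b') = c *: (a - b) + (a' - b').
      by rewrite scalerBr opprD addrACA.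
    rewrite (le_lt_trans (ler_normD _ _))// (splitr e) normrZ ler_ltD//.
    move: h1 => /ltW; rewrite ler_pdivlMr// mulrC; apply: le_trans.
    by rewrite ler_wpM2r// lerDr.
  by exists (c *: z + z'), (c *: w + w'); split; [exact: GrL | exact: est | exact: est].
(* The bound survives the closure of the graph, so the closure is single-valued too; linearity and
   the extension property follow from this. *)
have uniq x y : (forall e, 0 < e -> exists x' y', [/\ Gr x' y', `|x - x'| < e & `|y - y'| < e]) ->
    f x = y.
  move=> H; apply/eqP; rewrite -subr_eq0 -normr_le0.
  have := approx0 _ _ (approx_lin (-1) _ _ _ _ H (fP x)).
  by rewrite !scaleN1r addNr normr0 mulr0 addrC.
have fb : bounded_linear f.
  apply/asboolP; split=> [c x y|]; first exact: uniq (approx_lin _ _ _ _ _ (fP x) (fP y)).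
  by exists M => // x; exact: approx0 _ _ (fP x).
exists (Bop fb) => x y xy /=; apply: uniq => e e0; exists x, y.
by rewrite !subrr !normr0.
Qed.

End BoundedOperatorTheory.

(** * Finite-dimensional spaces: orthonormal bases and positive operators *)

Section FiniteDimension.
Variable R : realType.
Local Notation C := (cplx R).
Implicit Types G H K L : hilbertType R.

Fact rank1_bounded H K (y : H) (z : K) : bounded_linear (fun x : H => '[x, y] *: z).
Proof.
apply/asboolP; split=> [c x x'|]; first by rewrite innerDl innerZl scalerDl scalerA.
exists (`|y| * `|z|) => [|x]; first exact: mulr_ge0.
by rewrite normrZ mulrAC ler_wpM2r// mulrC cauchy_schwarz.
Qed.
Definition rank1 H K (y : H) (z : K) : 'B(H, K) := Bop (rank1_bounded y z).

Lemma rank1E H K (y : H) (z : K) x : rank1 y z x = '[x, y] *: z.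
Proof. by []. Qed.

Lemma adj_rank1 H K (y : H) (z : K) : adj (rank1 y z) = rank1 z y.
Proof.
apply/esym/adj_unique => x x'; rewrite !rank1E innerZl innerZr -innerC; exact: mulrC.
Qed.

(** Dependent vectors are not dropped: they produce [u s = 0]. The indices therefore stay aligned,
    and [v t] involves only [u s] with [s <= t], which later makes a Gram factor triangular. *)
Lemma gram_schmidt H (v : nat -> H) n : exists u : nat -> H,
  [/\ forall s t, s != t -> '[u s, u t] = 0, forall s, u s = 0 \/ '[u s, u s] = 1 &
      forall t, (t < n)%N -> v t = \sum_(s < t.+1) '[v t, u s] *: u s].
Proof.
(* The induction also records that [u] vanishes from [n] on, so that its value at [n] is free to be
   set. *)
suff [u [ou nu vu _]] : exists u : nat -> H,
  [/\ forall s t, s != t -> '[u s, u t] = 0, forall s, u s = 0 \/ '[u s, u s] = 1,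
      forall t, (t < n)%N -> v t = \sum_(s < t.+1) '[v t, u s] *: u s &
      forall s, (n <= s)%N -> u s = 0] by exists u.
elim: n => [|n [u [ou nu vu u0]]].
  by exists (fun=> 0); split=> // [s t _|s]; [exact: inner0l | left].
pose w := v n - \sum_(s < n) '[v n, u s] *: u s.
have wu s : '[w, u s] = 0.
  rewrite innerBl inner_suml; have [sn|ns] := ltnP s n; last first.
    by rewrite (u0 _ ns) inner0r big1 ?subr0// => i _; rewrite inner0r.
  rewrite (bigD1 (Ordinal sn))//= big1 => [|i /eqP isn].
    rewrite addr0 innerZl; case: (nu s) => ->; rewrite ?mulr1 ?subrr//.
    by rewrite !inner0r mulr0 subr0.
  by rewrite innerZl ou ?mulr0//; apply/eqP => e; apply: isn; apply: val_inj.
have uw s : '[u s, w] = 0 by rewrite innerC wu conjC0.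
pose w' := `|w|^-1 *: w.
exists (fun s => if s == n then w' else u s); split.
- move=> s t st; have [sn|sn] := eqVneq s n; have [tn|tn] := eqVneq t n.
  + by rewrite sn tn eqxx in st.
  + by rewrite innerZl wu mulr0.
  + by rewrite innerZr uw mulr0.
  + exact: ou.
- move=> s; case: eqP => _; last exact: nu.
  have [w0|wn] := eqVneq w 0; first by left; rewrite /w' w0 scaler0.
  by right; rewrite -normr_inner normrZ normfV normr_id mulVf ?expr1n// normr_eq0.
- move=> t; rewrite ltnS leq_eqVlt => /orP[/eqP ->|tn]; last first.
    rewrite {1}(vu _ tn); apply: eq_bigr => s _.
    by case: eqP => // e; have := leq_trans (ltn_ord s) tn; rewrite e ltnn.
  rewrite big_ord_recr /= eqxx (eq_bigr (fun s : 'I_n => '[v n, u s] *: u s)); last first.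
    by move=> s _; case: eqP => // e; have := ltn_ord s; rewrite e ltnn.
  have -> : '[v n, w'] *: w' = w.
    have [w0|wn] := eqVneq w 0; first by rewrite /w' w0 !scaler0.
    have -> : '[v n, w'] = '[w, w'].
      rewrite -{1}(subrK (\sum_(s < n) '[v n, u s] *: u s) (v n)) -/w innerDl inner_suml big1 ?addr0//.
      by move=> s _; rewrite innerZl innerZr uw !mulr0.
    rewrite innerZr (conj_Creal ((_ : `|w|^-1 \is Num.real))) ?rpredV ?normr_real// -normr_inner scalerA.
    by rewrite mulrC mulrA -invfM -expr2 mulVf ?scale1r// sqrf_eq0 normr_eq0.
  by rewrite /w addrC subrK.
- by move=> s ns; case: eqP => [e|_]; [rewrite e ltnn in ns | rewrite u0// ltnW].
Qed.

Definition onb H d (e : 'I_d -> H) : Prop :=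
  (forall i j, '[e i, e j] = (i == j)%:R) /\ (forall x, x = \sum_i '[x, e i] *: e i).

(** Gram-Schmidt on a spanning family, extended by 0 beyond [d]; the zero vectors are then discarded
    by enumerating the set [S] of the others. *)
Lemma onb_exists H : finite_dimensional H -> exists d (e : 'I_d -> H), onb e.
Proof.
move=> [d [f fspan]].
pose v (n : nat) := if insub n is Some i then f i else 0.
have [u [ou nu vu]] := gram_schmidt v d.
have pu (x : H) : x = \sum_(s < d) '[x, u s] *: u s.
  have us (t : nat) : (t < d)%N -> \sum_(s < d) '[u t, u s] *: u s = u t.
    move=> td; rewrite (bigD1 (Ordinal td))//= big1 => [|i it].
      by rewrite addr0; case: (nu t) => [->|->]; rewrite ?scaler0 ?scale1r.
    by rewrite ou ?scale0r//; apply: contraNneq it => e; apply/eqP/val_inj.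
  have fv i : f i = \sum_(s < d) '[f i, u s] *: u s.
    have -> : f i = v i by rewrite /v valK.
    rewrite {2}(vu i (ltn_ord i)) {1}(vu i (ltn_ord i)).
    under [RHS]eq_bigr do rewrite inner_suml scaler_suml.
    rewrite exchange_big; apply: eq_bigr => s _.
    under eq_bigr do rewrite innerZl -scalerA.
    by rewrite -scaler_sumr us// (leq_trans (ltn_ord s) (ltn_ord i)).
  have [c ->] := fspan x.
  under [RHS]eq_bigr do rewrite inner_suml scaler_suml.
  rewrite exchange_big; apply: eq_bigr => i _.
  under eq_bigr do rewrite innerZl -scalerA.
  by rewrite -scaler_sumr -fv.
pose S := [set s : 'I_d | u s != 0]%SET.
exists #|S|, (fun k : 'I_#|S| => u (enum_val k : 'I_d)); split=> [i j|x].
  have [->|ij] := eqVneq i j; last first.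
    by rewrite ou//; apply: contraNneq ij => /val_inj/enum_val_inj ->.
  by have := enum_valP j; rewrite inE; case: (nu (enum_val j)) => [->|->//]; rewrite eqxx.
transitivity (\sum_(s in S) '[x, u s] *: u s); last by rewrite big_enum_val.
rewrite {1}(pu x) [LHS](bigID (mem S))/=.
rewrite [X in _ + X]big1 ?addr0// => s; rewrite inE negbK => /eqP ->.
by rewrite scaler0.
Qed.

Section WithBasis.
Variables (H : hilbertType R) (d : nat) (e : 'I_d -> H).
Hypothesis oe : onb e.

Lemma onb_inner (c : 'I_d -> C) j : '[\sum_i c i *: e i, e j] = c j.
Proof.
rewrite inner_suml (bigD1 j)//= big1 ?addr0 => [|i ij]; rewrite innerZl oe.1 ?eqxx ?mulr1//.
by rewrite (negPf ij) mulr0.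
Qed.

Lemma onb_parseval x y : '[x, y] = \sum_i '[x, e i] * '[y, e i]^*.
Proof.
rewrite {1}(oe.2 x) inner_suml; apply: eq_bigr => i _.
by rewrite innerZl (innerC (e i)).
Qed.

Lemma onb_eq K (S T : 'B(H, K)) : (forall i, S (e i) = T (e i)) -> S = T.
Proof.
move=> ST; apply: bopP => x; rewrite (oe.2 x) !linear_sum; apply: eq_bigr => i _.
by rewrite !linearZ /= ST.
Qed.

Definition bop_of K (f : 'I_d -> K) : 'B(H, K) := \sum_i rank1 (e i) (f i).

Lemma bop_ofE K (f : 'I_d -> K) i : bop_of f (e i) = f i.
Proof.
rewrite bop_sumE (bigD1 i)//= big1 ?addr0 => [|j ji]; rewrite oe.1 ?eqxx ?scale1r//.
by rewrite eq_sym (negPf ji) scale0r.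
Qed.

(** Rows are indexed by the basis of the source: coordinates are row vectors on which the matrix
    acts from the right ([bop_mxE]). *)
Definition bop_mx K (d' : nat) (e' : 'I_d' -> K) (T : 'B(H, K)) : 'M[C]_(d, d') :=
  \matrix_(i, j) '[T (e i), e' j].

Lemma bop_mxE K (d' : nat) (e' : 'I_d' -> K) (T : 'B(H, K)) : onb e' -> forall r : 'rV[C]_d,
  T (\sum_i r 0 i *: e i) = \sum_j (r *m bop_mx e' T) 0 j *: e' j.
Proof.
move=> oe' r; rewrite linear_sum /=.
under [RHS]eq_bigr do rewrite mxE scaler_suml.
rewrite exchange_big; apply: eq_bigr => i _; rewrite linearZ /= {1}(oe'.2 (T (e i))) scaler_sumr.
by apply: eq_bigr => j _; rewrite mxE scalerA.
Qed.

Lemma inj_invertible_onb (T : 'B(H)) : (forall x, T x = 0 -> x = 0) -> invertible_op T.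
Proof.
move=> injT; pose A := bop_mx e T.
have uA : A \in unitmx.
  rewrite -row_free_unit -kermx_eq0; apply/eqP/row_matrixP => i; rewrite row0.
  set r := row i _.
  have rA : r *m A = 0 by rewrite /r -row_mul mulmx_ker row0.
  have /injT r0 : T (\sum_i r 0 i *: e i) = 0.
    by rewrite (bop_mxE T oe) rA big1// => j _; rewrite mxE scale0r.
  by apply/rowP => j; rewrite -(onb_inner (r 0)) r0 inner0l mxE.
pose B := invmx A; pose T' := bop_of (fun i => \sum_j B i j *: e j).
have TE i : T (e i) = \sum_j A i j *: e j.
  by rewrite {1}(oe.2 (T (e i))); apply: eq_bigr => j _; rewrite mxE.
exists T'; split; apply: onb_eq => i /=.
  rewrite bop_ofE linear_sum /=; under eq_bigr do rewrite linearZ /= TE scaler_sumr.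
  rewrite exchange_big /= (bigD1 i)//= [X in _ + X]big1 ?addr0 => [|j ji].
    under eq_bigr do rewrite scalerA.
    rewrite -scaler_suml (_ : \sum_j _ = (B *m A) i i); last (by rewrite mxE); rewrite mulVmx// mxE eqxx.
    exact: scale1r.
  under eq_bigr do rewrite scalerA.
  rewrite -scaler_suml (_ : \sum_i0 _ = (B *m A) i j); last (by rewrite mxE); rewrite mulVmx// mxE eq_sym (negPf ji).
  exact: scale0r.
rewrite TE linear_sum /=; under eq_bigr do rewrite linearZ /= bop_ofE scaler_sumr.
rewrite exchange_big /= (bigD1 i)//= [X in _ + X]big1 ?addr0 => [|j ji].
  under eq_bigr do rewrite scalerA.
  rewrite -scaler_suml (_ : \sum_j _ = (A *m B) i i); last (by rewrite mxE); rewrite mulmxV// mxE eqxx.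
  exact: scale1r.
under eq_bigr do rewrite scalerA.
rewrite -scaler_suml (_ : \sum_i0 _ = (A *m B) i j); last (by rewrite mxE); rewrite mulmxV// mxE eq_sym (negPf ji).
exact: scale0r.
Qed.

End WithBasis.

Lemma inj_invertible H (T : 'B(H)) : finite_dimensional H ->
  (forall x, T x = 0 -> x = 0) -> invertible_op T.
Proof. by move=> /onb_exists[d [e oe]] /(inj_invertible_onb oe). Qed.

Lemma positive_self_adjoint H (P : 'B(H)) : positive_op P -> adj P = P.
Proof.
move=> P0; apply: bop_eq_form => x.
by rewrite adjE innerC conj_Creal// ger0_real.
Qed.

Lemma spectral_positive H (P : 'B(H)) : finite_dimensional H -> positive_op P ->
  exists d (f : 'I_d -> H) (l : 'I_d -> C),
    [/\ onb f, forall i, 0 <= l i & forall i, P (f i) = l i *: f i].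
Proof.
move=> /onb_exists[d [e oe]] P0; pose A := bop_mx e e P.
have hA : A \is hermsymmx.
  apply/is_hermitianmxP; rewrite expr0 scale1r; apply/matrixP => i j.
  rewrite !mxE [RHS](_ : _ = '[e i, P (e j)]); last by rewrite [RHS]innerC.
  by rewrite -adjE positive_self_adjoint.
have /orthomx_spectralP := hermitian_normalmx hA.
set U := spectralmx A; set D := spectral_diag A => AE.
have uU : U \is unitarymx := spectral_unitarymx A.
have UU : U *m (U ^t*)%sesqui = 1%:M by apply/unitarymxP.
have UU' : (U ^t*)%sesqui *m U = 1%:M by rewrite -invmx_unitary// mulVmx// unitarymx_unit.
(* The rows of the diagonalizing unitary are the coordinates of an eigenbasis. *)
pose f k := \sum_j U k j *: e j.
have fE k j : '[f k, e j] = U k j by rewrite onb_inner.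
have of1 i j : '[f i, f j] = (i == j)%:R.
  rewrite (onb_parseval oe); move/matrixP: UU => /(_ i j); rewrite !mxE => <-.
  by apply: eq_bigr => k _; rewrite !fE !mxE.
have UUE k j : \sum_i '[f i, e k]^* * U i j = (k == j)%:R.
  move/matrixP: UU' => /(_ k j); rewrite !mxE => <-.
  by apply: eq_bigr => i _; rewrite fE !mxE.
have of2 x : x = \sum_i '[x, f i] *: f i.
  rewrite [LHS](oe.2 x); under [RHS]eq_bigr do rewrite scaler_sumr.
  rewrite exchange_big; apply: eq_bigr => j _.
  under eq_bigr do rewrite scalerA; rewrite -scaler_suml; congr (_ *: _).
  under eq_bigr do rewrite (onb_parseval oe x) mulr_suml.
  rewrite exchange_big (bigD1 j)//= [X in _ + X]big1 ?addr0 => [|k kj];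
    under eq_bigr do rewrite -mulrA; rewrite -mulr_sumr.
    by rewrite UUE eqxx mulr1.
  by rewrite UUE (negPf kj) mulr0.
have Pf i : P (f i) = D 0 i *: f i.
  have -> : f i = \sum_j (row i U) 0 j *: e j by apply: eq_bigr => j _; rewrite mxE.
  rewrite (bop_mxE e P oe) -/A -row_mul AE !mulmxA mulmxV ?unitarymx_unit// mul1mx.
  rewrite scaler_sumr; apply: eq_bigr => j _.
  by rewrite !mxE (bigD1 i)//= big1 ?addr0 => [|k ki]; rewrite mxE ?eqxx ?mulr1n ?scalerA// eq_sym (negPf ki) mulr0n mul0r.
exists d, f, (D 0); split=> // i.
by have := P0 (f i); rewrite Pf innerZl of1 eqxx mulr1.
Qed.

Lemma positive_sqrt H (P : 'B(H)) : finite_dimensional H -> positive_op P ->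
  exists F : 'B(H), adj F = F /\ F \oB F = P.
Proof.
move=> fH /(spectral_positive fH)[d [f [l [of_ l0 Pf]]]].
pose F : 'B(H) := \sum_i sqrtC (l i) *: rank1 (f i) (f i).
have Ff i : F (f i) = sqrtC (l i) *: f i.
  transitivity (\sum_j sqrtC (l j) *: ('[f i, f j] *: f j)); first by rewrite bop_sumE.
  rewrite (bigD1 i)//= big1 ?addr0 => [|j ji]; rewrite of_.1.
    by rewrite eqxx scale1r.
  by rewrite eq_sym (negPf ji) scale0r scaler0.
exists F; split.
  rewrite adj_sum; apply: eq_bigr => i _; rewrite adjZ adj_rank1 conj_Creal//.
  by rewrite ger0_real// sqrtC_ge0.
by apply: (onb_eq of_) => i; rewrite /= !(Ff, linearZ) /= Ff scalerA -expr2 sqrtCK Pf.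
Qed.

Lemma positive_eq0 H (P : 'B(H)) x : finite_dimensional H -> positive_op P ->
  '[P x, x] = 0 -> P x = 0.
Proof.
move=> fH /(positive_sqrt fH)[F [Fs <-]] /=; rewrite -{1}Fs adjE => /inner_eq0 ->.
exact: linear0.
Qed.

End FiniteDimension.

(** * Closed subspaces and their projections *)

HB.lock Definition prj (R : realType) (H : hilbertType R) (S : csubspace H) : 'B(H) :=
  csubspace_incl S \oB adj (csubspace_incl S).

Section Projections.
Variable R : realType.
Local Notation C := (cplx R).
Implicit Types G H K L : hilbertType R.

Lemma csubspace_inclE H (S : csubspace H) (x : S) : csubspace_incl S x = val x.
Proof. by []. Qed.

Lemma adj_csubspace_incl H (S : csubspace H) :
  adj (csubspace_incl S) \oB csubspace_incl S = bop_id S.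
Proof. by apply/isometricP => x. Qed.

Lemma adj_csubspace_inclE H (S : csubspace H) (x : S) : adj (csubspace_incl S) (val x) = x.
Proof. by move/bop_eqP: (adj_csubspace_incl S) => /(_ x). Qed.

Lemma prjE H (S : csubspace H) x : prj S x = val (adj (csubspace_incl S) x).
Proof. by rewrite prj.unlock. Qed.

Lemma prj_in H (S : csubspace H) x : S (prj S x).
Proof. rewrite prjE; exact: valP (adj (csubspace_incl S) x). Qed.

Lemma prj_id H (S : csubspace H) x : S x -> prj S x = x.
Proof. by move=> Sx; rewrite prjE (adj_csubspace_inclE (CsubspaceVec Sx)). Qed.

Lemma prjP H (S : csubspace H) x : S x <-> prj S x = x.
Proof. by split=> [|<-]; [exact: prj_id | exact: prj_in]. Qed.

Lemma adj_prj H (S : csubspace H) : adj (prj S) = prj S.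
Proof. by rewrite prj.unlock adj_comp adjK. Qed.

Lemma prjK H (S : csubspace H) x : prj S (prj S x) = prj S x.
Proof. by apply: prj_id; exact: prj_in. Qed.

Lemma prj_inner H (S : csubspace H) x y : '[prj S x, y] = '[x, prj S y].
Proof. by rewrite adjP adj_prj. Qed.

Lemma prj_orth H (S : csubspace H) x y : S y -> '[x - prj S x, y] = 0.
Proof. by move=> Sy; rewrite innerBl prj_inner prj_id// subrr. Qed.

Lemma prj_eq0 H (S : csubspace H) x : (forall y, S y -> '[x, y] = 0) -> prj S x = 0.
Proof. by move=> xS; apply: inner_eq0; rewrite prj_inner prjK xS//; exact: prj_in. Qed.

Lemma finite_dimensional_csubspace H (S : csubspace H) :
  finite_dimensional H -> finite_dimensional S.
Proof.
move=> [d [e eP]]; exists d, (fun i => adj (csubspace_incl S) (e i)) => x.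
have [c xc] := eP (val x); exists c.
rewrite -{1}(adj_csubspace_inclE x) xc linear_sum; apply: eq_bigr => i _.
by rewrite linearZ.
Qed.

Lemma orthcP H (E : set H) x : orthc E x <-> forall y, E y -> '[y, x] = 0.
Proof. by split=> [/asboolP|?]; [|apply/asboolP]. Qed.

(** The kernel in the form of an orthogonal complement, which is closed by construction. *)
Definition ker_csubspace H K (T : 'B(H, K)) : csubspace H := orthc (range (adj T)).

Lemma ker_csubspaceP H K (T : 'B(H, K)) x : ker_csubspace T x <-> T x = 0.
Proof.
split=> [/orthcP T0|T0].
  by apply: inner_eq0; rewrite -(adjE T); apply: T0; exists (T x).
by apply/orthcP => _ [y _ <-]; rewrite adjE T0 inner0r.
Qed.

Lemma orthc_range_positive H (P : 'B(H)) x : positive_op P -> orthc (range P) x <-> P x = 0.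
Proof.
by move=> P0; rewrite -{1}(positive_self_adjoint P0); exact: ker_csubspaceP.
Qed.

Lemma closure_csubspace H (D : set H) : D 0 ->
  (forall c x y, D x -> D y -> D (c *: x + y)) ->
  exists S : csubspace H, forall x, S x <-> forall e : C, 0 < e -> exists2 y, D y & `|x - y| < e.
Proof.
move=> D0 DL; pose p : pred H := fun x => `[< forall e : C, 0 < e -> exists2 y, D y & `|x - y| < e >].
have pE x : p x <-> forall e : C, 0 < e -> exists2 y, D y & `|x - y| < e.
  by split=> [/asboolP|?]; [|apply/asboolP].
have pS : closed_linear p.
  split; first split=> [|c x y].
  - by apply/pE => e e0; exists 0 => //; rewrite subrr normr0.
  - move=> /pE xD /pE yD; apply/pE => e e0.
    have c1 : 0 < 1 + `|c| by rewrite ltr_pwDl.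
    have e2 : 0 < e / 2 by rewrite divr_gt0.
    have [x' Dx' xx'] := xD _ (divr_gt0 e2 c1); have [y' Dy' yy'] := yD _ e2.
    exists (c *: x' + y'); first exact: DL.
    have -> : (c *: x + y) - (c *: x' + y') = c *: (x - x') + (y - y').
      by rewrite scalerBr opprD addrACA.
    rewrite (le_lt_trans (ler_normD _ _))// (splitr e) normrZ ler_ltD//.
    move: xx' => /ltW; rewrite ler_pdivlMr// mulrC; apply: le_trans.
    by rewrite ler_wpM2r// lerDr.
  - move=> x clx; apply/pE => e e0; have e2 : 0 < e / 2 by rewrite divr_gt0.
    have [y [/pE yD]] := clx _ (nbhsx_ballx x _ e2).
    rewrite -ball_normE /= => xy; have [z Dz yz] := yD _ e2.
    exists z => //; rewrite -[x](subrK y) -addrA (le_lt_trans (ler_normD _ _))//.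
    by rewrite (splitr e) ltrD.
by exists (Csubspace pS) => x; exact: pE.
Qed.

(** For [y] in [D] one has [|x|^2 = '[x, x - y]], hence [|x| <= |x - y|] by Cauchy-Schwarz, and [y]
    may be taken arbitrarily close to [x]. *)
Lemma dense_inner_eq0 H (D : set H) x :
  (forall z (e : C), 0 < e -> exists2 y, D y & `|z - y| < e) ->
  (forall y, D y -> '[x, y] = 0) -> x = 0.
Proof.
move=> dD xD; apply: inner_eq0; rewrite -normr_inner; apply/eqP; rewrite sqrf_eq0 -normr_le0.
apply/ler_addgt0Pl => e e0; rewrite addr0; have [y Dy xy] := dD x e e0.
rewrite normr_id real_leNgt ?normr_real ?gtr0_real//; apply/negP => ex.
have : `|x| ^+ 2 <= `|x| * `|x - y|.
  rewrite normr_inner -[X in '[_, X]](subrK y x) innerDr (xD _ Dy) addr0.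
  have := cauchy_schwarz x (x - y); apply: le_trans.
  have -> : '[x, x - y] = `|x| ^+ 2 by rewrite innerBr (xD _ Dy) subr0 normr_inner.
  by rewrite ger0_norm// exprn_ge0.
by rewrite expr2 ler_pM2l ?(lt_trans e0)// => /le_lt_trans/(_ xy)/lt_trans/(_ ex); rewrite ltxx.
Qed.

Section FiniteDimensionalPositive.
Variable H : hilbertType R.
Hypothesis fH : finite_dimensional H.
Implicit Types P T : 'B(H).

(** Adding the projection [p] onto the kernel of [P] to the square root [F] makes it invertible. Its
    inverse [J] inverts [F] on the orthogonal complement of the kernel. *)
Lemma positive_sqrt_inverse P : positive_op P -> exists F J : 'B(H),
  [/\ adj F = F, F \oB F = P, F \oB prj (orthc (range P)) = 0,
      forall x, F (J x) + prj (orthc (range P)) (J x) = x &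
      forall x, J (F x) + J (prj (orthc (range P)) x) = x].
Proof.
move=> P0; have [F [Fs FF]] := positive_sqrt fH P0.
set p := prj _.
have Fp x : F (p x) = 0.
  apply: adj_comp_eq0; rewrite Fs -[F (F _)]/((F \oB F) (p x)) FF.
  by apply/(orthc_range_positive _ P0); exact: prj_in.
have [|J [FJ JF]] := @inj_invertible _ _ (F + p) fH.
  move=> x; rewrite bopDE => Fx.
  have px : p x = 0.
    apply: inner_eq0; have : '[F x + p x, p x] = 0 by rewrite Fx inner0l.
    by rewrite innerDl adjP Fs Fp inner0r add0r.
  move: Fx; rewrite px addr0 => Fx; rewrite -px; apply/esym/prj_id.
  by apply/(orthc_range_positive _ P0); rewrite -FF /= Fx linear0.
exists F, J; split=> //; first by apply: bopP => x; exact: Fp.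
  by move=> x; move/bop_eqP: FJ => /(_ x).
by move=> x; move/bop_eqP: JF => /(_ x); rewrite /= linearD.
Qed.

(** The component of [y] orthogonal to the kernel is [J (F y)], so [c] is the square of a bound for
    [J]. *)
Lemma positive_lower_bound P : positive_op P -> exists2 c : C, 0 <= c &
  forall y, `|y - prj (orthc (range P)) y| ^+ 2 <= c * '[P y, y].
Proof.
move=> /positive_sqrt_inverse[F [J [Fs FF Fp FJ JF]]].
set p := prj _ in Fp FJ JF *.
have [M M0 JM] := bop_bounded J; exists (M ^+ 2) => [|y]; first exact: exprn_ge0.
have -> : y - p y = J (F y).
  have := JF (y - p y); rewrite !bopB prjK subrr addr0 => <-.
  by move/bop_eqP: Fp => /(_ y); rewrite bop_compE bop0E => ->; rewrite bop0 subr0.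
rewrite -FF bop_compE adjP Fs -normr_inner -exprMn ler_pXn2r ?nnegrE ?mulr_ge0//.
Qed.

(** [T0 = J F'] satisfies [F T0 = F'], hence [Ad T0 P = P'], but it vanishes on the common kernel.
    [T] keeps its compression to the orthogonal complement and acts as the identity on the kernel,
    which changes nothing in [F T] and makes [T] injective. *)
Lemma positive_congruent P P' : positive_op P -> positive_op P' ->
  (forall x, P x = 0 <-> P' x = 0) -> exists2 T, invertible_op T & Ad T P = P'.
Proof.
move=> P0 P'0 kerP; have [F [J [Fs FF Fp FJ JF]]] := positive_sqrt_inverse P0.
have [F' [J' [F's F'F' F'p _ _]]] := positive_sqrt_inverse P'0.
set p := prj (orthc (range P)) in Fp FJ JF.
have Pp x : P (p x) = 0 by rewrite -FF bop_compE; move/bop_eqP: Fp => /(_ x); rewrite bop_compE => ->; rewrite !bop0E bop0.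
have pP x : P x = 0 -> p x = x by move=> /(orthc_range_positive _ P0)/prj_id.
have {}F'p x : F' (p x) = 0.
  have px : orthc (range P') (p x).
    by apply/(orthc_range_positive _ P'0)/kerP; exact: Pp.
  by rewrite -(prj_id px); move/bop_eqP: F'p; exact.
have pF (U : 'B(H)) x : adj U = U -> (forall y, U (p y) = 0) -> p (U x) = 0.
  by move=> Us Up; apply: inner_eq0; rewrite prj_inner prjK adjP Us Up inner0r.
pose T0 := J \oB F'.
have FT0 x : F (T0 x) = F' x.
  have := FJ (F' x); rewrite -/(T0 x) => E.
  have pT : p (T0 x) = 0.
    move/(congr1 p): (E); rewrite bopD prjK (pF F)// => [|y].
      by rewrite add0r (pF F').
    by move/bop_eqP: Fp; exact.
  by rewrite -E pT addr0.
have PE x y : '[P x, y] = '[F x, F y] by rewrite -FF /= adjP Fs.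
have P'E x y : '[P' x, y] = '[F' x, F' y] by rewrite -F'F' /= adjP F's.
have Fpx x : F (p x) = 0 by move/bop_eqP: Fp; exact.
pose q := bop_id H - p.
pose T := q \oB T0 \oB q + p.
have FT x : F (T x) = F' x.
  rewrite /T bopDE bopD Fpx addr0 !bop_compE /q !bopBE bopB Fpx subr0 FT0.
  by rewrite bopB F'p subr0.
have AdT : Ad T P = P'.
  by apply: bop_ext => x y; rewrite /= adjE PE !FT -P'E.
exists T => //; apply: inj_invertible => // x Tx.
have P'x : P' x = 0.
  by rewrite -AdT /Ad !bop_compE Tx !bop0.
have px : p x = x by apply: pP; apply/kerP.
have qx : q x = 0 by rewrite /q bopBE px subrr.
by move: Tx; rewrite /T bopDE !bop_compE qx !bop0 add0r px.
Qed.

End FiniteDimensionalPositive.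

Lemma bop_family_dependent H (I : finType) d (e : 'I_d -> H) (Q : I -> 'B(H)) :
  onb e -> (d * d < #|I|)%N ->
  exists2 c : I -> C, (exists i, c i != 0) & \sum_i c i *: Q i = 0.
Proof.
move=> oe dI.
pose A : 'M[C]_(#|I|, d * d) := \matrix_(i < #|I|) mxvec (bop_mx e e (Q (enum_val i))).
have kA : kermx A != 0.
  by rewrite kermx_eq0 /row_free neq_ltn (leq_ltn_trans (rank_leq_col A) dI).
have [i ri0] : exists i, row i (kermx A) != 0.
  by apply/existsP; apply: contraNT kA => /existsPn k0; apply/eqP/row_matrixP => i;
    rewrite row0; apply/eqP; have := k0 i; rewrite negbK.
set r := row i _ in ri0.
have rA : r *m A = 0 by rewrite /r -row_mul mulmx_ker row0.
exists (fun j => r 0 (enum_rank j)).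
  have [j rj] : exists j, r 0 j != 0.
    by apply/existsP; apply: contraNT ri0 => /existsPn k0; apply/eqP/rowP => j;
      rewrite [RHS]mxE; apply/eqP; have := k0 j; rewrite negbK.
  by exists (enum_val j); rewrite enum_valK.
apply: (onb_eq oe) => k; rewrite bop0E (oe.2 (_ (e k))) big1// => l _.
suff -> : '[(\sum_i0 r 0 (enum_rank i0) *: Q i0) (e k), e l] = 0 by rewrite scale0r.
move/rowP: rA => /(_ (mxvec_index k l)); rewrite !mxE => <-.
rewrite bop_sumE inner_suml (reindex (@enum_val I predT))/=; last first.
  by apply: onW_bij; exact: enum_val_bij.
by apply: eq_bigr => j _; rewrite enum_valK innerZl !mxE mxvecE mxE.
Qed.

End Projections.

(** * Completely positive maps and dilations *)

Section LinearFunctions.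
Variables (K : pzRingType) (U W : lmodType K) (f : U -> W).
Hypothesis lf : linear f.

Lemma linear_fun0 : f 0 = 0.
Proof. by have := lf (-1) 0 0; rewrite !scaleN1r !addNr. Qed.

Lemma linear_funD x y : f (x + y) = f x + f y.
Proof. by have := lf 1 x y; rewrite !scale1r. Qed.

Lemma linear_funZ c x : f (c *: x) = c *: f x.
Proof. by have := lf c x 0; rewrite linear_fun0 !addr0. Qed.

Lemma linear_funB x y : f (x - y) = f x - f y.
Proof. by rewrite addrC -scaleN1r lf scaleN1r addrC. Qed.

Lemma linear_fun_sum (I : Type) (r : seq I) (P : pred I) (F : I -> U) :
  f (\sum_(i <- r | P i) F i) = \sum_(i <- r | P i) f (F i).
Proof. exact: (big_morph f linear_funD linear_fun0). Qed.

End LinearFunctions.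

Section CompletelyPositiveTheory.
Variables (R : realType) (A : cstarAlgType R).
Local Notation C := (cplx R).
Implicit Types G H K L : hilbertType R.

(** The squared norm of the sum of the [a] tensor [x], over the pairs [(a, x)] of [s], in the
    Stinespring space of [Phi]. *)
Definition gram H (Phi : A -> 'B(H)) (s : seq (A * H)) : C :=
  \sum_(p <- s) \sum_(q <- s) '[Phi (star q.1 * p.1) p.2, q.2].

Lemma gram_ge0 H (Phi : A -> 'B(H)) s : completely_positive Phi -> 0 <= gram Phi s.
Proof.
move=> [lPhi cpPhi]; rewrite /gram big_tnth; under eq_bigr do rewrite big_tnth.
move: (size s) (in_tuple s) => [|n] t; first by rewrite big_ord0.
(* With the algebra elements in the row 0 and zeros elsewhere, the entries of [X^* X] are the
   products [a_i^* a_j]. *)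
pose X : 'M[A]_n.+1 := \matrix_(k, j) if k == 0 then (tnth t j).1 else 0.
have Xpos : mx_positive ((\matrix_(i, j) star (X j i)) *m X) by exists X.
have := cpPhi _ _ Xpos (fun j => (tnth t j).2).
rewrite exchange_big; congr (_ <= _); apply: eq_bigr => j _; apply: eq_bigr => i _.
rewrite !mxE (bigD1 0)//= big1 => [|k k0]; rewrite !mxE ?eqxx ?addr0//.
by rewrite (negPf k0) mulr0.
Qed.

Lemma gram_le H (Phi Psi : A -> 'B(H)) s :
  completely_positive (Phi - Psi) -> gram Psi s <= gram Phi s.
Proof.
move=> cp; rewrite -subr_ge0 (_ : _ - _ = gram (Phi - Psi) s) ?gram_ge0//.
rewrite /gram -sumrB; apply: eq_bigr => p _; rewrite -sumrB; apply: eq_bigr => q _.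
by rewrite -innerBl.
Qed.

Lemma gram_unit H (Phi : A -> 'B(H)) x : gram Phi [:: (1, x)] = '[Phi 1 x, x].
Proof. by rewrite /gram !big_seq1 /= mulr1 star1. Qed.

Lemma cp_unit_positive H (Phi : A -> 'B(H)) : completely_positive Phi -> positive_op (Phi 1).
Proof. by move=> cp x; rewrite -gram_unit gram_ge0. Qed.

(** On a positive matrix [X^* X] the form splits over the rows [k] of [X] into values of the form of
    [D] at [\sum_j theta (X k j) (x j)]. *)
Lemma cp_form H L (Phi : A -> 'B(H)) (theta : A -> H -> L) (D : 'B(L)) :
  linear Phi -> positive_op D ->
  (forall a b x y, '[Phi (star b * a) x, y] = '[D (theta a x), theta b y]) ->
  completely_positive Phi.
Proof.
move=> lPhi D0 E; split=> // n M [X ->] x.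
have -> : \sum_i \sum_j '[(map_mx Phi ((\matrix_(i, j) star (X j i)) *m X)) i j (x j), x i]
  = \sum_k '[D (\sum_j theta (X k j) (x j)), \sum_i theta (X k i) (x i)].
  under [RHS]eq_bigr do rewrite inner_sumr.
  rewrite [RHS]exchange_big; apply: eq_bigr => i _.
  under [RHS]eq_bigr do rewrite bop_sum inner_suml.
  rewrite [RHS]exchange_big; apply: eq_bigr => j _.
  have -> : (map_mx Phi ((\matrix_(i, j) star (X j i)) *m X)) i j =
      Phi (\sum_k star (X k i) * X k j).
    by rewrite !mxE; congr (Phi _); apply: eq_bigr => k _; rewrite mxE.
  rewrite (linear_fun_sum lPhi) bop_sumE inner_suml; apply: eq_bigr => k _.
  exact: E.
by apply: sumr_ge0 => k _.
Qed.

Lemma AdE H K (T : 'B(H, K)) (X : 'B(K)) x y : '[Ad T X x, y] = '[X (T x), T y].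
Proof. by rewrite /Ad !bop_compE adjE. Qed.

Lemma Ad_comp H K L (S : 'B(K, L)) (T : 'B(H, K)) X : Ad T (Ad S X) = Ad (S \oB T) X.
Proof. by apply: bop_ext => x y; rewrite !AdE. Qed.

Lemma Ad_linear H K (T : 'B(H, K)) : linear (Ad T).
Proof.
move=> c X Y; apply: bop_ext => x y.
by rewrite AdE !bopDE !bopZE !innerDl !innerZl !AdE.
Qed.

Lemma Ad_id H (X : 'B(H)) : Ad (bop_id H) X = X.
Proof. by apply: bop_ext => x y; rewrite AdE. Qed.

Lemma cp_Ad H K (T : 'B(H, K)) (Phi : A -> 'B(K)) :
  completely_positive Phi -> completely_positive (fun a => Ad T (Phi a)).
Proof.
move=> [lPhi cp]; split=> [c a b|n M Mp x]; first by rewrite lPhi Ad_linear.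
have := cp n M Mp (fun i => T (x i)); congr (_ <= _).
by apply: eq_bigr => i _; apply: eq_bigr => j _; rewrite !mxE AdE.
Qed.

Lemma cp0 H : completely_positive (fun _ : A => 0 : 'B(H)).
Proof.
split=> [c a b|n M Mp x]; first by rewrite scaler0 addr0.
by rewrite big1// => i _; rewrite big1// => j _; rewrite mxE inner0l.
Qed.

Lemma cpD H (Phi Psi : A -> 'B(H)) : completely_positive Phi -> completely_positive Psi ->
  completely_positive (fun a => Phi a + Psi a).
Proof.
move=> [lPhi cp] [lPsi cp']; split=> [c a b|n M Mp x].
  by rewrite lPhi lPsi scalerDr addrACA.
have := addr_ge0 (cp n M Mp x) (cp' n M Mp x); congr (_ <= _).
rewrite -big_split; apply: eq_bigr => i _; rewrite -big_split; apply: eq_bigr => j _.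
by rewrite !mxE bopDE innerDl.
Qed.

Lemma cpZ H (t : C) (Phi : A -> 'B(H)) : 0 <= t -> completely_positive Phi ->
  completely_positive (fun a => t *: Phi a).
Proof.
move=> t0 [lPhi cp]; split=> [c a b|n M Mp x].
  by rewrite lPhi scalerDr !scalerA mulrC.
have := mulr_ge0 t0 (cp n M Mp x); congr (_ <= _).
rewrite mulr_sumr; apply: eq_bigr => i _; rewrite mulr_sumr; apply: eq_bigr => j _.
by rewrite !mxE bopZE innerZl.
Qed.

Lemma cp_sum (I : Type) (r : seq I) (P : pred I) H (Phi : I -> A -> 'B(H)) :
  (forall i, P i -> completely_positive (Phi i)) ->
  completely_positive (fun a => \sum_(i <- r | P i) Phi i a).
Proof.
move=> cp; elim: r => [|i r IH].
  under [X in completely_positive X]funext do rewrite big_nil; exact: cp0.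
have [Pi|nPi] := boolP (P i).
  have -> : (fun a => \sum_(j <- i :: r | P j) Phi j a) =
            (fun a => Phi i a + \sum_(j <- r | P j) Phi j a).
    by apply/funext => a; rewrite big_cons Pi.
  by apply: cpD => //; exact: cp.
have -> : (fun a => \sum_(j <- i :: r | P j) Phi j a) = (fun a => \sum_(j <- r | P j) Phi j a).
  by apply/funext => a; rewrite big_cons (negPf nPi).
exact: IH.
Qed.

Definition comb H K (pi : A -> 'B(K)) (V : 'B(H, K)) (s : seq (A * H)) : K :=
  \sum_(p <- s) pi p.1 (V p.2).

(** Minimality of the dilation: the vectors [pi a (V x)] span a dense subspace. *)
Definition cyclic H K (pi : A -> 'B(K)) (V : 'B(H, K)) : Prop :=
  forall (x : K) (e : C), 0 < e -> exists s, `|x - comb pi V s| < e.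

Lemma rep_star H K (pi : A -> 'B(K)) (V : 'B(H, K)) : representation pi ->
  forall a b x y, '[Ad V (pi (star b * a)) x, y] = '[pi a (V x), pi b (V y)].
Proof. by move=> [_ _ mpi spi] a b x y; rewrite AdE mpi spi bop_compE adjE. Qed.

Lemma gram_comb H K (pi : A -> 'B(K)) (V : 'B(H, K)) s : representation pi ->
  gram (fun a => Ad V (pi a)) s = '[comb pi V s, comb pi V s].
Proof.
move=> rpi; rewrite /gram /comb inner_suml; apply: eq_bigr => p _.
by rewrite inner_sumr; apply: eq_bigr => q _; exact: rep_star.
Qed.

(** The bound on combinations makes the assignment of [f a x] to [pi a (V x)] well defined and
    continuous on a dense subspace. *)
Lemma cyclic_extend H K L (pi : A -> 'B(K)) (V : 'B(H, K)) (f : A -> 'B(H, L)) (M : C) :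
  cyclic pi V -> 0 <= M ->
  (forall s, `|\sum_(p <- s) f p.1 p.2| <= M * `|comb pi V s|) ->
  exists F : 'B(K, L), forall a x, F (pi a (V x)) = f a x.
Proof.
move=> cV M0 fM.
pose Gr (x : K) (y : L) := exists s, x = comb pi V s /\ y = \sum_(p <- s) f p.1 p.2.
have [|_ _ [s [-> ->]]|x e e0|F FP] := @bop_extend _ _ _ Gr M M0.
- move=> c _ _ _ _ [s [-> ->]] [t [-> ->]].
  exists ([seq (p.1, c *: p.2) | p <- s] ++ t); rewrite /comb !big_cat !big_map /=.
  rewrite !scaler_sumr; split; congr (_ + _); apply: eq_bigr => p _; rewrite !bopZ//.
- exact: fM.
- by have [s sP] := cV x e e0; exists (comb pi V s), (\sum_(p <- s) f p.1 p.2); split=> //; exists s.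
by exists F => a x; apply: FP; exists [:: (a, x)]; rewrite /comb !big_seq1.
Qed.

Lemma cyclic_eq H K L (pi : A -> 'B(K)) (V : 'B(H, K)) (S T : 'B(K, L)) : cyclic pi V ->
  (forall a x, S (pi a (V x)) = T (pi a (V x))) -> S = T.
Proof.
move=> cV ST; apply/eqP; rewrite -subr_eq0; apply/eqP; apply: bop_ext => x y.
rewrite bop0E inner0l adjP (_ : adj (S - T) y = 0) ?inner0r//.
apply: (@dense_inner_eq0 _ _ (range (comb pi V))) => [z e /(cV z)[s sP]|_ [s _ <-]].
  by exists (comb pi V s) => //; exists s.
rewrite adjE /comb bop_sum big1 ?inner0r// => p _.
by rewrite bopBE ST subrr.
Qed.

Lemma onb_ext H d (e : 'I_d -> H) (S T : 'B(H)) : onb e ->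
  (forall i j, '[S (e i), e j] = '[T (e i), e j]) -> S = T.
Proof.
move=> oe ST; apply: (onb_eq oe) => i; rewrite (oe.2 (S _)) (oe.2 (T _)).
by apply: eq_bigr => j _; rewrite ST.
Qed.

Lemma stinespring H (Phi : A -> 'B(H)) : finite_dimensional H -> completely_positive Phi ->
  exists (K : hilbertType R) (pi : A -> 'B(K)) (V : 'B(H, K)),
    [/\ representation pi, forall a, Phi a = Ad V (pi a) & cyclic pi V].
Proof.
move=> /onb_exists[d [e oe]] cpPhi; have [lPhi _] := cpPhi.
(* Functions from the basis indices to [A] stand for the tensor product of [A] and [H]. *)
pose V0 : lmodType C := 'I_d -> A.
pose h (x y : V0) : C := \sum_j \sum_i '[Phi (star (y i) * x j) (e j), e i].
have hl c (x y z : V0) : h (c *: x + y) z = c * h x z + h y z.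
  rewrite /h mulr_sumr -big_split; apply: eq_bigr => j _.
  rewrite mulr_sumr -big_split; apply: eq_bigr => i _.
  have -> : star (z i) * (c *: x + y) j = c *: (star (z i) * x j) + star (z i) * y j.
    by rewrite scalerAr -mulrDr.
  by rewrite lPhi bopDE bopZE innerDl innerZl.
have hr c (x y z : V0) : h z (c *: x + y) = c^* * h z x + h z y.
  rewrite /h mulr_sumr -big_split; apply: eq_bigr => j _.
  rewrite mulr_sumr -big_split; apply: eq_bigr => i _.
  have -> : star ((c *: x + y) i) * z j = c^* *: (star (x i) * z j) + star (y i) * z j.
    by rewrite scalerAl -mulrDl -starZ -starD.
  by rewrite lPhi bopDE bopZE innerDl innerZl.
have h0 x : 0 <= h x x.
  have := gram_ge0 [seq (x j, e j) | j <- index_enum 'I_d] cpPhi.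
  rewrite /gram big_map; congr (_ <= _); apply: eq_bigr => j _.
  by rewrite big_map.
have [K [i [iE iD]]] := hilbert_completion (SemiInner hl hr h0).
rewrite /= in iE.
pose m a (x : V0) : V0 := fun j => a * x j.
have ieq L (S T : 'B(K, L)) : (forall x, S (i x) = T (i x)) -> S = T.
  move=> ST; apply/eqP; rewrite -subr_eq0; apply/eqP; apply: bop_ext => x y.
  rewrite bop0E inner0l adjP (_ : adj (S - T) y = 0) ?inner0r//.
  apply: (@dense_inner_eq0 _ _ (range i)) => [z k /(iD z)[s sP]|_ [s _ <-]].
    by exists (i s) => //; exists s.
  by rewrite adjE bopBE ST subrr inner0r.
have mlin a c x y : m a (c *: x + y) = c *: m a x + m a y.
  by apply/funext => j; rewrite /m; have -> : (c *: x + y) j = c *: x j + y j by []; rewrite mulrDr -scalerAr.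
have hm a x y : h (m a x) y = h x (m (star a) y).
  by apply: eq_bigr => j _; apply: eq_bigr => k _; rewrite /m starM starK mulrA.
(* Left multiplication by [a] is bounded: if [M - a^* a = b^* b], then [M] times the square of the
   seminorm of [v] exceeds that of [a v] by that of [b v]. *)
have /choice[pi piE] : forall a, exists F : 'B(K), forall x, F (i x) = i (m a x).
  move=> a; have [M [b [M0 Mb]]] := cstar_dominated a.
  pose Gr (x y : K) := exists v, x = i v /\ y = i (m a v).
  have sM0 : 0 <= sqrtC M by rewrite sqrtC_ge0 ltW.
  have [||_ _ [v [-> ->]]|x k k0|F FP] := @bop_extend _ _ _ Gr (sqrtC M).
  - exact: sM0.
  - move=> c _ _ _ _ [v [-> ->]] [w [-> ->]]; exists (c *: v + w).
    by rewrite mlin !linearP.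
  - apply: normr_sqr_le => //; rewrite sqrtCK !iE -subr_ge0.
    have -> : M * h v v - h (m a v) (m a v) = h (m b v) (m b v); last exact: h0.
    rewrite /h mulr_sumr -sumrB; apply: eq_bigr => j _.
    rewrite mulr_sumr -sumrB; apply: eq_bigr => k _.
    rewrite /m !starM -!mulrA [star b * _]mulrA -Mb mulrBl mulrBr -scalerAl mul1r -scalerAr.
    by rewrite (linear_funB lPhi) (linear_funZ lPhi) bopBE bopZE innerBl innerZl !mulrA.
  - by have [v vP] := iD x k k0; exists (i v), (i (m a v)); split=> //; exists v.
  by exists F => x; apply: FP; exists x.
(* [delta k] stands for the tensor of 1 and [e k]. *)
pose delta (k : 'I_d) : V0 := fun j => if j == k then 1 else 0.
pose V : 'B(H, K) := bop_of e (fun k => i (delta k)).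
have VE k : V (e k) = i (delta k) by rewrite bop_ofE.
have Phi0 : Phi 0 = 0 by exact: linear_fun0.
have rpi : representation pi.
  split=> [c a b||a b|a].
  - apply: ieq => x; rewrite bopDE bopZE !piE -linearP; congr (i _).
    by apply/funext => j; rewrite /m mulrDl -scalerAl.
  - by apply: ieq => x; rewrite piE; congr (i _); apply/funext => j; rewrite /m mul1r.
  - by apply: ieq => x; rewrite bop_compE !piE; congr (i _); apply/funext => j; rewrite /m mulrA.
  - apply: ieq => x; apply/eqP; rewrite -subr_eq0; apply/eqP.
    apply: (@dense_inner_eq0 _ _ (range i)) => [z k /(iD z)[s sP]|_ [s _ <-]].
      by exists (i s) => //; exists s.
    by rewrite innerBl adjE !piE !iE hm starK subrr.
exists K, pi, V; split=> //.
  move=> a; apply: (onb_ext oe) => j k; rewrite AdE !VE piE iE /h.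
  rewrite (bigD1 j)//= [X in _ + X]big1 ?addr0 => [|l lj].
    rewrite (bigD1 k)//= big1 ?addr0 => [|l lk]; rewrite /m /delta ?eqxx ?star1 ?mul1r ?mulr1//.
    by rewrite (negPf lk) star0 mul0r Phi0 bop0E inner0l.
  by rewrite big1// => l' _; rewrite /m /delta (negPf lj) !mulr0 Phi0 bop0E inner0l.
move=> x k k0; have [v vP] := iD x k k0.
exists [seq (v j, e j) | j <- index_enum 'I_d].
suff -> : comb pi V [seq (v j, e j) | j <- index_enum 'I_d] = i v by [].
rewrite /comb big_map /=; under eq_bigr do rewrite VE piE.
rewrite -linear_sum; congr (i _); apply/funext => j.
rewrite fct_sumE (bigD1 j)//= big1 ?addr0 => [|l lj]; rewrite /m /delta ?eqxx ?mulr1//.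
by rewrite eq_sym (negPf lj) mulr0.
Qed.

End CompletelyPositiveTheory.

(** * Maps dominated by an extreme point *)

Lemma cvg_bigsum (R : realType) (T J : Type) (F : set_system T) {FF : Filter F} (r : seq J)
    (f : J -> T -> cplx R) (l : J -> cplx R) :
  (forall j, f j x @[x --> F] --> l j) ->
  \sum_(j <- r) f j x @[x --> F] --> \sum_(j <- r) l j.
Proof.
move=> fl; elim: r => [|j r IH].
  by under eq_fun do rewrite big_nil; rewrite big_nil; exact: cvg_cst.
under eq_fun do rewrite big_cons; rewrite big_cons.
exact: (cvgD (fl j) IH).
Qed.

Lemma cvg_mix (R : realType) (T : Type) (F : set_system T) {FF : Filter F} (t : T -> cplx R)
    (a b : cplx R) : t x @[x --> F] --> (0 : cplx R) ->
  (1 - 2 * t x) * a + t x * b @[x --> F] --> a.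
Proof.
move=> t0.
have h1 : 2 * t x @[x --> F] --> (2 * 0 : cplx R) by exact: (cvgM (cvg_cst _) t0).
have h2 : 1 - 2 * t x @[x --> F] --> (1 - 2 * 0 : cplx R) by exact: (cvgB (cvg_cst _) h1).
have h3 : (1 - 2 * t x) * a @[x --> F] --> ((1 - 2 * 0) * a : cplx R) by exact: (cvgM h2 (cvg_cst _)).
have h4 : t x * b @[x --> F] --> (0 * b : cplx R) by exact: (cvgM t0 (cvg_cst _)).
have {2}-> : a = (1 - 2 * 0) * a + 0 * b by ring.
exact: (cvgD h3 h4).
Qed.

Section Domination.
Variables (R : realType) (A : cstarAlgType R) (H : hilbertType R).
Local Notation C := (cplx R).
Hypothesis fH : finite_dimensional H.
Variables (P : 'B(H)) (Phi : A -> 'B(H)).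

Lemma positive_same_kernel (S T : 'B(H)) (t c : C) : positive_op S -> positive_op T -> 0 < t ->
  (forall x, t * '[S x, x] <= '[T x, x]) -> (forall x, '[T x, x] <= c * '[S x, x]) ->
  forall x, S x = 0 <-> T x = 0.
Proof.
move=> S0 T0 t0 tST TcS x; split=> [Sx|Tx]; apply: positive_eq0 => //; apply/eqP; rewrite eq_le.
  by have := TcS x; rewrite Sx inner0l mulr0 => ->; exact: T0.
by have := tST x; rewrite Tx inner0l pmulr_rle0// => ->; exact: S0.
Qed.

(** In a dilation [Theta a = Ad V (pi a)], the equation [Theta 1 x = 0] means [V x = 0]. *)
Lemma cp_kernel (Theta : A -> 'B(H)) a x : completely_positive Theta -> Theta 1 x = 0 ->
  Theta a x = 0 /\ forall y, '[Theta a y, x] = 0.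
Proof.
move=> cp T1; have [K [pi [V [rpi TE _]]]] := stinespring fH cp.
have Vx : V x = 0.
  apply: inner_eq0; have [_ pi1 _ _] := rpi.
  by have := AdE V (pi 1) x x; rewrite -TE T1 inner0l pi1.
by split=> [|y]; rewrite TE ?AdE ?Vx ?inner0r// /Ad !bop_compE Vx !bop0.
Qed.

(** Undoing the two congruences makes [Psi] and [Phi - Psi] into maps with unit [P], and [Phi] into
    an admissible combination of them with coefficients [T1] and [T2]. Extremality returns [S 0],
    and [Q = S 0 T1]. *)
Lemma extreme_dominated_inv (Psi : A -> 'B(H)) :
  cstar_extreme P Phi -> completely_positive Psi -> completely_positive (Phi - Psi) ->
  positive_op P ->
  (forall x, P x = 0 <-> Psi 1 x = 0) -> (forall x, P x = 0 <-> (Phi - Psi) 1 x = 0) ->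
  exists Q : 'B(H), forall a, Psi a = Ad Q (Phi a).
Proof.
move=> [[cpPhi Phi1] ext] cpPsi cpD P0 k1 k2.
(* Congruences by invertible T1, T2 carry P to Psi 1 and (Phi - Psi) 1. *)
have [T1 [T1' [TT1 TT1']] A1] := positive_congruent fH P0 (cp_unit_positive cpPsi) k1.
have [T2 [T2' [TT2 TT2']] A2] := positive_congruent fH P0 (cp_unit_positive cpD) k2.
pose Phis (j : 'I_2) a := if j == 0 then Ad T1' (Psi a) else Ad T2' ((Phi - Psi) a).
pose T (j : 'I_2) := if j == 0 then T1 else T2.
have [||||a|S SP] := ext 2 Phis T => //.
- move=> j; rewrite /Phis; case: (j == 0); split; try exact: cp_Ad.
    by rewrite -A1 Ad_comp TT1 Ad_id.
  by rewrite -A2 Ad_comp TT2 Ad_id.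
- by move=> j; rewrite /T; case: (j == 0); [exists T1' | exists T2'].
- rewrite big_ord_recl big_ord1 /T /= A1 A2; apply: bopP => x.
  by rewrite -Phi1 bopDE addrC subrK.
- rewrite big_ord_recl big_ord1 /T /Phis /= !Ad_comp TT1' TT2' !Ad_id; apply: bopP => x.
  by rewrite bopDE addrC subrK.
exists (S 0 \oB T1) => a.
by rewrite -Ad_comp -(SP 0).2 /Phis /= Ad_comp TT1' Ad_id.
Qed.

(* Replacing Psi by (1 - 2t) Psi + t Phi makes all the kernels equal to ker P. The
   resulting operators are bounded modulo ker P, which does not matter for Phi, and
   their limit along an ultrafilter as t -> 0 is the required one. *)
Lemma extreme_dominated (Psi : A -> 'B(H)) :
  cstar_extreme P Phi -> completely_positive Psi -> completely_positive (Phi - Psi) ->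
  exists Q : 'B(H), forall a, Psi a = Ad Q (Phi a).
Proof.
move=> ext cpPsi cpDiff; have [[cpPhi Phi1] _] := ext.
have P0 : positive_op P by rewrite -Phi1; exact: cp_unit_positive.
have PsiP x : '[Psi 1 x, x] <= '[P x, x] by rewrite -Phi1 -!gram_unit gram_le.
have Psi0 x : 0 <= '[Psi 1 x, x] by exact: cp_unit_positive.
(* Starting at [1 / 4] keeps [1 - 2 * t n] positive. *)
pose t (n : nat) : C := n.+4%:R^-1.
have t0 n : 0 < t n by rewrite invr_gt0.
have t1 n : 0 < 1 - 2 * t n.
  rewrite subr_gt0 ltr_pdivrMr// mul1r ltr_nat//.
have t1' n : 1 - 2 * t n <= 1 by rewrite gerBl mulr_ge0// ltW.
pose Psin n a := (1 - 2 * t n) *: Psi a + t n *: Phi a.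
have cpn n : completely_positive (Psin n) by apply: cpD; apply: cpZ => //; exact: ltW.
(* With the weights [1 - 2t] and [t], the difference [Phi - Psin n] is the same mixture built from
   [Phi - Psi]. *)
have cpn' n : completely_positive (Phi - Psin n).
  have -> : Phi - Psin n = (fun a => (1 - 2 * t n) *: (Phi - Psi) a + t n *: Phi a).
    apply/funext => a; apply: bopP => x.
    rewrite -[LHS]/(Phi a x - ((1 - 2 * t n) *: Psi a x + t n *: Phi a x)).
    rewrite -[RHS]/((1 - 2 * t n) *: (Phi a x - Psi a x) + t n *: Phi a x).
    rewrite scalerBr opprD addrA addrAC [X in _ = X + _]addrC -[RHS]addrA addrC; congr (_ + _).
    rewrite -{1}[Phi a x]scale1r -scalerBl -scalerDl; congr (_ *: _); ring.
  by apply: cpD; apply: cpZ => //; exact: ltW.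
have Qn n : exists Q, forall a, Psin n a = Ad Q (Phi a).
  apply: extreme_dominated_inv => //.
  - apply: (@positive_same_kernel _ _ (t n) 1) => // [|x|x]; first exact: cp_unit_positive.
      by rewrite bopDE !bopZE innerDl !innerZl Phi1 lerDr mulr_ge0// ltW.
    rewrite mul1r bopDE !bopZE innerDl !innerZl Phi1.
    rewrite (le_trans (lerD (ler_wpM2l (ltW (t1 n)) (PsiP x)) (lexx _)))// -mulrDl.
    by rewrite ler_piMl// -addrA gerDl mulrDl mul1r opprD subrK oppr_le0 ltW.
  - have E x : '[(Phi - Psin n) 1 x, x] = '[P x, x] - '[Psin n 1 x, x].
      by rewrite -Phi1 -innerBl.
    apply: (@positive_same_kernel _ _ (t n) 1) => // [|x|x]; first exact: cp_unit_positive.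
      rewrite E bopDE !bopZE innerDl !innerZl Phi1 lerBrDl.
      rewrite (le_trans (lerD (lerD (ler_wpM2l (ltW (t1 n)) (PsiP x)) (lexx _)) (lexx _)))//.
      by rewrite le_eqVlt; apply/orP; left; apply/eqP; ring.
    by rewrite mul1r E gerBl; exact: cp_unit_positive.
have {Qn}/choice[Q QP] := Qn.
have [c c0 cP] := positive_lower_bound fH P0.
set p := prj _ in cP.
have Pp x : P (p x) = 0 by apply/orthc_range_positive => //; exact: prj_in.
have [d [e oe]] := onb_exists fH.
(* Only the component of [Q n (e i)] orthogonal to the kernel of [P] is controlled: its squared norm
   is at most [c] times ['[Psin n 1 (e i), e i]], hence at most [c] times ['[P (e i), e i]]. *)
pose q n i : H := Q n (e i) - p (Q n (e i)).
have qb n i j : `|'[q n i, e j]| <= sqrtC (c * '[P (e i), e i]) * `|e j|.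
  rewrite (le_trans (cauchy_schwarz _ _))// ler_wpM2r//.
  rewrite -(@ler_pXn2r _ 2) ?nnegrE ?sqrtC_ge0 ?mulr_ge0// sqrtCK (le_trans (cP _))// ler_wpM2l//.
  have := QP n 1; move/(congr1 (fun T : 'B(H) => '[T (e i), e i])); rewrite AdE Phi1 => <-.
  rewrite bopDE !bopZE innerDl !innerZl Phi1.
  rewrite (le_trans (lerD (ler_wpM2l (ltW (t1 n)) (PsiP _)) (lexx _)))// -mulrDl.
  by rewrite ler_piMl// -addrA gerDl mulrDl mul1r opprD subrK oppr_le0 ltW.
have [F [FU Foo]] := @ultraFilterLemma _ (\oo : set_system nat) _.
have FF : ProperFilter F by exact: ultra_proper.
have /choice[l0 l0P] : forall ij : 'I_d * 'I_d, exists l : C, '[q n ij.1, e ij.2] @[n --> F] --> l.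
  by move=> [i j]; exact: (ultra_cvg FU (fun n => qb n i j)).
pose l i j := l0 (i, j).
have lP i j : '[q n i, e j] @[n --> F] --> l i j by exact: l0P (i, j).
exists (bop_of e (fun i : 'I_d => \sum_j l i j *: e j)) => a.
apply: (onb_ext oe) => i j; rewrite AdE !bop_ofE//.
have expand (x y : H) : '[Phi a x, y] =
    \sum_k \sum_m '[x, e k] * ('[y, e m]^* * '[Phi a (e k), e m]).
  rewrite {1}(oe.2 x) bop_sum inner_suml; apply: eq_bigr => k _.
  rewrite bopZ innerZl -mulr_sumr; congr (_ * _).
  rewrite {1}(oe.2 y) inner_sumr; apply: eq_bigr => m _; exact: innerZr.
rewrite expand; under eq_bigr do under eq_bigr do rewrite !(onb_inner oe).
have lim1 : '[Psin n a (e i), e j] @[n --> F] -->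
    \sum_k \sum_m l i k * ((l j m)^* * '[Phi a (e k), e m]).
  have -> : (fun n => '[Psin n a (e i), e j]) =
      (fun n => \sum_k \sum_m '[q n i, e k] * ('[q n j, e m]^* * '[Phi a (e k), e m])).
    apply/funext => n; rewrite QP AdE -expand.
    (* [Phi a] does not see the component in the kernel of [P], on either side of the form. *)
    have [Pa _] := cp_kernel a cpPhi (etrans (congr1 (fun T : 'B(H) => T _) Phi1) (Pp (Q n (e i)))).
    have [_ Pb] := cp_kernel a cpPhi (etrans (congr1 (fun T : 'B(H) => T _) Phi1) (Pp (Q n (e j)))).
    by rewrite /q bopB Pa subr0 innerBr Pb subr0.
  apply: cvg_bigsum => k; apply: cvg_bigsum => m.
  exact: (cvgM (lP i k) (cvgM (cvg_conjC (lP j m)) (cvg_cst _))).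
have tl : t n @[n --> F] --> (0 : C).
  apply/cvgrPdist_lt => k k0; have [N NP] := cplx_invn_lt k0; apply: Foo; exists N => // n /= Nn.
  by rewrite sub0r normrN gtr0_norm// NP// (leq_trans Nn)// leqW// leqW// leqW.
have lim2 : '[Psin n a (e i), e j] @[n --> F] --> '[Psi a (e i), e j].
  have -> : (fun n => '[Psin n a (e i), e j]) =
     (fun n => (1 - 2 * t n) * '[Psi a (e i), e j] + t n * '[Phi a (e i), e j]).
    by apply/funext => n; rewrite bopDE !bopZE innerDl !innerZl.
  exact: cvg_mix.
exact: (cvg_unique (@norm_hausdorff _ _) lim2 lim1).
Qed.

End Domination.

(** * Subalgebras of matrices with the factorization property *)

(** By Cayley-Hamilton, and since the constant term of the characteristic polynomial of an
    invertible [Z] is nonzero, 1 is a combination of positive powers of [Z]. *)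
Lemma invertible_subalgebra_one (F : fieldType) m (BB : 'M[F]_m -> Prop) (Z : 'M[F]_m) :
  (forall c X Y, BB X -> BB Y -> BB (c *: X + Y)) ->
  (forall X Y, BB X -> BB Y -> BB (X *m Y)) ->
  BB Z -> Z \in unitmx -> BB 1%:M.
Proof.
case: m BB Z => [|n] BB Z lin mul BZ uZ; first by rewrite (flatmx0 1%:M) -(flatmx0 Z).
have B0 : BB 0 by rewrite -[0](addNr Z) -scaleN1r; exact: lin.
have BX q : BB (horner_mx Z (q * 'X)).
  elim/poly_ind: q => [|q c IH]; first by rewrite mul0r rmorph0.
  rewrite mulrDl rmorphD addrC (rmorphM _ c%:P) (rmorphM _ (q * 'X)) /= horner_mx_X horner_mx_C.
  by rewrite -!mulmxE mul_scalar_mx; apply: lin => //; exact: mul.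
have := char_poly_det Z; have := Cayley_Hamilton Z.
elim/poly_ind: (char_poly Z) => [|q c _].
  by move=> _ /esym/eqP; rewrite coef0 mulf_eq0 signr_eq0 /= => /eqP d0; move: uZ; rewrite unitmxE d0 unitr0.
rewrite coefD coefMX eqxx coefC eqxx add0r rmorphD /= horner_mx_C => E cE.
have c0 : c != 0 by rewrite cE mulf_neq0 ?signr_eq0// -unitfE -unitmxE.
have -> : 1%:M = - c^-1 *: horner_mx Z (q * 'X).
  move/eqP: E; rewrite addr_eq0 => /eqP ->; rewrite scalerN scaleNr opprK scale_scalar_mx mulVf//.
by rewrite -[_ *: _]addr0; exact: lin.
Qed.

Section Triangularization.
Variables (C : numClosedFieldType) (m : nat).
Local Notation "A ^*t" := (map_mx (@Num.conj C) (trmx A)) (at level 8, format "A ^*t").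

Lemma ctmxM a b c (X : 'M[C]_(a, b)) (Y : 'M[C]_(b, c)) : (X *m Y)^*t = Y^*t *m X^*t.
Proof. by rewrite trmx_mul map_mxM. Qed.

Lemma ctmxK a b (X : 'M[C]_(a, b)) : X^*t^*t = X.
Proof. by apply/matrixP => i j; rewrite !mxE conjCK. Qed.

Lemma ctmxB a b (X Y : 'M[C]_(a, b)) : (X - Y)^*t = X^*t - Y^*t.
Proof. by apply/matrixP => i j; rewrite !mxE rmorphB. Qed.

Lemma ctmx1 a : (1%:M : 'M[C]_a)^*t = 1%:M.
Proof. by rewrite trmx1 map_mx1. Qed.

Lemma ctmxZ a b c (X : 'M[C]_(a, b)) : (c *: X)^*t = c^* *: X^*t.
Proof. by apply/matrixP => i j; rewrite !mxE rmorphM. Qed.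

Lemma mulmx_ct_eq0 a b (X : 'M[C]_(a, b)) : X^*t *m X = 0 -> X = 0.
Proof.
move=> /matrixP X0; apply/matrixP => i j; rewrite [RHS]mxE; apply/eqP.
have := X0 j j; rewrite !mxE => /eqP.
rewrite psumr_eq0 => [|k _]; last by rewrite !mxE mulrC mul_conjC_ge0.
by move=> /allP/(_ i (mem_index_enum _))/implyP/(_ isT); rewrite !mxE mulf_eq0 conjC_eq0 orbb.
Qed.

Variable BB : 'M[C]_m -> Prop.
Hypothesis BB_lin : forall c X Y, BB X -> BB Y -> BB (c *: X + Y).
Hypothesis BB_mul : forall X Y, BB X -> BB Y -> BB (X *m Y).
Hypothesis BB_factor : forall X : 'M[C]_m, exists2 Z, BB Z & Z^*t *m Z = X^*t *m X.

(* The rows of U are chosen one after the other so that each is related to every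
   vector orthogonal to its predecessors. *)
Let dot (x y : 'rV[C]_m) : C := (x *m y^*t) 0 0.
Let rel (y x : 'rV[C]_m) : Prop := BB (y^*t *m x).

Let BB_one : BB 1%:M.
Proof.
have [Z BZ ZZ] := BB_factor 1%:M; apply: (invertible_subalgebra_one BB_lin BB_mul BZ).
by move: ZZ; rewrite mulmx1 ctmx1 => /mulmx1_unit[].
Qed.

Let BB_zero : BB 0.
Proof. by rewrite -[0](addNr 1%:M) -scaleN1r; apply: BB_lin; exact: BB_one. Qed.

Let BB_add X Y : BB X -> BB Y -> BB (X + Y).
Proof. by move=> XB YB; rewrite -[X]scale1r; exact: BB_lin. Qed.

Let BB_scale c X : BB X -> BB (c *: X).
Proof. by move=> XB; rewrite -[_ *: _]addr0; apply: BB_lin => //; exact: BB_zero. Qed.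

Let BB_sub X Y : BB X -> BB Y -> BB (X - Y).
Proof. by move=> XB YB; rewrite addrC -scaleN1r; exact: BB_lin. Qed.

Let BB_sum (I : finType) (F : I -> 'M[C]_m) : (forall i, BB (F i)) -> BB (\sum_i F i).
Proof. by move=> FB; apply: big_ind => //; exact: BB_add. Qed.

Let mx11 (x y : 'rV[C]_m) : x *m y^*t = (dot x y)%:M.
Proof. by rewrite /dot [LHS]mx11_scalar. Qed.

Let dot_gt0 x : x != 0 -> dot x x != 0.
Proof.
apply: contra_neq => d0; apply/eqP; rewrite -[x]ctmxK (_ : x^*t = 0) ?map_mx0 ?trmx0 ?map_mx0//.
by apply: mulmx_ct_eq0; rewrite ctmxK mx11 d0; apply/matrixP => i j; rewrite !mxE mul0rn.
Qed.

Let normalize (x : 'rV[C]_m) : x != 0 -> exists2 c : C, c != 0 & (c^-1 *: x) *m (c^-1 *: x)^*t = 1%:M.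
Proof.
move=> x0; pose c := sqrtC (dot x x).
have dx0 : 0 <= dot x x.
  by rewrite /dot mxE sumr_ge0// => i _; rewrite !mxE mul_conjC_ge0.
exists c; first by rewrite sqrtC_eq0 dot_gt0.
have cr : (c^-1)^* = c^-1 by rewrite conj_Creal// rpredV ger0_real// sqrtC_ge0.
rewrite ctmxZ cr -scalemxAl -scalemxAr mx11 scalerA -invfM -expr2 sqrtCK.
by rewrite scale_scalar_mx mulVf ?dot_gt0.
Qed.

(** The product of [y^*t x] and [y'^*t x'] is [y^*t x'] times the scalar [dot x y']. *)
Let rel_trans y x y' x' : rel y x -> rel y' x' -> dot x y' != 0 -> rel y x'.
Proof.
move=> yx y'x' d0; have := BB_mul yx y'x'.
rewrite mulmxA -[_ *m x *m _]mulmxA mx11 mul_mx_scalar -scalemxAl => /(BB_scale (dot x y')^-1).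
by rewrite scalerA mulVf// scale1r.
Qed.

Section Step.
Variables (k : nat) (X : 'M[C]_(k, m)).
Hypothesis km : (k < m)%N.
Hypothesis uX : X *m X^*t = 1%:M.
Hypothesis relX : forall (s : 'I_k) x, (forall r : 'I_k, (r < s)%N -> dot x (row r X) = 0) ->
  rel (row s X) x.
Let N (x : 'rV[C]_m) := x *m X^*t = 0.
Let p := X^*t *m X.

Let N_dot x r : N x -> dot x (row r X) = 0.
Proof.
have -> : dot x (row r X) = (x *m X^*t) 0 r.
  by rewrite /dot !mxE; apply: eq_bigr => j _; rewrite !mxE.
by move=> ->; rewrite mxE.
Qed.

Let p_BB : BB p.
Proof.
have -> : p = \sum_s (row s X)^*t *m row s X.
  apply/matrixP => i j; rewrite mxE summxE; apply: eq_bigr => s _.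
  by rewrite !mxE big_ord1 !mxE.
apply: BB_sum => s; apply: relX => r rs.
move/matrixP: uX => /(_ s r); rewrite !mxE /dot mxE.
under eq_bigr do rewrite !mxE; under [X in _ -> X = _]eq_bigr do rewrite !mxE.
by move=> ->; case: eqP rs => // ->; rewrite ltnn.
Qed.

(** Let [D] be the projection onto the span of the rows of [X] and of [x], and [D = Z^*t Z] with [Z]
    in [BB]. For every row [r] of [X'] the matrix [Z r^*t x'] is in [BB]: for a row of [X] by
    [relX], for [x'] because [Z x'^*t x' = Z (1 - p)]. Some [r Z^*t] has a nonzero component in [N],
    and this component is the vector [y]. *)
Let N_rel x : N x -> x != 0 -> exists y, [/\ N y, y != 0 & rel y x].
Proof.
move=> Nx x0; have [c c0 x'x'] := normalize x0; set x' := c^-1 *: x in x'x'.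
have Nx' : x' *m X^*t = 0 by rewrite -scalemxAl Nx scaler0.
have X'x : X *m x'^*t = 0 by rewrite -[X]ctmxK -ctmxM Nx' trmx0 map_mx0.
pose X' := col_mx X x'.
have X't : X'^*t = row_mx X^*t x'^*t by rewrite tr_col_mx map_row_mx.
have uX' : X' *m X'^*t = 1%:M.
  by rewrite X't mul_col_row uX X'x Nx' x'x' -scalar_mx_block.
pose D := X'^*t *m X'.
have DE : D = p + x'^*t *m x' by rewrite /D X't mul_row_col.
have Ds : D^*t = D by rewrite ctmxM ctmxK.
have [Z ZB] := BB_factor D; rewrite Ds.
have DD : D *m D = D by rewrite /D mulmxA -[X'^*t *m X' *m _]mulmxA uX' mulmx1.
rewrite DD => ZZ.
(* As [Z^*t Z = D] is a projection, [Z] vanishes on the complement of its range. *)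
have ZD : Z = Z *m D.
  apply/eqP; rewrite -subr_eq0; apply/eqP/mulmx_ct_eq0; rewrite ctmxB ctmxM Ds.
  rewrite -[Z in _ *m (Z - _)]mulmx1 -mulmxBr mulmxA -[_ - _ *m _](_ : (1%:M - D) *m Z^*t = _); last first.
    by rewrite mulmxBl mul1mx.
  rewrite -[(1%:M - D) *m Z^*t *m Z]mulmxA ZZ mulmxBl mul1mx.
  by rewrite DD subrr mul0mx.
have xp : x' *m p = 0 by rewrite /p mulmxA Nx' mul0mx.
have pp : p *m p = p by rewrite /p mulmxA -[_ *m X *m _]mulmxA uX mulmx1.
have Dp : D *m (1%:M - p) = x'^*t *m x'.
  by rewrite mulmxBr mulmx1 DE mulmxDl pp -mulmxA xp mulmx0 addr0 addrC addKr.
have ZBx (i : 'I_(k + 1)) : BB (Z *m (row i X')^*t *m x').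
  case: (split_ordP i) => j ->; rewrite ?rowKu ?rowKd.
    rewrite -mulmxA; apply: BB_mul => //; apply: relX => r _; exact: N_dot.
  have -> : row j x' = x' by apply/rowP => l; rewrite mxE ord1.
  rewrite -mulmxA -Dp mulmxA -ZD; apply: BB_mul => //; apply: BB_sub => //; exact: BB_one.
(* X' *m Z^*t has rank k + 1, so its rows do not all lie in the span of the k rows of X. *)
have [i i0] : exists i, row i (X' *m Z^*t *m (1%:M - p)) != 0.
  apply/existsP; apply: contraT => /existsPn all0.
  have E0 : X' *m Z^*t *m (1%:M - p) = 0.
    by apply/row_matrixP => i; rewrite row0; apply/eqP; have := all0 i; rewrite negbK.
  have E1 : X' *m Z^*t = X' *m Z^*t *m X^*t *m X.
    move/eqP: E0; rewrite mulmxBr mulmx1 subr_eq0 => /eqP {1}->.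
    by rewrite /p !mulmxA.
  have : (\rank (1%:M : 'M[C]_(k + 1)) <= k)%N.
    have <- : X' *m Z^*t *m (Z *m X'^*t) = 1%:M.
      by rewrite mulmxA -[X' *m _ *m Z]mulmxA ZZ /D mulmxA uX' mul1mx uX'.
    rewrite E1; apply: leq_trans (mxrankM_maxl _ _) _; apply: leq_trans (mxrankM_maxr _ _) _.
    exact: rank_leq_row.
  by rewrite mxrank1 addn1 ltnn.
exists (row i (X' *m Z^*t *m (1%:M - p))); split=> //.
  have pX : (1%:M - p) *m X^*t = 0 by rewrite mulmxBl mul1mx /p -mulmxA uX mulmx1 subrr.
  by rewrite /N -row_mul -[_ *m X^*t]mulmxA pX mulmx0 row0.
rewrite /rel row_mul ctmxM row_mul ctmxM ctmxK ctmxB ctmx1 ctmxM ctmxK -/p.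
have -> : x = c *: x' by rewrite scalerA mulfV// scale1r.
rewrite -scalemxAr -mulmxA; apply: BB_scale; apply: BB_mul; first by apply: BB_sub => //; exact: BB_one.
exact: ZBx.
Qed.

(** Take [y] related to as many independent vectors of [N] as possible. If it missed a vector, it
    would miss some [w] not orthogonal to [y]; a vector [z] related to [w] would, by [rel_trans]
    through [w] and [y], be related to all the previous vectors and to [w]. *)
Let N_total : exists y, [/\ N y, y != 0 & forall x, N x -> rel y x].
Proof.
pose Q n := `[< exists y, [/\ N y, y != 0 & exists2 Y : 'M[C]_(n, m), row_free Y &
   forall i, N (row i Y) /\ rel y (row i Y)] >].
have Q0 : exists n, Q n.
  exists 0%N; apply/asboolP.
  have kerX : kermx X^*t != 0.
    rewrite kermx_eq0 /row_free neq_ltn (leq_ltn_trans _ km)//.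
    exact: rank_leq_col.
  have [i i0] : exists i, row i (kermx X^*t) != 0.
    apply/existsP; apply: contraNT kerX => /existsPn k0; apply/eqP/row_matrixP => i.
    by rewrite row0; apply/eqP; have := k0 i; rewrite negbK.
  exists (row i (kermx X^*t)); split=> //.
    by rewrite /N -row_mul mulmx_ker row0.
  exists 0; last by case.
  by rewrite /row_free mxrank0.
have Qm n : Q n -> (n <= m)%N.
  move=> /asboolP[y [_ _ [Y fY _]]]; move: fY; rewrite /row_free => /eqP <-; exact: rank_leq_col.
have [n /asboolP[y [Ny y0 [Y fY YP]]] nmax] := ex_maxnP Q0 Qm.
exists y; split=> // x Nx; apply: contrapT => nyx.
have relD z z' : rel y z -> rel y z' -> rel y (z + z').
  by rewrite /rel mulmxDr; exact: BB_add.
have relB z z' : rel y z -> rel y z' -> rel y (z - z').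
  by rewrite /rel mulmxBr; exact: BB_sub.
have dotD z z' : dot (z + z') y = dot z y + dot z' y by rewrite /dot mulmxDl mxE.
have ND z z' : N z -> N z' -> N (z + z') by rewrite /N mulmxDl => -> ->; rewrite addr0.
(* If the missed [x] is orthogonal to [y], then [x + y] is missed as well, or else [y] itself is. *)
have [w [Nw nyw wy]] : exists w, [/\ N w, ~ rel y w & dot w y != 0].
  have [xy0|xy] := eqVneq (dot x y) 0; last by exists x.
  have [yxy|nyxy] := pselect (rel y (x + y)).
    exists y; split=> //; last exact: dot_gt0.
    by move=> yy; apply: nyx; rewrite -[x](addrK y); exact: relB.
  by exists (x + y); split=> //; [exact: ND | rewrite dotD xy0 add0r dot_gt0].
have w0 : w != 0 by apply: contra_neq wy => ->; rewrite /dot mul0mx mxE.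
have [z [Nz z0 zw]] := N_rel Nw w0.
have : Q (n + 1)%N.
  apply/asboolP; exists z; split=> //; exists (col_mx Y w).
    rewrite /row_free -addsmxE; apply/eqP.
    have -> : (\rank (Y + w)%MS = \rank Y + \rank w)%N.
      apply/eqP; rewrite -(eqn_add2r (\rank (Y :&: w)%MS)) mxrank_sum_cap.
      suff -> : (Y :&: w)%MS = 0 by rewrite mxrank0 addn0.
      apply/eqP; rewrite -submx0; apply/row_subP => i.
      have : (row i (Y :&: w)%MS <= Y :&: w)%MS by exact: row_sub.
      rewrite sub_capmx => /andP[/submxP[a aE] /sub_rVP[c cE]].
      have [c0|c0] := eqVneq c 0; first by rewrite cE c0 scale0r sub0mx.
      exfalso; apply: nyw; rewrite -[w](scale1r) -(mulVf c0) -scalerA -cE aE.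
      rewrite /rel -scalemxAr; apply: BB_scale.
      rewrite mulmxA [_ *m Y](_ : _ = \sum_j (a 0 j *: (y^*t *m row j Y))); last first.
        rewrite -[y^*t *m a *m Y]mulmxA mulmx_sum_row mulmx_sumr; apply: eq_bigr => j _.
        by rewrite -scalemxAr.
      by apply: BB_sum => j; apply: BB_scale; exact: (YP j).2.
    by rewrite (eqP fY) rank_rV w0.
  move=> i; case: (split_ordP i) => j ->; rewrite ?rowKu ?rowKd.
    split; first exact: (YP j).1.
    by apply: rel_trans zw (YP j).2 wy.
  by have -> : row j w = w by apply/rowP => l; rewrite mxE ord1.
by move=> /nmax; rewrite addn1 ltnn.
Qed.

Lemma triangular_step : exists X' : 'M[C]_(k + 1, m), X' *m X'^*t = 1%:M /\
  forall (s : 'I_(k + 1)) x, (forall r : 'I_(k + 1), (r < s)%N -> dot x (row r X') = 0) ->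
    rel (row s X') x.
Proof.
have [y [Ny y0 yP]] := N_total; have [c c0 x'x'] := normalize y0; set x' := c^-1 *: y in x'x'.
have Nx' : x' *m X^*t = 0 by rewrite -scalemxAl Ny scaler0.
have X'x : X *m x'^*t = 0 by rewrite -[X]ctmxK -ctmxM Nx' trmx0 map_mx0.
exists (col_mx X x'); split.
  by rewrite tr_col_mx map_row_mx mul_col_row uX X'x Nx' x'x' -scalar_mx_block.
move=> s x; case: (split_ordP s) => j -> xP; rewrite ?rowKu ?rowKd.
  by apply: relX => r rj; have := xP (lshift 1 r) rj; rewrite rowKu.
have -> : row j x' = x' by apply/rowP => l; rewrite mxE ord1.
rewrite /rel /x' ctmxZ -scalemxAl; apply: BB_scale; apply: yP.
apply/rowP => r; rewrite [RHS]mxE.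
have := xP (lshift 1 r); rewrite rowKu /dot /= => /(_ _) <-; last by rewrite ltn_addr.
by rewrite !mxE; apply: eq_bigr => l _; rewrite !mxE.
Qed.

End Step.

(** The matrices in the conclusion are the matrix units of the orthonormal basis formed by the rows
    of [U]; for [s <= t] the row [t] is orthogonal to all rows before [s], which is the condition
    under which row [s] is related to it. *)
Lemma factor_triangular : exists U : 'M[C]_m, U *m U^*t = 1%:M /\
  forall s t : 'I_m, (s <= t)%N -> BB ((row s U)^*t *m row t U).
Proof.
have main k : (k <= m)%N -> exists X : 'M[C]_(k, m), X *m X^*t = 1%:M /\
    forall (s : 'I_k) x, (forall r : 'I_k, (r < s)%N -> dot x (row r X) = 0) -> rel (row s X) x.
  elim: k => [|k IH] km; first by exists 0; split=> [|[]//]; apply/matrixP => -[].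
  have [X [uX XP]] := IH (ltnW km).
  by rewrite -addn1; exact: (triangular_step km uX XP).
have [U [uU UP]] := main m (leqnn m); exists U; split=> // s t st.
apply: UP => r rs; move/matrixP: uU => /(_ t r); rewrite !mxE /dot mxE.
under eq_bigr do rewrite !mxE; under [X in _ -> X = _]eq_bigr do rewrite !mxE.
by move=> ->; case: eqP => // e; move: st; rewrite e leqNgt rs.
Qed.

End Triangularization.

(** * Intertwiners and reducing subspaces *)

Section LinearDependence.

Lemma span_dependent (C : fieldType) (W : lmodType C) (J : finType) (mu : J -> W) n
    (w : 'I_n -> W) (c : 'I_n -> J -> C) : (forall k, w k = \sum_j c k j *: mu j) ->
  (#|J| < n)%N -> exists2 a : 'I_n -> C, (exists k, a k != 0) & \sum_k a k *: w k = 0.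
Proof.
move=> wE Jn; pose A : 'M[C]_(n, #|J|) := \matrix_(k, j) c k (enum_val j).
have kA : kermx A != 0.
  by rewrite kermx_eq0 /row_free neq_ltn (leq_ltn_trans (rank_leq_col A) Jn).
have [i ri0] : exists i, row i (kermx A) != 0.
  apply/existsP; apply: contraNT kA => /existsPn k0; apply/eqP/row_matrixP => i.
  by rewrite row0; apply/eqP; have := k0 i; rewrite negbK.
set r := row i _ in ri0.
have rA : r *m A = 0 by rewrite /r -row_mul mulmx_ker row0.
exists (r 0).
  apply/existsP; apply: contraNT ri0 => /existsPn k0; apply/eqP/rowP => j.
  by rewrite [RHS]mxE; apply/eqP; have := k0 j; rewrite negbK.
under eq_bigr do rewrite wE scaler_sumr.
rewrite exchange_big big1// => j _; under eq_bigr do rewrite scalerA.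
rewrite -scaler_suml (_ : \sum_i0 _ = (r *m A) 0 (enum_rank j)); first by rewrite rA mxE scale0r.
by rewrite mxE; apply: eq_bigr => k _; rewrite [A k _]mxE enum_rankK.
Qed.

Lemma maximal_family (C : fieldType) (W : lmodType C) (P : W -> Prop) N :
  (forall n (z : 'I_n -> W), (forall i, P (z i)) ->
     (forall c : 'I_n -> C, \sum_i c i *: z i = 0 -> forall i, c i = 0) -> (n <= N)%N) ->
  exists n (z : 'I_n -> W), (forall i, P (z i)) /\
    forall w, P w -> exists c : 'I_n -> C, w = \sum_i c i *: z i.
Proof.
move=> bound.
pose Q n := `[< exists z : 'I_n -> W, (forall i, P (z i)) /\
     (forall c : 'I_n -> C, \sum_i c i *: z i = 0 -> forall i, c i = 0) >].
have Q0 : exists n, Q n by exists 0%N; apply/asboolP; exists (fun=> 0); split=> [[]//|c _ []].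
have Qm n : Q n -> (n <= N)%N by move=> /asboolP[z [Pz iz]]; exact: bound Pz iz.
have [n /asboolP[z [Pz iz]] nmax] := ex_maxnP Q0 Qm.
exists n, z; split=> // w Pw; apply: contrapT => nw.
have : Q n.+1.
  apply/asboolP; exists (fun i => if unlift ord_max i is Some j then z j else w); split.
    by move=> i; case: unliftP => [j _|_].
  move=> c; rewrite big_ord_recr /= unlift_none.
  have wlE (j : 'I_n) : widen_ord (leqnSn n) j = lift ord_max j.
    by apply: val_inj; rewrite /= /bump leqNgt ltn_ord.
  rewrite (eq_bigr (fun j => c (lift ord_max j) *: z j)); last by move=> j _; rewrite wlE liftK.
  move=> c0; have [cm|cm] := eqVneq (c ord_max) 0.
    move: c0; rewrite cm scale0r addr0 => /iz ci i.
    by case: (unliftP ord_max i) => [j ->|->].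
  exfalso; apply: nw; exists (fun i => - (c ord_max)^-1 * c (lift ord_max i)).
  rewrite -[w]scale1r -(mulVf cm) -scalerA.
  move/eqP: c0; rewrite addrC addr_eq0 => /eqP ->; rewrite scalerN -scaleNr scaler_sumr.
  by apply: eq_bigr => j _; rewrite scalerA.
by move=> /nmax; rewrite ltnn.
Qed.

(** A nonzero polynomial [p] satisfies [p(phi) x = 0]. Roots are split off one by one until the
    cofactor [r] satisfies [r(phi) x != 0]; this vector is an eigenvector for the last root. *)
Lemma eigenvector_of_dependent (C : closedFieldType) (W : lmodType C) (phi : W -> W) (x : W) n
    (c : 'I_n -> C) : linear phi -> x != 0 -> (exists k, c k != 0) ->
  \sum_k c k *: iter k phi x = 0 -> exists l y, y != 0 /\ phi y = l *: y.
Proof.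
move=> lphi x0 [k ck]; pose p := \poly_(i < n) (if insub i is Some k then c k else 0).
have pE (i : 'I_n) : p`_i = c i by rewrite coef_poly ltn_ord valK.
have p0 : p != 0 by apply: contraNneq ck => p0; rewrite -pE p0 coef0.
under eq_bigr do rewrite -pE.
move: p p0 {pE} (size_poly n (fun i => if insub i is Some k then c k else 0) : (size p <= n)%N).
elim: n {c k ck} => [|n IH] p p0; first by rewrite leqn0 size_poly_eq0 (negPf p0).
move=> pn E; have [p1|p1] := eqVneq (size p) 1.
  exfalso; move/eqP: p1 => /size_poly1P[b b0 pE]; move: E; rewrite pE big_ord_recl /= coefC eqxx.
  rewrite big1 ?addr0 => [|i _]; last by rewrite coefC /= scale0r.
  by move=> /eqP; rewrite scaler_eq0 (negPf b0) (negPf x0).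
have [l /factor_theorem[r pr]] := closed_rootP _ p1.
have r0 : r != 0 by apply: contraNneq p0 => r0; rewrite pr r0 mul0r.
have rn : (size r <= n)%N by move: pn; rewrite pr size_Mmonic ?monicXsubC// size_XsubC addn2.
have [y0|y0] := eqVneq (\sum_(k < n) r`_k *: iter k phi x) 0; first exact: IH r0 rn y0.
exists l, (\sum_(k < n) r`_k *: iter k phi x); split=> //.
apply/eqP; rewrite -subr_eq0; apply/eqP; rewrite -[RHS]E.
rewrite (linear_fun_sum lphi).
have prE i : p`_i = (r * 'X)`_i - r`_i * l by rewrite pr mulrBr coefB coefMC.
under [RHS]eq_bigr do rewrite prE scalerBl.
rewrite sumrB; congr (_ - _).
  rewrite [RHS]big_ord_recl coefMX eqxx scale0r add0r; apply: eq_bigr => i _.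
  by rewrite coefMX /= (linear_funZ lphi).
rewrite [RHS]big_ord_recr /= (nth_default _ rn) mul0r scale0r addr0 scaler_sumr.
by apply: eq_bigr => i _; rewrite scalerA mulrC.
Qed.

End LinearDependence.

Section Intertwiners.
Variables (R : realType) (A : cstarAlgType R).
Local Notation C := (cplx R).
Implicit Types G H K L : hilbertType R.

Definition intertwines K L (pi : A -> 'B(K)) (rho : A -> 'B(L)) (X : 'B(K, L)) : Prop :=
  forall a x, X (pi a x) = rho a (X x).

Lemma intertwines_id K (pi : A -> 'B(K)) : intertwines pi pi (bop_id K).
Proof. by []. Qed.

Lemma intertwines_lin K L (pi : A -> 'B(K)) (rho : A -> 'B(L)) c X Y :
  intertwines pi rho X -> intertwines pi rho Y -> intertwines pi rho (c *: X + Y).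
Proof. by move=> iX iY a x; rewrite !bopDE !bopZE iX iY bopD bopZ. Qed.

Lemma intertwines0 K L (pi : A -> 'B(K)) (rho : A -> 'B(L)) : intertwines pi rho 0.
Proof. by move=> a x; rewrite !bop0E bop0. Qed.

Lemma intertwinesZ K L (pi : A -> 'B(K)) (rho : A -> 'B(L)) c X :
  intertwines pi rho X -> intertwines pi rho (c *: X).
Proof. by move=> iX; rewrite -[c *: X]addr0; apply: intertwines_lin => //; exact: intertwines0. Qed.

Lemma intertwinesD K L (pi : A -> 'B(K)) (rho : A -> 'B(L)) X Y :
  intertwines pi rho X -> intertwines pi rho Y -> intertwines pi rho (X + Y).
Proof. by move=> iX iY; rewrite -[X]scale1r; exact: intertwines_lin. Qed.

Lemma intertwinesB K L (pi : A -> 'B(K)) (rho : A -> 'B(L)) X Y :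
  intertwines pi rho X -> intertwines pi rho Y -> intertwines pi rho (X - Y).
Proof. by move=> iX iY; rewrite addrC -scaleN1r; exact: intertwines_lin. Qed.

Lemma intertwines_sum (I : Type) (r : seq I) (P : pred I) K L (pi : A -> 'B(K))
    (rho : A -> 'B(L)) (X : I -> 'B(K, L)) :
  (forall i, P i -> intertwines pi rho (X i)) -> intertwines pi rho (\sum_(i <- r | P i) X i).
Proof.
by move=> iX; apply: big_ind => //; [exact: intertwines0 | move=> *; exact: intertwinesD].
Qed.

Lemma intertwines_comp G K L (pi : A -> 'B(G)) (rho : A -> 'B(K)) (sig : A -> 'B(L)) X Y :
  intertwines rho sig X -> intertwines pi rho Y -> intertwines pi sig (X \oB Y).
Proof. by move=> iX iY a x; rewrite !bop_compE iY iX. Qed.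

Lemma intertwines_adj K L (pi : A -> 'B(K)) (rho : A -> 'B(L)) X :
  representation pi -> representation rho -> intertwines pi rho X -> intertwines rho pi (adj X).
Proof.
move=> [_ _ _ spi] [_ _ _ srho] iX a x; apply: inner_eq => y.
by rewrite -adjP -(adjE (rho a)) -srho -iX -(adjE (pi a)) -spi adjP.
Qed.

Definition restrict K (pi : A -> 'B(K)) (S : csubspace K) (a : A) : 'B(S) :=
  Ad (csubspace_incl S) (pi a).

Definition invariant K (pi : A -> 'B(K)) (S : csubspace K) : Prop :=
  forall a x, S x -> S (pi a x).

Section Restriction.
Variables (K : hilbertType R) (pi : A -> 'B(K)) (S : csubspace K).
Hypotheses (rpi : representation pi) (iS : invariant pi S).

Lemma restrictE a (x : S) : val (restrict pi S a x) = pi a (val x).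
Proof.
rewrite /restrict /Ad !bop_compE csubspace_inclE -prjE prj_id//.
by apply: iS; exact: valP.
Qed.

Lemma incl_intertwines : intertwines (restrict pi S) pi (csubspace_incl S).
Proof. by move=> a x; rewrite !csubspace_inclE restrictE. Qed.

Lemma restrict_representation : representation (restrict pi S).
Proof.
have [lpi pi1 mpi spi] := rpi; split=> [c a b||a b|a].
- by rewrite /restrict lpi Ad_linear.
- by apply: bopP => x; apply: val_inj; rewrite restrictE pi1.
- by apply: bopP => x; apply: val_inj; rewrite bop_compE !restrictE mpi.
- by rewrite /restrict spi /Ad !adj_comp adjK; apply: bopP => x.
Qed.

(** The range of [pi] is closed under adjoints, so the orthogonal complement of [S] is invariant as
    well. *)
Lemma prj_intertwines : intertwines pi pi (prj S).
Proof.
have [_ _ _ spi] := rpi.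
have K1 a x : prj S (pi a (prj S x)) = pi a (prj S x).
  by apply: prj_id; apply: iS; exact: prj_in.
move=> a x; apply: inner_eq => y.
rewrite innerC [RHS]innerC; congr (_^*).
by rewrite prj_inner adjP -spi -K1 -prj_inner spi -adjP -prj_inner K1.
Qed.

End Restriction.

End Intertwiners.

(** * The commutant of a minimal dilation and its irreducible summands *)

Section CommutantFactorization.
Variables (R : realType) (A : cstarAlgType R) (H K : hilbertType R).
Local Notation C := (cplx R).
Variables (d : nat) (e : 'I_d -> H) (oe : onb e).
Variables (Phi : A -> 'B(H)) (pi : A -> 'B(K)) (V : 'B(H, K)).
Hypotheses (rpi : representation pi) (PhiE : forall a, Phi a = Ad V (pi a)) (cV : cyclic pi V).
Hypothesis dominatedP : forall Psi : A -> 'B(H), completely_positive Psi ->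
  completely_positive (Phi - Psi) -> exists Q : 'B(H), forall a, Psi a = Ad Q (Phi a).

Local Notation comm := (intertwines pi pi).

(** Invariance of the range of [V], together with an operator [Q] that implements it on [H]; [Q] is
    unique only modulo the kernel of [V]. *)
Definition nest_alg (Z : 'B(K)) : Prop :=
  comm Z /\ exists Q : 'B(H), forall x, Z (V x) = V (Q x).

Lemma nest_alg_lin c X Y : nest_alg X -> nest_alg Y -> nest_alg (c *: X + Y).
Proof.
move=> [iX [Q QX]] [iY [Q' QY]]; split; first exact: intertwines_lin.
by exists (c *: Q + Q') => x; rewrite !bopDE !bopZE QX QY bopD bopZ.
Qed.

Lemma nest_alg_comp X Y : nest_alg X -> nest_alg Y -> nest_alg (X \oB Y).
Proof.
move=> [iX [Q QX]] [iY [Q' QY]]; split; first exact: intertwines_comp iX iY.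
by exists (Q \oB Q') => x; rewrite !bop_compE QY QX.
Qed.

Lemma nest_alg0 : nest_alg 0.
Proof.
by split; [exact: intertwines0 | exists 0 => x; rewrite !bop0E bop0].
Qed.

Lemma cyclic_form_eq (X Y : 'B(K)) :
  (forall a x b y, '[X (pi a (V x)), pi b (V y)] = '[Y (pi a (V x)), pi b (V y)]) -> X = Y.
Proof.
move=> XY; apply: (cyclic_eq cV) => a x; apply/eqP; rewrite -subr_eq0; apply/eqP.
apply: (@dense_inner_eq0 _ _ (range (comb pi V))) => [z k /(cV z)[s sP]|_ [s _ <-]].
  by exists (comb pi V s) => //; exists s.
by rewrite /comb inner_sumr big1// => p _; rewrite innerBl XY subrr.
Qed.

Lemma repM a b x : pi (a * b) x = pi a (pi b x).
Proof. by have [_ _ mpi _] := rpi; rewrite mpi. Qed.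

Lemma rep_inner a b x y : '[pi a x, pi b y] = '[pi (star b * a) x, y].
Proof. by have [_ _ mpi spi] := rpi; rewrite mpi spi bop_compE adjE. Qed.

Lemma commutant_form_cp (D : 'B(K)) : comm D -> positive_op D ->
  completely_positive (fun a => Ad V (D \oB pi a)).
Proof.
move=> iD D0; have [lpi _ mpi spi] := rpi.
apply: (@cp_form _ _ _ _ _ (fun a x => pi a (V x)) D) => // [c a b|a b x y].
  rewrite lpi (_ : D \oB _ = c *: (D \oB pi a) + D \oB pi b) ?Ad_linear//.
  by apply: bopP => x; rewrite bop_compE !bopDE !bopZE bopD bopZ.
by rewrite AdE bop_compE iD mpi spi bop_compE adjE -iD.
Qed.

(* Domination makes Ad V (D pi) equal to Ad Q Phi, and then Z sends pi a (V x) to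
   pi a (V (Q x)). *)
Lemma factor_small (D : 'B(K)) : comm D -> positive_op D -> (forall x, '[D x, x] <= '[x, x]) ->
  exists2 Z, nest_alg Z & adj Z \oB Z = D.
Proof.
move=> iD D0 D1; have [lpi pi1 mpi spi] := rpi.
have [|Q QP] := dominatedP (commutant_form_cp iD D0).
  have iD' : comm (bop_id K - D) by apply: intertwinesB => //; exact: intertwines_id.
  have D'0 : positive_op (bop_id K - D) by move=> x; rewrite bopBE innerBl subr_ge0.
  have := commutant_form_cp iD' D'0; congr completely_positive; apply/funext => a.
  rewrite -[RHS]/(Phi a - Ad V (D \oB pi a)) PhiE.
  by apply: bop_ext => x y; rewrite bopBE innerBl !AdE !bop_compE bopBE innerBl.
have QE a x y : '[D (pi a (V x)), V y] = '[pi a (V (Q x)), V (Q y)].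
  by have := AdE V (D \oB pi a) x y; rewrite bop_compE => <-; rewrite QP PhiE Ad_comp AdE.
pose f a : 'B(H, K) := pi a \oB V \oB Q.
have fE s : '[\sum_(p <- s) f p.1 p.2, \sum_(p <- s) f p.1 p.2] = '[D (comb pi V s), comb pi V s].
  rewrite /comb bop_sum !inner_suml; apply: eq_bigr => p _.
  rewrite !inner_sumr; apply: eq_bigr => q _; rewrite /f !bop_compE.
  by rewrite iD !rep_inner -iD QE.
have [|Z ZP] := cyclic_extend cV (@ler01 C) (f := f).
  by move=> s; apply: normr_sqr_le => //; rewrite expr1n mul1r fE.
exists Z.
  split; last by exists Q => x; have := ZP 1 x; rewrite /f !bop_compE pi1.
  move=> a x; suff /bop_eqP : Z \oB pi a = pi a \oB Z by exact.
  apply: (cyclic_eq cV) => b y; rewrite !bop_compE ZP -repM ZP /f !bop_compE.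
  exact: repM.
apply: cyclic_form_eq => a x b y; rewrite bop_compE adjE !ZP /f !bop_compE.
by rewrite iD !rep_inner -iD QE.
Qed.

(** Scaling reduces to [D <= 1]; dividing by [M + 1] instead of [M] allows [M = 0]. *)
Lemma nest_alg_factor (D : 'B(K)) : comm D -> positive_op D ->
  exists2 Z, nest_alg Z & adj Z \oB Z = D.
Proof.
move=> iD D0; have [M M0 DM] := bop_bounded D.
have M1 : 0 < M + 1 by rewrite ltr_wpDl.
have c0 : 0 < (M + 1)^-1 by rewrite invr_gt0.
have [|||Z ZB ZZ] := @factor_small ((M + 1)^-1 *: D).
- exact: intertwinesZ.
- by move=> x; rewrite bopZE innerZl mulr_ge0// ltW.
- move=> x; rewrite bopZE innerZl ler_pdivrMl//.
  rewrite -(ger0_norm (D0 x)) (le_trans (cauchy_schwarz _ _))// -normr_inner expr2 mulrA.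
  by rewrite ler_wpM2r// (le_trans (DM x))// ler_wpM2r// lerDl.
exists (sqrtC (M + 1) *: Z); first by rewrite -[_ *: Z]addr0; apply: nest_alg_lin => //; exact: nest_alg0.
have s0 : 0 <= sqrtC (M + 1) by rewrite sqrtC_ge0 ltW.
apply: bopP => x; rewrite adjZ (conj_Creal (ger0_real s0)) bop_compE !bopZE bopZ.
move/bop_eqP: ZZ => /(_ x); rewrite bop_compE bopZE => ->.
by rewrite !scalerA -expr2 sqrtCK mulfV ?scale1r// gt_eqF.
Qed.

Lemma nest_alg_eq0 (Z : 'B(K)) : comm Z -> (forall x, Z (V x) = 0) -> Z = 0.
Proof.
by move=> iZ Z0; apply: (cyclic_eq cV) => a x; rewrite iZ Z0 bop0 bop0E.
Qed.

Lemma nest_alg_dependent (I : finType) (Z : I -> 'B(K)) : (forall i, nest_alg (Z i)) ->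
  (d * d < #|I|)%N -> exists2 c : I -> C, (exists i, c i != 0) & \sum_i c i *: Z i = 0.
Proof.
move=> ZB dI; have /choice[Q QP] : forall i, exists Q : 'B(H), forall x, Z i (V x) = V (Q x).
  by move=> i; have [_] := ZB i.
have [c cn0 c0] := bop_family_dependent Q oe dI.
exists c => //; apply: nest_alg_eq0.
  by apply: intertwines_sum => i _; apply: intertwinesZ; exact: (ZB i).1.
move=> x; rewrite bop_sumE; under eq_bigr do rewrite bopZE QP -bopZ.
rewrite -bop_sum; under eq_bigr do rewrite -bopZE.
by rewrite -bop_sumE c0 bop0E bop0.
Qed.

(* An element of nest_alg is determined by an operator on H, hence nest_alg is
   finite-dimensional; the positive elements Z^* Z of the commutant then span a
   finite-dimensional space. *)
Lemma commutant_spanned : exists (J : finType) (mu : J -> 'B(K)),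
  forall X, comm X -> exists c : J -> C, X = \sum_j c j *: mu j.
Proof.
have [|n [Z [ZB Zspan]]] := @maximal_family _ _ nest_alg (d * d).
  move=> n z zB zi; rewrite leqNgt; apply/negP => dn.
  have [|c [i ci] c0] := nest_alg_dependent zB; first by rewrite card_ord.
  by move/eqP: ci; apply; exact: zi.
pose mu (kl : 'I_n * 'I_n) := adj (Z kl.1) \oB Z kl.2.
exists ('I_n * 'I_n)%type, mu.
pose Sp X := exists c : 'I_n * 'I_n -> C, X = \sum_j c j *: mu j.
have Sp_lin c X Y : Sp X -> Sp Y -> Sp (c *: X + Y).
  move=> [x ->] [y ->]; exists (fun j => c * x j + y j).
  rewrite scaler_sumr -big_split; apply: eq_bigr => j _.
  by rewrite scalerA scalerDl.
have Sp_pos D : comm D -> positive_op D -> Sp D.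
  move=> iD D0; have [W WB WD] := nest_alg_factor iD D0; have [c cW] := Zspan _ WB.
  exists (fun kl => (c kl.1)^* * c kl.2).
  rewrite -(pair_bigA _ (fun k l => ((c k)^* * c l) *: mu (k, l)))/=.
  rewrite -WD {1}cW adj_sum; apply: bopP => x; rewrite bop_compE !bop_sumE.
  apply: eq_bigr => k _; rewrite bop_sumE adjZ bopZE cW bop_sumE bop_sum scaler_sumr.
  by apply: eq_bigr => l _; rewrite !bopZE bopZ scalerA.
(* A self-adjoint [T] with bound [M] is the difference of the positive operators [T + M] and [M]. *)
have Sp_self T : comm T -> adj T = T -> Sp T.
  move=> iT Ts; have [M M0 TM] := bop_bounded T.
  have i1 : comm (M *: bop_id K) by apply: intertwinesZ; exact: intertwines_id.
  have h1 : Sp (M *: bop_id K).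
    by apply: Sp_pos => // x; rewrite bopZE innerZl mulr_ge0// inner_ge0.
  have h2 : Sp (T + M *: bop_id K).
    apply: Sp_pos => [|x]; first exact: intertwinesD.
    rewrite bopDE bopZE innerDl innerZl -normr_inner.
    have Tr : '[T x, x] \is Num.real by rewrite CrealE -innerC -adjE Ts.
    rewrite -lerBlDr sub0r.
    have : `|'[T x, x]| <= M * `|x| ^+ 2.
      by rewrite (le_trans (cauchy_schwarz _ _))// expr2 mulrA ler_wpM2r.
    by rewrite real_ler_norml// => /andP[].
  have -> : T = (- 1) *: (M *: bop_id K) + (T + M *: bop_id K).
    by rewrite scaleN1r addrC addrK.
  exact: Sp_lin.
move=> X iX.
have iX' : comm (adj X) by exact: intertwines_adj.
have h1 : Sp (X + adj X) by apply: Sp_self; [exact: intertwinesD | rewrite adjD adjK addrC].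
have h2 : Sp ('i *: (X - adj X)).
  apply: Sp_self; first by apply: intertwinesZ; exact: intertwinesB.
  by rewrite adjZ conjCi adjB adjK scaleNr -scalerN opprB.
(* Decomposition into self-adjoint parts, both in the span; the last summand gives the right-hand
   side the form [c X + Y] of [Sp_lin]. *)
have -> : X = 2^-1 *: (X + adj X) + ((- 2^-1 * 'i) *: ('i *: (X - adj X)) + 0 *: (X + adj X)).
  rewrite scale0r addr0 scalerA -mulrA -expr2 sqrCi mulrNN mulr1 -scalerDr addrACA subrr addr0.
  apply: bopP => x; rewrite bopZE bopDE.
  have -> : X x + X x = (2 : C) *: X x by rewrite scaler_nat mulr2n.
  by rewrite scalerA mulVf ?scale1r// pnatr_eq0.
apply: (Sp_lin _ _ _ h1); apply: (Sp_lin _ _ _ h2).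
by rewrite -[0 *: _]addr0; apply: Sp_lin => //; exists (fun=> 0); rewrite big1// => j _; rewrite scale0r.
Qed.

Definition orthogonal_family (I : Type) (S : I -> csubspace K) : Prop :=
  forall i j x y, i <> j -> S i x -> S j y -> '[x, y] = 0.

(** The factors [Z i] of the projections onto the [S i] are linearly independent: a nonzero vector
    of [S i] is killed by every other [Z j] but not by [Z i]. At most [d * d] elements of [nest_alg]
    are independent. *)
Lemma orthogonal_family_bound (I : finType) (S : I -> csubspace K) : orthogonal_family S ->
  (forall i, invariant pi (S i)) -> (forall i, exists2 x, S i x & x != 0) -> (#|I| <= d * d)%N.
Proof.
move=> oS iS nS; rewrite leqNgt; apply/negP => dI.
have pos i : positive_op (prj (S i)).
  by move=> x; rewrite -prjK prj_inner inner_ge0.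
have /choice[Z ZP] : forall i, exists Z, nest_alg Z /\ adj Z \oB Z = prj (S i).
  by move=> i; have [Z ZB ZZ] := nest_alg_factor (prj_intertwines rpi (iS i)) (pos i); exists Z.
have [c [i ci] c0] := nest_alg_dependent (fun i => (ZP i).1) dI.
have [x Sx x0] := nS i.
have Zx j : '[Z j x, Z j x] = '[prj (S j) x, x] by rewrite -adjE -bop_compE (ZP j).2.
have Zji j : j <> i -> Z j x = 0.
  move=> ji; apply: inner_eq0; rewrite Zx -prjK prj_inner.
  rewrite (_ : prj (S j) x = 0) ?inner0l//; apply: prj_eq0 => y Sy.
  by rewrite innerC (oS _ _ _ _ ji Sy Sx) conjC0.
have : c i *: Z i x = 0.
  move/bop_eqP: c0 => /(_ x); rewrite bop_sumE bop0E (bigD1 i)//= big1 ?addr0// => j ji.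
  by rewrite -[LHS]/(c j *: Z j x) Zji ?scaler0//; exact/eqP.
move/eqP; rewrite scaler_eq0 (negPf ci) => /eqP Zi0.
by move/eqP: x0; apply; apply: inner_eq0; have := Zx i; rewrite Zi0 inner0l prj_id.
Qed.

Lemma ker2_csubspace L L' (X : 'B(K, L)) (Y : 'B(K, L')) :
  exists S : csubspace K, forall x, S x <-> X x = 0 /\ Y x = 0.
Proof.
exists (orthc (range (adj X) `|` range (adj Y))) => x; split=> [/orthcP xS|[Xx Yx]].
  split; apply: inner_eq0.
    by rewrite -(adjE X); apply: xS; left; exists (X x).
  by rewrite -(adjE Y); apply: xS; right; exists (Y x).
by apply/orthcP => _ [[y _ <-]|[y _ <-]]; rewrite adjE ?Xx ?Yx inner0r.
Qed.

(** The powers of [X] lie in a finite-dimensional space, so composition with [X], started at the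
    identity, has an eigenvector: an operator [Y] with [X Y = l Y]. Every nonzero value of [Y] is an
    eigenvector of [X]. *)
Lemma commutant_eigenvector (S : csubspace K) (X : 'B(S)) : invariant pi S ->
  (exists2 x, S x & x != 0) -> intertwines (restrict pi S) (restrict pi S) X ->
  exists l (x : S), x != 0 /\ X x = l *: x.
Proof.
move=> iS [x0 Sx0 x0n] iX; have [J [mu muP]] := commutant_spanned.
pose phi (Y : 'B(S)) := X \oB Y.
have lphi : linear phi by move=> c Y Y'; apply: bopP => x; rewrite /phi !bop_compE bopD bopZ.
have ik k : intertwines (restrict pi S) (restrict pi S) (iter k phi (bop_id S)).
  elim: k => [|k IH]; first exact: intertwines_id.
  by rewrite iterS; apply: intertwines_comp iX IH.
have iincl := incl_intertwines iS.
have rS := restrict_representation rpi iS.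
(* The powers of [X] are extended by 0 to [K], where they belong to the commutant; one more of them
   than the spanning family [mu] has members forces a dependence. *)
pose w (k : 'I_#|J|.+1) := csubspace_incl S \oB iter k phi (bop_id S) \oB adj (csubspace_incl S).
have /choice[c cP] : forall k, exists c : J -> C, w k = \sum_j c j *: mu j.
  move=> k; apply: muP; apply: intertwines_comp; last exact: intertwines_adj iincl.
  exact: intertwines_comp iincl (ik k).
have [a an0 a0] := span_dependent cP (ltnSn _).
have id0 : bop_id S != 0.
  apply: contra_neq x0n => /bop_eqP/(_ (CsubspaceVec Sx0)) E.
  by have := congr1 val E; rewrite bop0E linear0.
have [|l [Y [Y0 YP]]] := eigenvector_of_dependent lphi id0 an0.
  apply: bopP => x; apply: val_inj; move/bop_eqP: a0 => /(_ (val x)); rewrite !bop0E linear0 => <-.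
  rewrite !bop_sumE linear_sum; apply: eq_bigr => k _.
  by rewrite !bopZE linearZ /w !bop_compE adj_csubspace_inclE.
have [x Yx] : exists x, Y x != 0.
  apply: contrapT => H'; move/eqP: Y0; apply; apply: bopP => x; rewrite bop0E.
  by apply: contrapT => Yx; apply: H'; exists x; apply/eqP.
exists l, (Y x); split=> //.
by move/bop_eqP: YP => /(_ x); rewrite /phi bop_compE bopZE.
Qed.

(** A largest orthogonal family of nonzero invariant subspaces exists by [orthogonal_family_bound].
    A nonscalar operator in the commutant of a summand would split it along an eigenspace, and a
    nonzero orthogonal complement of all the summands could be added; both contradict maximality. *)
Lemma irreducible_decomposition : exists n (S : 'I_n -> csubspace K),
  [/\ orthogonal_family S, forall i, invariant pi (S i), forall i, exists2 x, S i x & x != 0,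
      forall i, irreducible (restrict pi (S i)) & \sum_i prj (S i) = bop_id K].
Proof.
pose Q n := `[< exists S : 'I_n -> csubspace K, [/\ orthogonal_family S,
   forall i, invariant pi (S i) & forall i, exists2 x, S i x & x != 0] >].
have Q0 : exists n, Q n.
  exists 0%N; apply/asboolP; exists (fun=> orthc set0).
  by split=> [[]//|[]//|[]].
have Qm n : Q n -> (n <= d * d)%N.
  by move=> /asboolP[S [oS iS nS]]; have := orthogonal_family_bound oS iS nS; rewrite card_ord.
have [n /asboolP[S [oS iS nS]] nmax] := ex_maxnP Q0 Qm.
have nomore (S' : option 'I_n -> csubspace K) : orthogonal_family S' ->
    (forall i, invariant pi (S' i)) -> (forall i, exists2 x, S' i x & x != 0) -> False.
  move=> oS' iS' nS'.
  have co : #|{: option 'I_n}| = n.+1 by rewrite card_option card_ord.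
  have : Q n.+1.
    apply/asboolP; rewrite -co; exists (fun i => S' (enum_val i)); split=> // i j x y ij.
    by apply: oS' => /enum_val_inj.
  by move=> /nmax; rewrite ltnn.
exists n, S; split=> //.
- move=> i; have ri := restrict_representation rpi (iS i); split=> //.
  apply/seteqP; split=> [X XC|_ [c _ <-]]; last first.
    rewrite /commutant/= => _ [a _ <-]; apply: bopP => x.
    exact: (esym (bopZ (restrict pi (S i) a) c x)).
  have iX : intertwines (restrict pi (S i)) (restrict pi (S i)) X.
    by move=> a x; have /bop_eqP/(_ x) := XC _ (ex_intro2 _ _ a I erefl).
  have [l [y [y0 Xy]]] := commutant_eigenvector (iS i) (nS i) iX.
  exists l => //; apply: esym.
  pose j := csubspace_incl (S i); pose Y := X - l *: bop_id (S i).
  have iY : intertwines (restrict pi (S i)) (restrict pi (S i)) Y.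
    by apply: intertwinesB => //; apply: intertwinesZ; exact: intertwines_id.
  pose E := j \oB Y \oB adj j.
  have iE : comm E.
    apply: intertwines_comp; last exact: intertwines_adj (incl_intertwines (iS i)).
    exact: intertwines_comp (incl_intertwines (iS i)) iY.
  have ip := prj_intertwines rpi (iS i).
  have qE x : (bop_id K - prj (S i)) x = x - prj (S i) x by [].
  (* [S1] is the eigenspace of [X] for [l] inside [S i], and [S2] below is its orthogonal complement
     there. *)
  have [S1 S1P] := ker2_csubspace (bop_id K - prj (S i)) E.
  have S1S x : S1 x -> S i x.
    by move=> /S1P[]; rewrite bopBE => /eqP; rewrite subr_eq0 => /eqP/esym/prjP.
  have iS1 : invariant pi S1.
    move=> a x /S1P[x1 x2]; apply/S1P; rewrite iE x2 bop0; split=> //.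
    by move: x1; rewrite !qE ip -(bopB (pi a)) => ->; rewrite bop0.
  have ip1 := prj_intertwines rpi iS1.
  have [S2 S2P] := ker2_csubspace (bop_id K - prj (S i)) (prj S1).
  have S2S x : S2 x -> S i x.
    by move=> /S2P[]; rewrite bopBE => /eqP; rewrite subr_eq0 => /eqP/esym/prjP.
  have iS2 : invariant pi S2.
    move=> a x /S2P[x1 x2]; apply/S2P; rewrite ip1 x2 bop0; split=> //.
    by move: x1; rewrite !qE ip -(bopB (pi a)) => ->; rewrite bop0.
  have S20 x : S2 x -> x = 0.
    move=> S2x; apply: contrapT => /eqP x0.
    apply: (nomore (fun o => if o is Some k then if k == i then S1 else S k else S2)).
    - have o12 u v : S1 u -> S2 v -> '[u, v] = 0.
        by move=> S1u /S2P[_ v0]; rewrite -(prj_id S1u) prj_inner v0 inner0r.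
      have oi2 k u v : k <> i -> S k u -> S2 v -> '[u, v] = 0.
        by move=> ki Su /S2S Sv; exact: oS ki Su Sv.
      have oi1 k u v : k <> i -> S k u -> S1 v -> '[u, v] = 0.
        by move=> ki Su /S1S Sv; exact: oS ki Su Sv.
      have sym u v : '[u, v] = 0 -> '[v, u] = 0 by move=> uv; rewrite innerC uv conjC0.
      move=> [k|] [k'|] u v kk' //; last first.
      + by case: eqP => [_|ki] Su Sv; apply: sym; [exact: o12 | exact: oi2 ki Sv Su].
      + by case: eqP => [_|ki] Su Sv; [exact: o12 | exact: oi2 ki Su Sv].
      case: eqP => [ki|ki]; case: eqP => [k'i|k'i] Su Sv.
      + by exfalso; apply: kk'; rewrite ki k'i.
      + by apply: sym; exact: oi1 k'i Sv Su.
      + exact: oi1 ki Su Sv.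
      + by apply: oS Su Sv => kk; apply: kk'; rewrite kk.
    - by move=> [k|]//; case: eqP => // _; exact: iS.
    - move=> [k|]; last by exists x.
      case: eqP => [_|_]; last exact: nS.
      exists (val y).
        apply/S1P; rewrite bopBE prj_id ?subrr; last exact: valP.
        split=> //; rewrite /E !bop_compE adj_csubspace_inclE /Y bopBE Xy bopZE subrr.
        exact: bop0.
      by apply: contra_neq y0 => y0; apply: val_inj; rewrite y0 linear0.
  apply: bopP => x; apply/eqP; rewrite -subr_eq0; apply/eqP.
  have x2 : S2 (val x - prj S1 (val x)).
    apply/S2P; split; last by rewrite bopB prjK subrr.
    rewrite qE (bopB (prj (S i))) (prj_id (valP x)) (prj_id (S1S _ (prj_in S1 _))).
    exact: subrr.
  have /S1P[_] : S1 (val x).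
    by apply/prjP/esym/eqP; rewrite -subr_eq0; apply/eqP; exact: S20.
  by rewrite /E !bop_compE adj_csubspace_inclE /Y bopBE => E0; apply: val_inj; rewrite linear0.
have pS (k l : 'I_n) x : S l x -> prj (S k) x = if k == l then x else 0.
  case: eqP => [->|kl] Sx; first exact: prj_id.
  by apply: prj_eq0 => y Sy; rewrite innerC (oS _ _ _ _ kl Sy Sx) conjC0.
set T := \sum_i prj (S i).
have TS l x : S l x -> T x = x.
  move=> Sx; rewrite /T bop_sumE (bigD1 l)//= big1 ?addr0 => [|k kl]; rewrite (pS _ l)//.
    by rewrite eqxx.
  by rewrite (negPf kl).
have TT x : T (T x) = T x.
  have TE y : T y = \sum_k prj (S k) y by rewrite bop_sumE.
  rewrite {1}(TE x) (bop_sum _ _ T) [RHS]TE; apply: eq_bigr => k _.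
  by apply: (TS k); exact: prj_in.
have Ts : adj T = T by rewrite adj_sum; apply: eq_bigr => k _; exact: adj_prj.
have iT : comm T by apply: intertwines_sum => k _; exact: prj_intertwines.
(* The projections add up to the projection [T]. If [T x] differs from [x], the kernel of [T] is a
   nonzero invariant subspace orthogonal to the whole family. *)
apply: bopP => x; apply/eqP; rewrite -subr_eq0; apply/eqP; apply: contrapT => /eqP Tx.
apply: (nomore (fun o => if o is Some k then S k else ker_csubspace T)).
- have oT l u v : S l u -> T v = 0 -> '[u, v] = 0.
    by move=> Su Tv; rewrite -(TS l u Su) -{1}Ts adjE Tv inner0r.
  move=> [k|] [k'|] u v kk' //.
  + by apply: oS => kk; apply: kk'; rewrite kk.
  + by move=> Su /ker_csubspaceP Tv; exact: oT Su Tv.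
  + by move=> /ker_csubspaceP Tu Sv; rewrite innerC (oT _ _ _ Sv Tu) conjC0.
- move=> [k|]; first exact: iS.
  by move=> a u /ker_csubspaceP Tu; apply/ker_csubspaceP; rewrite iT Tu bop0.
- move=> [k|]; first exact: nS.
  by exists (T x - bop_id K x) => //; apply/ker_csubspaceP; rewrite bopB TT subrr.
Qed.

End CommutantFactorization.

(** * Schur's lemma and pure compressions *)

Section Schur.
Variables (R : realType) (A : cstarAlgType R).
Local Notation C := (cplx R).
Implicit Types G H K L : hilbertType R.

Lemma schur_scalar K (pi : A -> 'B(K)) X : irreducible pi -> intertwines pi pi X ->
  exists c : C, X = c *: bop_id K.
Proof.
move=> [_ ipi] iX; have : commutant (range pi) X.
  by rewrite /commutant /= => _ [a _ <-]; apply: bopP => x; exact: iX.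
by rewrite ipi => -[c _ <-]; exists c.
Qed.

Lemma equivalent_refl K (pi : A -> 'B(K)) : equivalent pi pi.
Proof.
exists (bop_id K); first by split; rewrite adj_id; apply: bopP.
by move=> a; rewrite adj_id; apply: bopP.
Qed.

Lemma equivalentP K L (pi : A -> 'B(K)) (rho : A -> 'B(L)) :
  equivalent pi rho <-> exists2 U, unitary_op U & intertwines pi rho U.
Proof.
split=> [[U uU E]|[U uU iU]]; exists U => //.
  by move=> a x; rewrite E !bop_compE; have /bop_eqP/(_ x) := uU.1; rewrite bop_compE => ->.
move=> a; apply: bopP => x; rewrite !bop_compE iU.
by have /bop_eqP/(_ x) := uU.2; rewrite bop_compE => ->.
Qed.

Lemma equivalent_sym K L (pi : A -> 'B(K)) (rho : A -> 'B(L)) :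
  equivalent pi rho -> equivalent rho pi.
Proof.
move=> [U [u1 u2] E]; exists (adj U); first by split; rewrite adjK.
move=> a; rewrite adjK E; apply: bopP => x; rewrite !bop_compE.
have /bop_eqP u1x := u1.
by have := u1x x; have := u1x (pi a x); rewrite !bop_compE => e1 e2; rewrite e2 e1.
Qed.

Lemma equivalent_trans G K L (pi : A -> 'B(G)) (rho : A -> 'B(K)) (sig : A -> 'B(L)) :
  equivalent pi rho -> equivalent rho sig -> equivalent pi sig.
Proof.
move=> [U [u1 u2] E] [U' [u1' u2'] E']; exists (U' \oB U).
  split; rewrite adj_comp; apply: bopP => x; rewrite !bop_compE.
    have /bop_eqP/(_ (U x)) := u1'; rewrite bop_compE => ->.
    by have /bop_eqP/(_ x) := u1.
  have /bop_eqP/(_ (adj U' x)) := u2; rewrite bop_compE => ->.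
  by have /bop_eqP/(_ x) := u2'.
by move=> a; rewrite E' E adj_comp; apply: bopP => x.
Qed.

(** [X^* X] and [X X^*] are scalars, equal because [X X^* X] can be read in two ways, and positive;
    dividing [X] by the square root makes it unitary. *)
Lemma schur_equivalent K L (pi : A -> 'B(K)) (rho : A -> 'B(L)) X :
  irreducible pi -> irreducible rho -> intertwines pi rho X -> X <> 0 -> equivalent pi rho.
Proof.
move=> ipi irho iX X0; have iX' := intertwines_adj ipi.1 irho.1 iX.
have [c cE] := schur_scalar ipi (intertwines_comp iX' iX).
have [c' c'E] := schur_scalar irho (intertwines_comp iX iX').
have [x Xx] : exists x, X x <> 0.
  by apply: contrapT => H'; apply: X0; apply: bopP => x; apply: contrapT => Xx; apply: H'; exists x.
have XX y : adj X (X y) = c *: y by move/bop_eqP: cE => /(_ y).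
have XX' y : X (adj X y) = c' *: y by move/bop_eqP: c'E => /(_ y).
have cn : c != 0.
  by apply/eqP => c0; apply: Xx; apply: adj_comp_eq0; rewrite XX c0 scale0r.
have cc' : c = c'.
  have : c *: X x = c' *: X x by rewrite -XX' XX bopZ.
  move/eqP; rewrite -subr_eq0 -scalerBl scaler_eq0 subr_eq0 => /orP[/eqP//|/eqP].
  by move/Xx.
have x0 : 0 < '[x, x].
  rewrite lt_def inner_ge0 andbT; apply/eqP => /inner_eq0 x0.
  by apply: Xx; rewrite x0 bop0.
have c0 : 0 < c.
  rewrite lt_def cn /= -(pmulr_lge0 _ x0) -innerZl -XX adjE; exact: inner_ge0.
have s0 : 0 < sqrtC c by rewrite sqrtC_gt0.
have sr : ((sqrtC c)^-1)^* = (sqrtC c)^-1.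
  by rewrite conj_Creal// rpredV gtr0_real.
apply/equivalentP; exists ((sqrtC c)^-1 *: X); last exact: intertwinesZ.
have sc : (sqrtC c)^-1 * (sqrtC c)^-1 * c = 1.
  by rewrite -invfM -expr2 sqrtCK mulVf.
split; rewrite adjZ sr; apply: bopP => y; rewrite bop_compE !bopZE bopZ ?XX ?XX' !scalerA -?cc' sc.
  exact: scale1r.
exact: scale1r.
Qed.

Lemma schur_inequivalent K L (pi : A -> 'B(K)) (rho : A -> 'B(L)) X :
  irreducible pi -> irreducible rho -> ~ equivalent pi rho -> intertwines pi rho X -> X = 0.
Proof. by move=> ipi irho ne iX; apply: contrapT => X0; apply: ne; exact: schur_equivalent iX X0. Qed.

(** The closure of the set of combinations is invariant, so its projection is a scalar; it fixes the
    nonzero vector [V x], so the scalar is 1. *)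
Lemma irreducible_cyclic H K (pi : A -> 'B(K)) (V : 'B(H, K)) x : irreducible pi ->
  V x <> 0 -> cyclic pi V.
Proof.
move=> ipi Vx; have [rpi _] := ipi; have [_ pi1 mpi _] := rpi.
have [||S SP] := @closure_csubspace _ _ (range (comb pi V)).
- by exists [::] => //; rewrite /comb big_nil.
- move=> c _ _ [s _ <-] [t _ <-]; exists ([seq (p.1, c *: p.2) | p <- s] ++ t) => //.
  rewrite /comb big_cat big_map /= scaler_sumr; congr (_ + _).
  by apply: eq_bigr => p _; rewrite !bopZ.
have iS : invariant pi S.
  move=> a y /SP yS; apply/SP => k k0; have [M M0 aM] := bop_bounded (pi a).
  have M1 : 0 < M + 1 by rewrite ltr_wpDl.
  have [_ [s _ <-] ys] := yS _ (divr_gt0 k0 M1).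
  exists (pi a (comb pi V s)).
    exists [seq (a * p.1, p.2) | p <- s] => //.
    by rewrite /comb big_map bop_sum; apply: eq_bigr => p _; rewrite mpi.
  rewrite -bopB (le_lt_trans (aM _))// (@le_lt_trans _ _ ((M + 1) * `|y - comb pi V s|))//.
    by rewrite ler_wpM2r// lerDl.
  by rewrite -ltr_pdivlMl// mulrC.
have [c cE] := schur_scalar ipi (prj_intertwines rpi iS).
have SV : S (V x).
  apply/SP => k k0; exists (V x); last by rewrite subrr normr0.
  by exists [:: (1, x)] => //; rewrite /comb big_seq1 pi1.
have c1 : c = 1.
  have := prj_id SV; rewrite cE -[LHS]/(c *: V x) => /eqP.
  rewrite -[X in _ == X]scale1r -subr_eq0 -scalerBl scaler_eq0 subr_eq0 => /orP[/eqP//|/eqP].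
  by move/Vx.
move=> y k k0; have /SP/(_ k k0)[_ [s _ <-] ys] : S y; last by exists s.
by apply/prjP; rewrite cE c1 scale1r.
Qed.

(** Domination makes the assignment of [rho a (V x)] to [pi a (W x)] a contraction. If [W] is
    nonzero it is cyclic, by irreducibility; if [W = 0], domination forces [V = 0]. *)
Lemma dominated_intertwiner H K L (pi : A -> 'B(K)) (W : 'B(H, K)) (rho : A -> 'B(L))
    (V : 'B(H, L)) : irreducible pi -> representation rho ->
  (forall s, '[comb rho V s, comb rho V s] <= '[comb pi W s, comb pi W s]) ->
  exists2 X, intertwines pi rho X & forall x, X (W x) = V x.
Proof.
move=> ipi rrho le; have [rpi _] := ipi.
have [_ pi1 mpi _] := rpi; have [_ rho1 mrho _] := rrho.
have [[x Wx]|W0] := pselect (exists x, W x <> 0); last first.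
  have {}W0 x : W x = 0 by apply: contrapT => Wx; apply: W0; exists x.
  exists 0; first exact: intertwines0.
  move=> x; rewrite bop0E; apply/esym/inner_eq0/eqP; rewrite eq_le inner_ge0 andbT.
  have := le [:: (1, x)]; rewrite /comb !big_seq1 /= pi1 rho1.
  by rewrite -![bop_id _ _]/(_ x) W0 inner0l.
have cW := irreducible_cyclic ipi Wx.
have [|X XP] := cyclic_extend cW (@ler01 C) (f := fun a => rho a \oB V).
  by move=> s; apply: normr_sqr_le => //; rewrite expr1n mul1r; exact: le.
exists X; last by move=> y; have := XP 1 y; rewrite pi1 bop_compE rho1.
move=> a y; suff /bop_eqP/(_ y) : X \oB pi a = rho a \oB X by [].
apply: (cyclic_eq cW) => b z; rewrite !bop_compE XP bop_compE.
have -> : pi a (pi b (W z)) = pi (a * b) (W z) by rewrite mpi.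
by rewrite XP bop_compE mrho.
Qed.

(** A dominated map dilates with an intertwiner [X] from [pi] such that [X W = V]; then [X^* X] is a
    scalar [t] by irreducibility, and comparison at the unit gives [0 <= t <= 1]. *)
Lemma compression_pure G K (pi : A -> 'B(K)) (W : 'B(G, K)) : finite_dimensional G ->
  irreducible pi -> isometric W -> pure_map (fun a => Ad W (pi a)).
Proof.
move=> fG ipi isoW; have [rpi _] := ipi; have [lpi pi1 mpi spi] := rpi.
have cpW : completely_positive (fun a => Ad W (pi a)).
  apply: cp_Ad; apply: (@cp_form _ _ _ _ _ (fun a x => pi a x) (bop_id K)) => //.
  by move=> a b x y; rewrite mpi spi bop_compE adjE.
split=> // Psi cpPsi cpD.
have [K' [rho [V [rrho PsiE _]]]] := stinespring fG cpPsi.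
have PsiE' : Psi = (fun a => Ad V (rho a)) by apply/funext.
have [s|X iX XW] := @dominated_intertwiner _ _ _ pi W rho V ipi rrho.
  by rewrite -!gram_comb// -PsiE' gram_le.
have [t tE] := schur_scalar ipi (intertwines_comp (intertwines_adj rpi rrho iX) iX).
have Psit a : Psi a = t *: Ad W (pi a).
  apply: bop_ext => x y; rewrite bopZE innerZl PsiE !AdE -!XW -iX -adjE.
  by move/bop_eqP: tE => /(_ (pi a (W x))); rewrite bop_compE => ->; rewrite innerZl.
(* On the zero space the scalar is not constrained, and [t = 0] is taken. *)
have [[g g0]|G0] := pselect (exists g : G, g <> 0); last first.
  exists 0; first by rewrite lexx ler01.
  apply/funext => a; apply: bopP => g.
  have -> : g = 0 by apply: contrapT => g0; apply: G0; exists g.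
  by rewrite !bop0.
have gp : 0 < '[g, g].
  by rewrite lt_def inner_ge0 andbT; apply/eqP => /inner_eq0.
exists t; last by apply/funext => a; exact: Psit.
have E1 : '[Psi 1 g, g] = t * '[g, g].
  by rewrite Psit bopZE innerZl AdE pi1 -normr_inner -[bop_id K _]/(W g) -normr_inner isoW.
apply/andP; split.
  rewrite -(pmulr_lge0 _ gp) -E1; exact: cp_unit_positive.
rewrite -(ler_pM2r gp) mul1r -E1 -gram_unit (le_trans (gram_le _ cpD))// gram_unit AdE pi1.
by rewrite -[bop_id K _]/(W g) -!normr_inner isoW.
Qed.

End Schur.

(** * Decomposition of an extreme point *)

Section NestedFamily.
Variables (R : realType) (A : cstarAlgType R).
Local Notation C := (cplx R).
Local Notation "A ^*t" := (map_mx (@Num.conj C) (trmx A)) (at level 8, format "A ^*t").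
Implicit Types H K : hilbertType R.

(** Isometric intertwiners with mutually orthogonal ranges: an orthonormal family in the
    multiplicity space of [pi0]. *)
Definition orthonormal_intertwiners K0 K (pi0 : A -> 'B(K0)) (pi : A -> 'B(K)) n
    (x : 'I_n -> 'B(K0, K)) : Prop :=
  (forall l, intertwines pi0 pi (x l)) /\
  forall l l' y, adj (x l) (x l' y) = (l == l')%:R *: y.

Variables (H K K0 : hilbertType R) (pi : A -> 'B(K)) (V : 'B(H, K)) (pi0 : A -> 'B(K0)).
Hypotheses (rpi : representation pi) (ipi0 : irreducible pi0).
Hypothesis nest_factor : forall D, intertwines pi pi D -> positive_op D ->
  exists2 Z, nest_alg pi V Z & adj Z \oB Z = D.
Hypothesis nz0 : exists y : K0, y != 0.
Variables (n : nat) (x : 'I_n -> 'B(K0, K)).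
Hypothesis ox : orthonormal_intertwiners pi0 pi x.
Hypothesis full_x : forall Y y, intertwines pi0 pi Y -> Y y = \sum_l x l (adj (x l) (Y y)).

(** The operators [x a \oB adj (x b)] are matrix units in the commutant, and [lift] is the resulting
    embedding of the matrix algebra, compatible with products and adjoints. *)
Let lift (m : 'M[C]_n) : 'B(K) := \sum_a \sum_b m a b *: (x a \oB adj (x b)).

Let liftE m y : lift m y = \sum_a \sum_b m a b *: x a (adj (x b) y).
Proof. by rewrite bop_sumE; apply: eq_bigr => a _; rewrite bop_sumE. Qed.

Let ix l : intertwines pi0 pi (x l).
Proof. exact: ox.1. Qed.

Let ix' l : intertwines pi pi0 (adj (x l)).
Proof. by apply: intertwines_adj => //; exact: ipi0.1. Qed.

Let lift_intertwines m : intertwines pi pi (lift m).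
Proof.
apply: intertwines_sum => a _; apply: intertwines_sum => b _; apply: intertwinesZ.
exact: intertwines_comp (ix a) (ix' b).
Qed.

Let adjx_lift m a y : adj (x a) (lift m y) = \sum_b m a b *: adj (x b) y.
Proof.
rewrite liftE bop_sum (bigD1 a)//= [X in _ + X]big1 ?addr0 => [|c ca].
  by rewrite bop_sum; apply: eq_bigr => b _; rewrite bopZ ox.2 eqxx scale1r.
by rewrite bop_sum big1// => b _; rewrite bopZ ox.2 eq_sym (negPf ca) scale0r scaler0.
Qed.

Let liftx m b y : lift m (x b y) = \sum_a m a b *: x a y.
Proof.
rewrite liftE; apply: eq_bigr => a _; rewrite (bigD1 b)//= [X in _ + X]big1 ?addr0 => [|c cb].
  by rewrite ox.2 eqxx scale1r.
by rewrite ox.2 (negPf cb) scale0r bop0 scaler0.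
Qed.

Let lift_lin c m m' : lift (c *: m + m') = c *: lift m + lift m'.
Proof.
apply: bopP => y; rewrite bopDE bopZE !liftE scaler_sumr -big_split; apply: eq_bigr => a _.
by rewrite scaler_sumr -big_split; apply: eq_bigr => b _; rewrite !mxE scalerDl scalerA.
Qed.

Let lift_mul m m' : lift (m *m m') = lift m \oB lift m'.
Proof.
apply: bopP => y; rewrite bop_compE (liftE m) liftE; apply: eq_bigr => a _.
under eq_bigr do rewrite mxE scaler_suml.
rewrite exchange_big; apply: eq_bigr => b _; rewrite adjx_lift bop_sum scaler_sumr.
by apply: eq_bigr => c _; rewrite bopZ scalerA.
Qed.

Let lift_ct m : lift m^*t = adj (lift m).
Proof.
rewrite /lift adj_sum exchange_big; apply: eq_bigr => a _; rewrite adj_sum.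
by apply: eq_bigr => b _; rewrite adjZ adj_comp adjK !mxE.
Qed.

Let lift_inj m m' : lift m = lift m' -> m = m'.
Proof.
have [y y0] := nz0; move=> E; apply/matrixP => a b.
have coordE m0 : adj (x a) (lift m0 (x b y)) = m0 a b *: y.
  rewrite adjx_lift (bigD1 b)//= [X in _ + X]big1 ?addr0 => [|c cb].
    by rewrite ox.2 eqxx scale1r.
  by rewrite ox.2 (negPf cb) scale0r scaler0.
have /eqP := coordE m; rewrite E coordE -subr_eq0 -scalerBl scaler_eq0 (negPf y0) orbF subr_eq0.
by move/eqP.
Qed.

(** [factor_triangular] is applied to the matrices whose lift is in [nest_alg], and the basis it
    provides is used to rotate the family [x]. *)
Lemma nested_family : exists X : 'I_n -> 'B(K0, K),
  [/\ orthonormal_intertwiners pi0 pi X,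
      \sum_l X l \oB adj (X l) = \sum_l x l \oB adj (x l) &
      forall s t : 'I_n, (s <= t)%N -> nest_alg pi V (X s \oB adj (X t))].
Proof.
have [|||U [UU nestU]] := @factor_triangular C n (fun m => nest_alg pi V (lift m)).
- by move=> c m m' hm hm'; rewrite lift_lin; exact: nest_alg_lin.
- by move=> m m' hm hm'; rewrite lift_mul; exact: nest_alg_comp.
- move=> m; have [||Z hZ ZZ] := nest_factor (D := lift (m^*t *m m)).
  + exact: lift_intertwines.
  + by move=> y; rewrite lift_mul lift_ct bop_compE adjE; exact: inner_ge0.
  have iZ : intertwines pi pi Z := hZ.1.
  (* By Schur's lemma the blocks of [Z] are scalars. They are the entries of a matrix [M]. *)
  have /choice[z zE] : forall st, exists c : C, forall y, adj (x st.1) (Z (x st.2 y)) = c *: y.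
    move=> [s t] /=.
    have [c cE] := schur_scalar ipi0 (intertwines_comp (ix' s) (intertwines_comp iZ (ix t))).
    by exists c => y; move/bop_eqP: cE => /(_ y); rewrite !bop_compE.
  pose M : 'M[C]_n := \matrix_(s, t) z (s, t).
  have Zx t y : Z (x t y) = lift M (x t y).
    rewrite liftx -[LHS]/((Z \oB x t) y) full_x; last exact: intertwines_comp iZ (ix t).
    by apply: eq_bigr => s _; rewrite bop_compE (zE (s, t)) bopZ mxE.
  (* Off the isotypic component [Z] vanishes because [adj Z \oB Z] is a lift and vanishes there. *)
  have ZM : Z = lift M.
    apply: bopP => y; pose w := y - lift 1%:M y.
    have w0 s : adj (x s) w = 0.
      apply/eqP; rewrite bopB subr_eq0 adjx_lift (bigD1 s)//= big1 ?addr0 => [|c cs].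
        by rewrite mxE eqxx scale1r.
      by rewrite mxE eq_sym (negPf cs) scale0r.
    have lw m' : lift m' w = 0.
      by rewrite liftE big1// => a _; rewrite big1// => b _; rewrite w0 bop0 scaler0.
    have Zw : Z w = 0.
      by apply: adj_comp_eq0; rewrite -[LHS]/((adj Z \oB Z) w) ZZ lw.
    have yE : y = w + lift 1%:M y by rewrite subrK.
    clearbody w; rewrite yE !bopD Zw lw; congr (_ + _); rewrite liftE !bop_sum; apply: eq_bigr => a _.
    by rewrite !bop_sum; apply: eq_bigr => b _; rewrite !bopZ Zx.
  exists M; first by rewrite -ZM.
  by apply: lift_inj; rewrite lift_mul lift_ct -ZM.
have UU' : U^*t *m U = 1%:M by exact: mulmx1C.
(* The conjugates make [X s \oB adj (X t)] the lift of the matrix unit [(row s U)^*t *m row t U]. *)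
pose X s : 'B(K0, K) := \sum_a (U s a)^* *: x a.
have adjXE s y : adj (X s) y = \sum_a U s a *: adj (x a) y.
  by rewrite adj_sum bop_sumE; apply: eq_bigr => a _; rewrite adjZ conjCK bopZE.
have XE s y : X s y = \sum_a (U s a)^* *: x a y by rewrite bop_sumE.
have XX s t : X s \oB adj (X t) = lift ((row s U)^*t *m row t U).
  apply: bopP => y; rewrite bop_compE XE liftE; apply: eq_bigr => a _.
  rewrite adjXE bop_sum scaler_sumr; apply: eq_bigr => b _.
  by rewrite bopZ scalerA mxE big_ord1 !mxE.
exists X; split.
- split=> [l|l l' y]; first by apply: intertwines_sum => a _; exact: intertwinesZ.
  rewrite adjXE; have := congr1 (fun m : 'M[C]_n => m l l') UU; rewrite !mxE => <-.
  rewrite scaler_suml; apply: eq_bigr => a _; rewrite XE bop_sum (bigD1 a)//=.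
  rewrite [X in _ + X]big1 ?addr0 => [|b ba]; last by rewrite bopZ ox.2 eq_sym (negPf ba) scale0r scaler0.
  by rewrite bopZ ox.2 eqxx scale1r !mxE scalerA.
- under eq_bigr do rewrite XX.
  transitivity (lift 1%:M).
    rewrite -UU' /lift exchange_big /=; apply: eq_bigr => a _.
    rewrite exchange_big /=; apply: eq_bigr => b _; rewrite -scaler_suml; congr (_ *: _).
    by rewrite mxE; apply: eq_bigr => s _; rewrite mxE big_ord1 !mxE.
  apply: eq_bigr => a _; rewrite (bigD1 a)//= [X in _ + X]big1 ?addr0 => [|b ba].
    by rewrite mxE eqxx scale1r.
  by rewrite mxE eq_sym (negPf ba) scale0r.
- by move=> s t st; rewrite XX; exact: nestU.
Qed.

End NestedFamily.

(** * Grouping the irreducible summands by equivalence *)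

Section IsotypicDecomposition.
Variables (R : realType) (A : cstarAlgType R) (K : hilbertType R).
Local Notation C := (cplx R).

(** One summand represents each equivalence class; [x i j] is a unitary equivalence from it onto the
    [j]-th member of the class, followed by the inclusion into [K]. *)
Lemma isotypic_decomposition (pi : A -> 'B(K)) N (S : 'I_N -> csubspace K) :
  representation pi -> orthogonal_family S -> (forall s, invariant pi (S s)) ->
  (forall s, exists2 x, S s x & x != 0) -> (forall s, irreducible (restrict pi (S s))) ->
  \sum_s prj (S s) = bop_id K ->
  exists k (L : 'I_k -> hilbertType R) (rho : forall i, A -> 'B(L i)) (n : 'I_k -> nat)
      (x : forall i, 'I_(n i) -> 'B(L i, K)),
    [/\ forall i, irreducible (rho i) /\ exists y : L i, y != 0,
        forall i i', i != i' -> ~ equivalent (rho i) (rho i'),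
        forall i, (0 < n i)%N /\ orthonormal_intertwiners (rho i) pi (x i) &
        \sum_i \sum_l x i l \oB adj (x i l) = bop_id K].
Proof.
move=> rpi oS iS nS irrS sumS.
pose E s t := `[< equivalent (restrict pi (S s)) (restrict pi (S t)) >].
have EP s t : reflect (equivalent (restrict pi (S s)) (restrict pi (S t))) (E s t) by exact: asboolP.
have Er s : E s s by apply/EP; exact: equivalent_refl.
have Es s t : E s t -> E t s by move/EP/equivalent_sym => ?; apply/EP.
have Et s t u : E s t -> E t u -> E s u.
  by move=> /EP st /EP tu; apply/EP; exact: equivalent_trans st tu.
(* The choice made by [pick] depends only on the class of [s]; since [E s s] holds, the default is
   never taken. *)
pose rep s := odflt s [pick t | E s t].
have repE s : E s (rep s) by rewrite /rep; case: pickP => [//|/(_ s)]; rewrite Er.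
have rep_eq s t : E s t -> rep s = rep t.
  move=> st; rewrite /rep (eq_pick (Q := E t)).
    by case: pickP => // /(_ t); rewrite Er.
  by move=> u; apply/idP/idP => [|tu]; [exact: Et (Es _ _ st) | exact: Et st tu].
pose reps := [set rep s | s : 'I_N]%SET.
pose r (i : 'I_#|reps|) : 'I_N := enum_val i.
pose cl (i : 'I_#|reps|) := [set s | rep s == r i]%SET.
pose sub i (j : 'I_#|cl i|) : 'I_N := enum_val j.
have rP i : rep (r i) = r i.
  have /imsetP[s _ sE] := enum_valP i; rewrite /r sE; apply/esym/rep_eq; exact: repE.
have subP i j : rep (sub i j) = r i by have := enum_valP j; rewrite inE => /eqP.
have U_ i j : exists U : 'B(S (r i), S (sub i j)), unitary_op U /\
    intertwines (restrict pi (S (r i))) (restrict pi (S (sub i j))) U.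
  have /EP/equivalentP[U uU iU] : E (r i) (sub i j) by rewrite -(subP i j); apply: Es; exact: repE.
  by exists U.
pose U i j := projT1 (cid (U_ i j)).
have uU i j : unitary_op (U i j) by exact: (projT2 (cid (U_ i j))).1.
have iU i j := (projT2 (cid (U_ i j))).2.
pose x i j := csubspace_incl (S (sub i j)) \oB U i j.
have xin i j y : S (sub i j) (x i j y) by exact: valP (U i j y).
exists #|reps|, (fun i => S (r i)), (fun i => restrict pi (S (r i))), (fun i => #|cl i|), x; split.
- move=> i; split=> //; have [y Sy y0] := nS (r i).
  by exists (CsubspaceVec Sy); rewrite -(inj_eq val_inj).
- move=> i i' ii' /EP/rep_eq; rewrite !rP => /enum_val_inj ii.
  by rewrite ii eqxx in ii'.
- move=> i; split; first by apply/card_gt0P; exists (r i); rewrite inE rP.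
  split=> [l|l l' y]; first by exact: intertwines_comp (incl_intertwines (iS _)) (iU i l).
  have [<-|ll'] := eqVneq l l'.
    rewrite scale1r; apply: inner_eq => z; rewrite -adjP.
    have /bop_eqP/(_ y) := (uU i l).1; rewrite bop_compE -[RHS]/(y) => {2}<-.
    by rewrite -adjP.
  rewrite scale0r; apply: inner_eq => z; rewrite inner0r -adjP.
  apply: (oS (sub i l) (sub i l')) => // /enum_val_inj lE.
  by rewrite lE eqxx in ll'.
- have xx i j : x i j \oB adj (x i j) = prj (S (sub i j)).
    apply: bopP => y; rewrite adj_comp !bop_compE.
    have /bop_eqP/(_ (adj (csubspace_incl (S (sub i j))) y)) := (uU i j).2.
    by rewrite bop_compE => ->; rewrite prjE.
  rewrite -sumS (partition_big rep (fun u => u \in reps)) /=; last first.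
    by move=> s _; apply/imsetP; exists s.
  rewrite [RHS]big_enum_val; apply: eq_bigr => i _.
  rewrite (eq_bigl (fun s => s \in cl i)); last by move=> s; rewrite inE.
  by rewrite [RHS]big_enum_val; apply: eq_bigr => j _; rewrite xx.
Qed.

End IsotypicDecomposition.

Section ExtremeDecomposition.
Variables (R : realType) (A : cstarAlgType R).
Local Notation C := (cplx R).
Implicit Types H K : hilbertType R.

Lemma projection_csubspace H (T : 'B(H)) : adj T = T -> (forall x, T (T x) = T x) ->
  exists G : csubspace H, prj G = T.
Proof.
move=> sT TT; exists (ker_csubspace (bop_id H - T)); set G := ker_csubspace _; apply: bopP => x.
have GP y : G y <-> T y = y.
  rewrite ker_csubspaceP bopBE -[bop_id H y]/y; split=> [/eqP|->]; last by rewrite subrr.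
  by rewrite subr_eq0 => /eqP.
rewrite -{1}[x](subrK (T x)) bopD prj_eq0 ?add0r => [|y /GP <-].
  by apply: prj_id; apply/GP.
by rewrite innerBl (adjP T) sT TT subrr.
Qed.

(** The right-hand side of the characterization, named so that the two implications can be proved
    apart. *)
Definition nested_pure_form H (P : 'B(H)) (Phi : A -> 'B(H)) : Prop :=
  exists (k : nat) (K : 'I_k -> hilbertType R)
    (pi : forall i, A -> 'B(K i)) (n : 'I_k -> nat)
    (G : forall i, 'I_(n i) -> csubspace H)
    (Psi : forall (i : 'I_k) (j : 'I_(n i)), A -> 'B(G i j)) (S : 'B(H)),
    [/\ (P = 0 -> k = 0%N)
        /\ (forall i, irreducible (pi i))
        /\ (forall i i' : 'I_k, i != i' -> ~ equivalent (pi i) (pi i')),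
        forall i, (0 < n i)%N
          /\ (forall j, UCP (Psi i j) /\ pure_map (Psi i j))
          /\ nested_compressions (Psi i) (pi i),
        orthogonal_dsum
          (extend_blocks (fun p : {i : 'I_k & 'I_(n i)} => G (tag p) (tagged p))
             (orthc (range P))),
        invertible_op S
      & forall a, Phi a = Ad S (dsum_op
          (extend_by0 (orthc (range P))
             (fun p : {i : 'I_k & 'I_(n i)} => Psi (tag p) (tagged p) a)))].

Lemma big_option (V : nmodType) (I : finType) (F : option I -> V) :
  \sum_o F o = F None + \sum_i F (Some i).
Proof.
rewrite (bigD1 None)//= (reindex_omap Some id) => [|[]//]; congr (_ + _).
by apply: eq_bigl => i; rewrite eqxx.
Qed.

(** * The blocks of [H] cut out by the nested intertwiners *)

Section NestedBlocks.
Variables (H K : hilbertType R) (P : 'B(H)) (pi : A -> 'B(K)) (V : 'B(H, K)).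
Hypotheses (fH : finite_dimensional H) (P0 : positive_op P) (rpi : representation pi).
Hypotheses (cV : cyclic pi V) (VV : adj V \oB V = P).
Variables (k : nat) (L : 'I_k -> hilbertType R) (rho : forall i, A -> 'B(L i)).
Hypothesis irho : forall i, irreducible (rho i).
Hypothesis nzL : forall i, exists y : L i, y != 0.
Hypothesis inequiv : forall i i' : 'I_k, i != i' -> ~ equivalent (rho i) (rho i').
Variables (n : 'I_k -> nat) (X : forall i, 'I_(n i) -> 'B(L i, K)).
Arguments X : clear implicits.
Hypothesis n_gt0 : forall i, (0 < n i)%N.
Hypothesis oX : forall i, orthonormal_intertwiners (rho i) pi (X i).
Hypothesis fullX : \sum_i \sum_l X i l \oB adj (X i l) = bop_id K.
Hypothesis nestX : forall i (s t : 'I_(n i)), (s <= t)%N ->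
  nest_alg pi V (X i s \oB adj (X i t)).

Let p0 := prj (orthc (range P)).
Let P' : 'B(H) := bop_id H - p0.

Let P'_positive : positive_op P'.
Proof.
move=> x; rewrite bopBE -[bop_id H x]/x.
have -> : '[x - p0 x, x] = '[x - p0 x, x - p0 x].
  by rewrite [RHS]innerBr (prj_orth x (prj_in (orthc (range P)) x)) subr0.
exact: inner_ge0.
Qed.

Let P'_ker x : P' x = 0 <-> P x = 0.
Proof.
rewrite bopBE -[bop_id H x]/x; split=> [/eqP|/(orthc_range_positive _ P0)/prj_id ->]; last exact: subrr.
by rewrite subr_eq0 => /eqP xp; apply/(orthc_range_positive _ P0)/prjP.
Qed.

(** [P] and the projection [P'] onto its range have the same kernel and are therefore congruent. [T]
    becomes the invertible operator of the decomposition, and [T'] is its inverse. *)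
Let T_exists : exists TT : 'B(H) * 'B(H),
  [/\ TT.1 \oB TT.2 = bop_id H, TT.2 \oB TT.1 = bop_id H & Ad TT.1 P' = P].
Proof.
have [T [T' [h1 h2]] h] := positive_congruent fH P'_positive P0 P'_ker.
by exists (T, T').
Qed.

Let T : 'B(H) := (projT1 (cid T_exists)).1.
Let T' : 'B(H) := (projT1 (cid T_exists)).2.

Let TT' x : T (T' x) = x.
Proof.
by have [/bop_eqP h _ _] := projT2 (cid T_exists); exact: h x.
Qed.

Let T'T x : T' (T x) = x.
Proof.
by have [_ /bop_eqP h _] := projT2 (cid T_exists); exact: h x.
Qed.

Let AdT : Ad T P' = P.
Proof. by have [_ _ h] := projT2 (cid T_exists). Qed.

(* A partial isometry with initial space range P. *)
Let W : 'B(H, K) := V \oB T'.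

Let WT x : W (T x) = V x.
Proof. by rewrite bop_compE T'T. Qed.

Let WW x : adj W (W x) = P' x.
Proof.
apply: inner_eq => y; rewrite -adjP [W y]bop_compE [W x]bop_compE adjP.
have -> : adj V (V (T' x)) = P (T' x) by move/bop_eqP: VV => /(_ (T' x)).
by rewrite -AdT innerC AdE !TT' -innerC.
Qed.

Let W0 x : P x = 0 -> W x = 0.
Proof. by move=> Px; apply: adj_comp_eq0; rewrite WW; apply/P'_ker. Qed.

Let WP' x : W (P' x) = W x.
Proof.
rewrite /P' bopBE bopB (W0 (x := p0 x)) ?subr0//.
by apply/(orthc_range_positive _ P0); exact: prj_in.
Qed.

(** [W \oB adj W] is the projection onto the range of [W], which is the range of [V], and [Z] leaves
    that range invariant. *)
Let nestW Z x : nest_alg pi V Z -> W (adj W (Z (W x))) = Z (W x).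
Proof.
move=> [_ [Q QP]]; rewrite [W x]bop_compE QP -[Q (T' x)]T'T -[V _]/(W _).
by rewrite WW WP'.
Qed.

Local Notation I := {i : 'I_k & 'I_(n i)}.
Let Y (p : I) : 'B(L (tag p), K) := X (tag p) (tagged p).

Let YY (p : I) y : adj (Y p) (Y p y) = y.
Proof. by rewrite (oX (tag p)).2 eqxx scale1r. Qed.

Let Y_orth (p q : I) y : p != q -> adj (Y p) (Y q y) = 0.
Proof.
move: p q y => [i l] [i' l']; rewrite /Y /= => y pq.
have [ii|ii] := eqVneq i i'.
  subst i'; rewrite (oX i).2; have [ll|_] := eqVneq l l'; last by rewrite scale0r.
  by rewrite ll eqxx in pq.
rewrite -[LHS]/((adj (X i l) \oB X i' l') y).
have iX := intertwines_comp (intertwines_adj (irho i).1 rpi ((oX i).1 l)) ((oX i').1 l').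
rewrite (schur_inequivalent (irho i') (irho i) _ iX) ?bop0E//.
by apply: inequiv; rewrite eq_sym.
Qed.

Let Yfull y : \sum_p Y p (adj (Y p) y) = y.
Proof.
rewrite -[RHS]/(bop_id K y) -fullX bop_sumE.
rewrite (eq_bigr (fun i => \sum_l X i l (adj (X i l) y))); last by move=> i _; rewrite bop_sumE.
by rewrite (sig_big_dep (fun=> true) (fun _ _ => true) (fun i l => X i l (adj (X i l) y))).
Qed.

Let nestY i (s t : 'I_(n i)) x : (s <= t)%N ->
  W (adj W (X i s (adj (X i t) (W x)))) = X i s (adj (X i t) (W x)).
Proof. by move=> st; rewrite -[X i s _]/((X i s \oB adj (X i t)) (W x)) nestW//; exact: nestX. Qed.

Let nestp (p : I) x : W (adj W (Y p (adj (Y p) (W x)))) = Y p (adj (Y p) (W x)).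
Proof. exact: nestY. Qed.

(** The compression to [H] of the projection onto the range of [Y p]. It is again a projection
    because [Y p \oB adj (Y p)], the diagonal case of [nestX], leaves the range of [W] invariant;
    its range is the block [G]. *)
Let Rp (p : I) : 'B(H) := adj W \oB Y p \oB adj (Y p) \oB W.

Let RpE p x : Rp p x = adj W (Y p (adj (Y p) (W x))).
Proof. by []. Qed.

Let adj_Rp p : adj (Rp p) = Rp p.
Proof. by rewrite /Rp !adj_comp !adjK; apply: bopP => x. Qed.

Let WRp p x : W (Rp p x) = Y p (adj (Y p) (W x)).
Proof. exact: nestp. Qed.

Let RpRp p x : Rp p (Rp p x) = Rp p x.
Proof. by rewrite {1}RpE WRp YY. Qed.

Let RpRq p q x : p != q -> Rp p (Rp q x) = 0.
Proof. by move=> pq; rewrite RpE WRp Y_orth// !bop0. Qed.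

Let G_exists p := projection_csubspace (adj_Rp p) (RpRp p).
Let G (i : 'I_k) (j : 'I_(n i)) : csubspace H :=
  projT1 (cid (G_exists (existT (fun i => 'I_(n i)) i j))).
Let GP (p : I) : prj (G (tagged p)) = Rp p.
Proof. by case: p => i j; exact: (projT2 (cid (G_exists _))). Qed.

Let Wp i (j : 'I_(n i)) : 'B(G j, L i) := adj (X i j) \oB W \oB csubspace_incl (G j).

Let WpE i (j : 'I_(n i)) g : Wp j g = adj (X i j) (W (val g)).
Proof. by []. Qed.

Let Rp_id i (j : 'I_(n i)) (g : G j) : adj W (X i j (adj (X i j) (W (val g)))) = val g.
Proof.
rewrite -(RpE (existT (fun i => 'I_(n i)) i j)) -GP; apply: prj_id; exact: valP g.
Qed.

Let isoWp i (j : 'I_(n i)) : isometric (Wp j).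
Proof.
apply/isometricP; apply: bopP => g; apply: inner_eq => h.
by rewrite bop_compE -adjP !WpE adjE adjP Rp_id.
Qed.

Let Psi i (j : 'I_(n i)) a : 'B(G j) := Ad (Wp j) (rho i a).

Let Psi_pure i (j : 'I_(n i)) : pure_map (Psi j).
Proof. exact: compression_pure (finite_dimensional_csubspace _ fH) (irho i) (@isoWp i j). Qed.

Let Psi_ucp i (j : 'I_(n i)) : UCP (Psi j).
Proof.
split; first exact: (Psi_pure j).1.
have [_ rho1 _ _] := (irho i).1; rewrite /Psi rho1.
have /isometricP/bop_eqP isoW := @isoWp i j; apply: bop_ext => x y.
by rewrite AdE -[bop_id _ _ in LHS]/(Wp j x) adjP -[adj _ _]/((adj (Wp j) \oB Wp j) y) isoW.
Qed.

(** For [j <= j'] the operator [X i j \oB adj (X i j')] leaves the range of [W] invariant, so each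
    value of [Wp j'] is also a value of [Wp j]. The map [w] with [Wp j (w g) = Wp j' g] is then
    isometric and yields the compression. *)
Let Psi_nested i : nested_compressions (Psi (i := i)) (rho i).
Proof.
split=> [j|j _|j j' jj']; first exact: Psi_ucp.
  by exists (Wp j) => //; exact: isoWp.
pose w : 'B(G j', G j) :=
  adj (csubspace_incl (G j)) \oB adj W \oB X i j \oB adj (X i j') \oB W \oB csubspace_incl (G j').
have jj : (j <= j')%N by rewrite jj'.
have Ww g : Wp j (w g) = Wp j' g.
  rewrite !WpE -prjE (GP (existT (fun i => 'I_(n i)) i j)) WRp.
  rewrite [LHS](@YY (existT (fun i => 'I_(n i)) i j)) nestY// (oX i).2.
  by rewrite eqxx scale1r.
exists w => [g|a]; first by rewrite -(@isoWp i j) Ww isoWp.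
by rewrite /Psi Ad_comp; congr Ad; apply: bopP => g; rewrite bop_compE Ww.
Qed.

Let RpP x : \sum_p Rp p x + p0 x = x.
Proof.
have -> : \sum_p Rp p x = P' x by rewrite -WW -[in RHS](Yfull (W x)) bop_sum.
by rewrite bopBE subrK.
Qed.

Lemma nested_blocks_form : nested_pure_form P (fun a => Ad V (pi a)).
Proof.
exists k, L, rho, n, G, Psi, T; split.
(* If [P = 0] then [V = 0], and [K = 0] by cyclicity. A nonzero [L i] has no isometry into the zero
   space, whereas [n i > 0] provides one; so there is no index [i]. *)
- split=> // PE; case: k L rho irho nzL inequiv n X n_gt0 oX fullX nestX => // k' L' rho' irho' nz _ n' X' ng o _ _.
  have V0 x : V x = 0.
    by apply: adj_comp_eq0; move/bop_eqP: VV => /(_ x); rewrite PE.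
  have K0 (y : K) : y = 0.
    apply: (@dense_inner_eq0 _ _ (range (comb pi V))) => [z e /(cV z)[s sP]|_ [s _ <-]].
      by exists (comb pi V s) => //; exists s.
    by rewrite /comb big1 ?inner0r// => p _; rewrite V0 bop0.
  have [y /eqP y0] := nz ord0; case: y0.
  by have := (o ord0).2 (Ordinal (ng ord0)) (Ordinal (ng ord0)) y; rewrite eqxx scale1r => <-; rewrite (K0 (X' _ _ _)) bop0.
- move=> i; split; first exact: n_gt0.
  split; last exact: Psi_nested.
  by move=> j; split; [exact: Psi_ucp | exact: Psi_pure].
- split.
    have h1 (p q : I) (x : G (tagged p)) (y : G (tagged q)) : p != q -> '[val x, val y] = 0.
      move=> pq; have := prj_id (valP x); have := prj_id (valP y); rewrite !GP => <- <-.
      by rewrite adjP adj_Rp RpRq// inner0r.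
    have h2 (p : I) (x : G (tagged p)) (y : orthc (range P)) : '[val x, val y] = 0.
      have := prj_id (valP x); rewrite GP => <-; rewrite adjP adj_Rp RpE.
      rewrite W0 ?bop0 ?inner0r//; apply/(orthc_range_positive _ P0); exact: valP y.
    move=> [p|] [q|] // pq x y; [exact: h1|exact: h2|].
    by rewrite innerC (h2 q y x) rmorph0.
  move=> x; exists (fun o => adj (csubspace_incl _) x).
  rewrite -[LHS](RpP x) addrC big_option /=; congr (_ + _).
    by rewrite -prjE.
  by apply: eq_bigr => p _; rewrite -prjE GP.
- by exists T'; split; apply: bopP => x; [exact: TT' | exact: T'T].
(* The block sum is [Ad W (pi a)], and [W T = V]. *)
- move=> a; rewrite (_ : dsum_op _ = Ad W (pi a)).
    by rewrite Ad_comp; congr Ad; apply: bopP => x; rewrite bop_compE WT.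
  have ia p y : Y p (rho (tag p) a y) = pi a (Y p y) by exact: (oX (tag p)).1.
  have ia' p y : adj (Y p) (pi a y) = rho (tag p) a (adj (Y p) y).
    by apply: (intertwines_adj (irho (tag p)).1 rpi); exact: (oX (tag p)).1.
  rewrite /dsum_op big_option /= [X in X + _](_ : _ = 0) ?add0r; last first.
    by apply: bopP => x; rewrite !bop_compE !bop0E bop0.
  apply: bopP => x; rewrite bop_sumE.
  rewrite -[RHS]/(adj W (pi a (W x))) -[in RHS](Yfull (W x)) !bop_sum.
  apply: eq_bigr => p _; rewrite !bop_compE csubspace_inclE.
  rewrite -[_ x in LHS]/(adj (csubspace_incl (G (tagged p))) x).
  set g := adj _ x; have gE : val g = Rp p x by rewrite -GP prjE.
  have -> : val (Psi (tagged p) a g) =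
      Rp p (adj W (Y p (rho (tag p) a (adj (Y p) (W (val g)))))).
    by rewrite -GP prjE -[Psi _ _ g]/(adj (Wp _) (rho _ a (Wp (tagged p) g))) /Wp !adj_comp adjK.
  rewrite gE WRp YY -[V (T' x)]/(W x) -ia; apply: inner_eq => z.
  by rewrite -[in LHS]adj_Rp -adjP -(adjP W) WRp adjP YY -(adjP W) adjE.
Qed.

End NestedBlocks.

End ExtremeDecomposition.

Lemma extreme_nested_form (R : realType) (A : cstarAlgType R) (H : hilbertType R)
    (P : 'B(H)) (Phi : A -> 'B(H)) :
  finite_dimensional H -> positive_op P -> cstar_extreme P Phi -> nested_pure_form P Phi.
Proof.
move=> fH P0 ext; have [[cpPhi Phi1] _] := ext.
have [K [pi [V [rpi PhiE cV]]]] := stinespring fH cpPhi.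
have [d [e oe]] := onb_exists fH.
have dom := fun Psi => @extreme_dominated _ _ _ fH _ _ Psi ext.
have [N [S [oS iS nS irrS sumS]]] := irreducible_decomposition oe rpi PhiE cV dom.
have [k [L [rho [n [x [irho ineq nx sumx]]]]]] := isotypic_decomposition rpi oS iS nS irrS sumS.
have rrho i := (irho i).1.1.
(* An intertwiner from [rho i] has its values in the isotypic component of [rho i]: its components
   in the others vanish by Schur's lemma. *)
have full i (Y : 'B(L i, K)) y : intertwines (rho i) pi Y ->
    Y y = \sum_l x i l (adj (x i l) (Y y)).
  move=> iY; rewrite -[LHS]/(bop_id K (Y y)) -sumx bop_sumE (bigD1 i)//=.
  rewrite [X in _ + X]big1 ?addr0 ?bop_sumE// => i' ii'.
  rewrite bop_sumE big1// => l _; rewrite bop_compE.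
  have iZ := intertwines_comp (intertwines_adj (rrho i') rpi ((nx i').2.1 l)) iY.
  have Z0 : adj (x i' l) \oB Y = 0.
    by apply: (schur_inequivalent (irho i).1 (irho i').1 _ iZ); apply: ineq; rewrite eq_sym.
  by move/bop_eqP: Z0 => /(_ y); rewrite bop_compE => ->; rewrite bop0E bop0.
have X_ i := nested_family rpi (irho i).1 (nest_alg_factor rpi PhiE cV dom) (irho i).2 (nx i).2 (full i).
pose X i := projT1 (cid (X_ i)).
have XP i : [/\ orthonormal_intertwiners (rho i) pi (X i),
      \sum_l X i l \oB adj (X i l) = \sum_l x i l \oB adj (x i l) &
      forall s t : 'I_(n i), (s <= t)%N -> nest_alg pi V (X i s \oB adj (X i t))].
  exact: projT2 (cid (X_ i)).
have -> : Phi = (fun a => Ad V (pi a)) by apply/funext.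
apply: (nested_blocks_form fH P0 rpi cV _ (fun i => (irho i).1) (fun i => (irho i).2) ineq (X := X)).
- have [_ pi1 _ _] := rpi; rewrite -Phi1 PhiE pi1 /Ad; exact: bopP.
- by move=> i; exact: (nx i).1.
- by move=> i; have [] := XP i.
- by rewrite -sumx; apply: eq_bigr => i _; have [_ ->] := XP i.
- by move=> i s t; have [_ _] := XP i; exact.
Qed.

(** * Extremality of nested sums *)

Section NestedForms.
Variables (R : realType) (A : cstarAlgType R).
Local Notation C := (cplx R).
Implicit Types H K : hilbertType R.

(** Composing the isometries of consecutive compressions gives isometries [W j] straight into the
    space of [pi], with decreasing ranges; [J] expresses that the range of [W t] is contained in
    that of [W r]. *)
Lemma nested_isometries n (G : 'I_n -> hilbertType R) (Psi : forall j, A -> 'B(G j)) K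
    (pi : A -> 'B(K)) : nested_compressions Psi pi ->
  exists W : forall j, 'B(G j, K),
    (forall j, isometric (W j) /\ forall a, Psi j a = Ad (W j) (pi a)) /\
    forall r t : 'I_n, (r <= t)%N -> exists J : 'B(G t, G r), forall g, W r (J g) = W t g.
Proof.
move=> [_ first_c next_c].
(* Only the indices below [m] are constrained; the other values of [W] are provisional, 0 at the
   start, and the step replaces the one at [m]. *)
suff ind m : exists W : forall j, 'B(G j, K),
    (forall j : 'I_n, (j < m)%N -> isometric (W j) /\ forall a, Psi j a = Ad (W j) (pi a)) /\
    forall r t : 'I_n, (r <= t)%N -> (t < m)%N -> exists J : 'B(G t, G r), forall g, W r (J g) = W t g.
  have [W [W1 W2]] := ind n; exists W; split=> [j|r t rt]; first exact: W1.
  exact: W2.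
elim: m => [|m [W [W1 W2]]]; first by exists (fun=> 0); split.
have W'_ (j : 'I_n) : exists w : 'B(G j, K), ((j < m)%N -> w = W j) /\
    (j = m :> nat -> (isometric w /\ forall a, Psi j a = Ad w (pi a)) /\
      forall r : 'I_n, (r < m)%N -> exists J : 'B(G j, G r), forall g, W r (J g) = w g).
  have [jm|jm] := eqVneq (j : nat) m; last by exists (W j); split=> // jm'; rewrite jm' eqxx in jm.
  case: m jm W1 W2 => [|m] jm W1 W2.
    by have [w ? ?] := first_c j jm; exists w; split=> // _; split.
  have mn : (m < n)%N by have := ltn_ord j; rewrite jm => /ltnW.
  have [w iw wE] := next_c (Ordinal mn) j jm.
  have [iW WE] := W1 (Ordinal mn) (ltnSn m).
  exists (W (Ordinal mn) \oB w); split=> [|_]; first by rewrite jm ltnn.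
  split; first by split=> [x|a]; [rewrite bop_compE iW iw | rewrite wE WE Ad_comp].
  move=> r rm; have [J JP] := W2 r (Ordinal mn) rm (ltnSn m).
  by exists (J \oB w) => g; rewrite !bop_compE JP.
pose W' j := projT1 (cid (W'_ j)).
have W'P j := projT2 (cid (W'_ j)).
exists W'; split=> [j|r t rt]; rewrite ltnS leq_eqVlt => /predU1P[jm|jm].
- by have [_ /(_ jm)[]] := W'P j.
- by have [E _] := W'P j; rewrite /W' (E jm); exact: W1.
- move: rt; rewrite jm leq_eqVlt => /predU1P[rm|rm].
    have -> : r = t by apply: val_inj; rewrite /= rm jm.
    by exists (bop_id _).
  have [_ /(_ jm)[_ /(_ r rm)[J JP]]] := W'P t; exists J => g.
  by have [E _] := W'P r; rewrite /W' (E rm); exact: JP.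
- have rm := leq_ltn_trans rt jm.
  have [E _] := W'P r; have [E' _] := W'P t; rewrite /W' (E rm) (E' jm); exact: W2.
Qed.

(** By Schur's lemma the operators [adj (X s) \oB X t] are scalars, and these form the Gram matrix
    of the vectors [X t q] for any fixed unit vector [q]. Their coordinates in a Gram-Schmidt basis
    form the triangular factor. *)
Lemma triangular_gram K K' (pi : A -> 'B(K)) (rho : A -> 'B(K')) n (X : 'I_n -> 'B(K, K')) :
  irreducible pi -> representation rho -> (forall t, intertwines pi rho (X t)) ->
  exists z : 'I_n -> 'I_n -> C, (forall r t : 'I_n, (t < r)%N -> z r t = 0) /\
    forall s t y, adj (X s) (X t y) = (\sum_r (z r s)^* * z r t) *: y.
Proof.
move=> ipi rrho iX; have [[y0 y00]|K0] := pselect (exists y : K, y <> 0); last first.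
  exists (fun _ _ => 0); split=> // s t y.
  have -> : y = 0 by apply: contrapT => y0; apply: K0; exists y.
  by rewrite scaler0 !bop0.
have y1 : 0 < '[y0, y0].
  by rewrite lt_def inner_ge0 andbT; apply/eqP => /inner_eq0.
pose q := (sqrtC '[y0, y0])^-1 *: y0.
have q1 : '[q, q] = 1.
  rewrite innerZl innerZr conj_Creal ?rpredV ?ger0_real ?sqrtC_ge0 ?ltW//.
  by rewrite mulrA -invfM -expr2 sqrtCK mulVf// gt_eqF.
pose v (t : nat) : K' := if insub t is Some t' then X t' q else 0.
have vE (t : 'I_n) : v t = X t q by rewrite /v valK.
have [u [uo u1 vu]] := gram_schmidt v n.
pose z (r t : 'I_n) : C := if (r <= t)%N then '[v t, u r] else 0.
exists z; split=> [r t tr|s t y]; first by rewrite /z leqNgt tr.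
have vz (t' : 'I_n) : v t' = \sum_r z r t' *: u r.
  rewrite vu// (big_ord_widen_cond n (fun=> true) (fun s => '[v t', u s] *: u s))//.
  by rewrite big_mkcond; apply: eq_bigr => r _; rewrite /z /= ltnS; case: (_ <= _)%N; rewrite ?scale0r.
(* Each [u r] is a unit vector or zero, and in the latter case the coefficient is zero. *)
have zu r t' : z r t' * '[u r, u r] = z r t'.
  rewrite /z; case: ifP => _; rewrite ?mul0r//.
  by have [->|->] := u1 r; rewrite ?inner0r ?mul0r ?mulr1.
have [c cE] := schur_scalar ipi (intertwines_comp (intertwines_adj ipi.1 rrho (iX s)) (iX t)).
have XX w : adj (X s) (X t w) = c *: w by move/bop_eqP: cE => /(_ w).
rewrite XX; congr (_ *: _); transitivity '[v t, v s].
  by rewrite !vE -adjE XX innerZl q1 mulr1.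
rewrite (vz t) inner_suml; apply: eq_bigr => r _.
rewrite innerZl (vz s) inner_sumr (bigD1 r)//= big1 ?addr0 => [|r' r'r].
  by rewrite innerZr mulrCA zu.
by rewrite innerZr uo ?mulr0// eq_sym.
Qed.

End NestedForms.

Section NestedDomination.
Variables (R : realType) (A : cstarAlgType R).
Local Notation C := (cplx R).
Implicit Types K : hilbertType R.

Lemma orthogonal_dsum_incl K (J : finType) (S : J -> csubspace K) o o' x :
  orthogonal_dsum S -> o != o' -> adj (csubspace_incl (S o)) (prj (S o') x) = 0.
Proof.
move=> [oS _] oo; apply: inner_eq => y; rewrite inner0r -adjP prjE.
exact: oS.
Qed.

Lemma orthogonal_dsum_sum K (J : finType) (S : J -> csubspace K) x :
  orthogonal_dsum S -> \sum_o prj (S o) x = x.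
Proof.
move=> [oS sS]; have [y yE] := sS x; rewrite [RHS]yE; apply: eq_bigr => o _.
rewrite yE bop_sum (bigD1 o)//= big1 ?addr0 => [|o' oo']; first by apply: prj_id; exact: valP (y o).
by apply: prj_eq0 => z Sz; exact: oS oo' (y o') (CsubspaceVec Sz).
Qed.

Variables (H : hilbertType R) (P : 'B(H)).
Hypothesis fH : finite_dimensional H.
Variables (k : nat) (L : 'I_k -> hilbertType R) (pi : forall i, A -> 'B(L i)) (n : 'I_k -> nat).
Variable G : forall i, 'I_(n i) -> csubspace H.
Arguments G : clear implicits.
Variable (Psi : forall (i : 'I_k) (j : 'I_(n i)), A -> 'B(G i j)).
Arguments Psi : clear implicits.
Hypothesis ipi : forall i, irreducible (pi i).
Hypothesis ineq : forall i i' : 'I_k, i != i' -> ~ equivalent (pi i) (pi i').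
Hypothesis nest : forall i, nested_compressions (Psi i) (pi i).
Local Notation I := {i : 'I_k & 'I_(n i)}.
Local Notation GG := (extend_blocks (fun p : I => G (tag p) (tagged p)) (orthc (range P))).
Hypothesis oG : orthogonal_dsum GG.

Local Notation pr := (existT (fun i => 'I_(n i))).

Let D a : 'B(H) := dsum_op (extend_by0 (orthc (range P)) (fun p : I => Psi (tag p) (tagged p) a)).
Let p0 := prj (orthc (range P)).
Let inc (p : I) : 'B(G (tag p) (tagged p), H) := csubspace_incl (G (tag p) (tagged p)).

Let inc_id p g : adj (inc p) (inc p g) = g.
Proof. exact: adj_csubspace_inclE. Qed.

Let inc_orth p q g : p != q -> adj (inc p) (inc q g) = 0.
Proof.
move=> pq; have := @orthogonal_dsum_incl _ _ _ (Some p) (Some q) (inc q g) oG pq.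
by rewrite prj_id//; exact: valP g.
Qed.

Let inc_p0 p x : adj (inc p) (p0 x) = 0.
Proof. exact: (@orthogonal_dsum_incl _ _ _ (Some p) None x oG). Qed.

Let p0_inc p g : p0 (inc p g) = 0.
Proof.
by apply: inner_eq => x; rewrite inner0r -prj_inner -/p0 -(adjK (inc p)) -adjP inc_p0 inner0l.
Qed.

Let sum_inc x : \sum_p inc p (adj (inc p) x) + p0 x = x.
Proof.
rewrite -[RHS](orthogonal_dsum_sum x oG) big_option addrC; congr (_ + _).
by apply: eq_bigr => p _; rewrite prjE.
Qed.

Let D_form a x y : '[D a x, y] = \sum_p '[Psi _ (tagged p) a (adj (inc p) x), adj (inc p) y].
Proof.
rewrite /D /dsum_op big_option [X in X + _](_ : _ = 0) ?add0r; last first.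
  by apply: bopP => z; rewrite bop_compE -[LHS]/(csubspace_incl (orthc (range P)) 0) bop0.
by rewrite bop_sumE inner_suml; apply: eq_bigr => p _; rewrite !bop_compE adjP.
Qed.

Let W_exists i := nested_isometries (nest i).
Let W i : forall j, 'B(G i j, L i) := projT1 (cid (W_exists i)).
Arguments W : clear implicits.
Let isoW i j : isometric (W i j).
Proof. exact: ((projT2 (cid (W_exists i))).1 j).1. Qed.

Let PsiE i j a : Psi i j a = Ad (W i j) (pi i a).
Proof. exact: ((projT2 (cid (W_exists i))).1 j).2. Qed.

(** Made total by the value 0 for [t < r], where the triangular coefficients vanish. *)
Let J_exists i (r t : 'I_(n i)) : exists J : 'B(G i t, G i r),
  (r <= t)%N -> forall g, W i r (J g) = W i t g.
Proof.
have [rt|rt] := boolP (r <= t)%N; last by exists 0.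
by have [J JP] := (projT2 (cid (W_exists i))).2 r t rt; exists J.
Qed.
Let J i r t := projT1 (cid (@J_exists i r t)).
Arguments J : clear implicits.
Let JP i (r t : 'I_(n i)) : (r <= t)%N -> forall g, W i r (J i r t g) = W i t g.
Proof. exact: projT2 (cid (@J_exists i r t)). Qed.

(** Together the maps [xi p] form a dilation of the block sum [D] to copies of the [pi i]; see
    [D_xi]. *)
Let xi (p : I) : 'B(H, L (tag p)) := W (tag p) (tagged p) \oB adj (inc p).

Let xi_inc p g : xi p (inc p g) = W _ (tagged p) g.
Proof. by rewrite [LHS]bop_compE inc_id. Qed.

Let xi_inc0 p q g : q != p -> xi q (inc p g) = 0.
Proof. by move=> qp; rewrite [LHS]bop_compE inc_orth// bop0. Qed.

Let D_xi a x y : '[D a x, y] = \sum_p '[pi (tag p) a (xi p x), xi p y].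
Proof. by rewrite D_form; apply: eq_bigr => p _; rewrite PsiE AdE. Qed.

Let sum_sig (F : I -> C) : \sum_p F p = \sum_i \sum_j F (pr i j).
Proof.
rewrite (sig_big_dep (fun=> true) (fun _ _ => true) (fun i j => F (pr i j))).
by apply: eq_bigr => -[].
Qed.

Let xj i j : 'B(H, L i) := xi (pr i j).
Arguments xj : clear implicits.

(** [Q] is built so that [xi r (Q x) = \sum_t z r t *: xi t x] within each [i]; the form of [D] at
    [Q x] and [Q y] then has the coefficients of [z^* z], which are those of [Theta]. The summand
    [p0] makes [Q] preserve the component in the kernel of [P], which is needed for
    invertibility. *)
Lemma nested_dominated (Theta : A -> 'B(H)) : completely_positive Theta ->
  completely_positive (D - Theta) ->
  exists Q : 'B(H), (forall a, Theta a = Ad Q (D a)) /\ forall x, p0 (Q x) = p0 x.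
Proof.
move=> cpT cpDT; have [K [rho [V [rrho ThE _]]]] := stinespring fH cpT.
have [_ rho1 _ _] := rrho.
have Vp0 x : V (p0 x) = 0.
  apply: inner_eq0; apply/eqP; rewrite eq_le inner_ge0 andbT.
  have := gram_le [:: (1, p0 x)] cpDT; rewrite !gram_unit D_xi big1 => [|p _]; last first.
    by rewrite [xi p _]bop_compE inc_p0 !bop0 inner0l.
  by rewrite ThE AdE rho1.
(* Restricted to the block [p], the map [Theta] is dominated by the compression [Psi] of
   [pi (tag p)], and this yields an intertwiner. *)
have X_ (p : I) : exists X : 'B(L (tag p), K), intertwines (pi (tag p)) rho X /\
    forall g, X (W _ (tagged p) g) = V (inc p g).
  have [s|X iX XE] := @dominated_intertwiner _ _ _ _ _ (pi (tag p)) (W _ (tagged p)) rho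
    (V \oB inc p) (ipi _) rrho; last by exists X.
  rewrite -!gram_comb//; last exact: (ipi _).1.
  apply: gram_le.
  have := cp_Ad (inc p) cpDT; congr completely_positive; apply/funext => a.
  apply: bop_ext => g h; rewrite AdE -[(D - Theta) a _]/(D a (inc p g) - Theta a (inc p g)).
  rewrite -[X in _ = '[X, h]]/(Ad (W _ (tagged p)) (pi (tag p) a) g - Ad (V \oB inc p) (rho a) g).
  rewrite !innerBl ThE !AdE !bop_compE; congr (_ - _).
  rewrite D_xi (@big_only1 _ _ _ _ p)// => [|q qp _]; first by rewrite !xi_inc.
  by rewrite xi_inc0// !bop0 inner0l.
pose X p := projT1 (cid (X_ p)).
have iX p : intertwines (pi (tag p)) rho (X p) by exact: (projT2 (cid (X_ p))).1.
have XW p g : X p (W _ (tagged p) g) = V (inc p g) by exact: (projT2 (cid (X_ p))).2.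
pose Xj i j : 'B(L i, K) := X (pr i j).
have iXj i j : intertwines (pi i) rho (Xj i j) by exact: (iX (pr i j)).
(* Applying z r t to J r t requires r <= t, which is why a triangular factor is needed. *)
have z_ i := triangular_gram (ipi i) rrho (fun t => iXj i t).
pose z i : 'I_(n i) -> 'I_(n i) -> C := projT1 (cid (z_ i)).
have z0 i (r t : 'I_(n i)) : (t < r)%N -> z i r t = 0 by exact: (projT2 (cid (z_ i))).1.
have zP i s t y : adj (Xj i s) (Xj i t y) = (\sum_r (z i r s)^* * z i r t) *: y.
  exact: (projT2 (cid (z_ i))).2.
pose Q : 'B(H) := (\sum_i \sum_r \sum_t z i r t *: (inc (pr i r) \oB J i r t \oB
   adj (inc (pr i t)))) + p0.
have QE x : Q x = \sum_i \sum_r \sum_t z i r t *: inc (pr i r)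
    (J i r t (adj (inc (pr i t)) x)) + p0 x.
  rewrite bopDE bop_sumE; congr (_ + _); apply: eq_bigr => i _; rewrite bop_sumE.
  by apply: eq_bigr => r _; rewrite bop_sumE.
have xiQ i r x : xj i r (Q x) =
    \sum_t z i r t *: xj i t x.
  have incQ : adj (inc (pr i r)) (Q x) =
      \sum_t z i r t *: J i r t (adj (inc (pr i t)) x).
    rewrite QE bopD inc_p0 addr0 bop_sum (@big_only1 _ _ _ _ i)// => [|i' ii' _]; last first.
      rewrite bop_sum big1// => r' _; rewrite bop_sum big1// => t _; rewrite bopZ inc_orth ?scaler0//.
      by apply: contra ii' => /eqP/(congr1 tag) /= ->.
    rewrite bop_sum (@big_only1 _ _ _ _ r)// => [|r' rr' _].
      by rewrite bop_sum; apply: eq_bigr => t _; rewrite bopZ inc_id.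
    rewrite bop_sum big1// => t _; rewrite bopZ inc_orth ?scaler0//.
    have E : (pr i r == pr i r') = (r == r') := @eq_Tagged _ _ (pr i r) r'.
    by rewrite E eq_sym.
  rewrite -[LHS]/(W i r (adj (inc (pr i r)) (Q x))) incQ bop_sum; apply: eq_bigr => t _; rewrite bopZ.
  have [rt|tr] := leqP r t; last by rewrite z0// !scale0r.
  by congr (_ *: _); exact: JP.
exists Q; split=> [a|x]; last first.
  rewrite QE bopD {2}/p0 prjK -/p0 bop_sum big1 ?add0r// => i _; rewrite bop_sum big1// => r _.
  by rewrite bop_sum big1// => t _; rewrite bopZ p0_inc scaler0.
apply: bop_ext => x y; rewrite AdE D_xi sum_sig ThE AdE.
have VE w : V w = \sum_p X p (xi p w).
  rewrite -{1}(sum_inc w) bopD Vp0 addr0 bop_sum; apply: eq_bigr => p _.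
  by rewrite -XW.
rewrite (VE x) (VE y) bop_sum inner_suml sum_sig; apply: eq_bigr => i _.
transitivity (\sum_t \sum_s '[Xj i t (pi i a (xj i t x)),
    Xj i s (xj i s y)]).
  apply: eq_bigr => t _; rewrite inner_sumr sum_sig (@big_only1 _ _ _ _ i)//.
    by apply: eq_bigr => s _; rewrite iXj.
  (* Cross terms between inequivalent representations vanish by Schur's lemma. *)
  move=> i' ii' _; rewrite big1// => s _; rewrite -[rho _ _]iXj -adjE.
  have iZ := intertwines_comp (intertwines_adj (ipi i').1 rrho (iXj i' s)) (iXj i t).
  have Z0 : adj (Xj i' s) \oB Xj i t = 0.
    by apply: (schur_inequivalent (ipi i) (ipi i') _ iZ); apply: ineq; rewrite eq_sym.
  rewrite -[adj _ _]/((adj (Xj i' s) \oB Xj i t) (pi i a (xj i t x))) Z0 bop0E; exact: inner0l.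
transitivity (\sum_r '[pi i a (xj i r (Q x)), xj i r (Q y)]); last by [].
under [RHS]eq_bigr do rewrite xiQ bop_sum inner_suml.
rewrite [RHS]exchange_big; apply: eq_bigr => t _.
under [RHS]eq_bigr do rewrite bopZ innerZl xiQ inner_sumr mulr_sumr.
rewrite [RHS]exchange_big; apply: eq_bigr => s _.
rewrite -adjE zP innerZl mulr_suml; apply: eq_bigr => r _.
by rewrite innerZr mulrA [_^* * _]mulrC.
Qed.

End NestedDomination.

Section NestedExtreme.
Variables (R : realType) (A : cstarAlgType R) (H : hilbertType R).
Local Notation C := (cplx R).
Variables (P : 'B(H)) (Phi : A -> 'B(H)).
Hypotheses (fH : finite_dimensional H) (P0 : positive_op P).

Lemma positive_sum_kernel n (T : 'I_n -> 'B(H)) : \sum_j Ad (T j) P = P ->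
  forall j x, P x = 0 -> P (T j x) = 0.
Proof.
move=> sT j x Px; apply: positive_eq0 => //; apply/eqP; rewrite -AdE.
have : \sum_j '[Ad (T j) P x, x] == 0 by rewrite -inner_suml -bop_sumE sT Px inner0l.
rewrite psumr_eq0 => [/allP/(_ j (mem_index_enum _))//|l _].
by rewrite AdE; exact: P0.
Qed.

(** [S] is injective and maps the finite-dimensional kernel of [P] into itself, hence onto
    itself. *)
Lemma kernel_preimage (S S' : 'B(H)) : (forall x, S (S' x) = x) ->
  (forall x, S' (S x) = x) -> (forall x, P x = 0 -> P (S x) = 0) ->
  forall x, P (S x) = 0 -> P x = 0.
Proof.
move=> SS' S'S kS x PSx; pose N := ker_csubspace P.
have NP y : N y <-> P y = 0 by exact: ker_csubspaceP.
pose SN : 'B(N) := adj (csubspace_incl N) \oB S \oB csubspace_incl N.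
have SNE y : val (SN y) = S (val y).
  by rewrite -prjE; apply: prj_id; apply/NP/kS/NP; exact: valP y.
have [|SN' [/bop_eqP SNK _]] := @inj_invertible _ _ SN (finite_dimensional_csubspace N fH).
  by move=> y y0; apply: val_inj; rewrite -[LHS]S'S -SNE y0 !bop0.
have NSx : N (S x) by apply/NP.
have := SNK (CsubspaceVec NSx); rewrite bop_compE => /(congr1 val).
rewrite SNE => /(congr1 S'); rewrite S'S [S' _]S'S => <-; apply/NP.
exact: valP (SN' _).
Qed.

(** Conjugation by [S] reduces to the block sum [D]. [Q] need not be injective; the kernel condition
    in the conclusion gives invertibility once the unit of the dominated map is known to be
    congruent to [P]. *)
Lemma nested_form_dominated (Psi : A -> 'B(H)) : Phi 1 = P -> nested_pure_form P Phi ->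
  completely_positive Psi -> completely_positive (Phi - Psi) ->
  exists Q : 'B(H), (forall a, Psi a = Ad Q (Phi a)) /\ forall x, Q x = 0 -> P x = 0 -> x = 0.
Proof.
move=> Phi1 [k [L [pi [n [G [Xi [S [[_ [ipi ineq]] nXi oG [S' [SS' S'S]] PhiE]]]]]]]] cpPsi cpD.
have {}SS' x : S (S' x) = x by move/bop_eqP: SS' => /(_ x).
have {}S'S x : S' (S x) = x by move/bop_eqP: S'S => /(_ x).
pose D a : 'B(H) := dsum_op (extend_by0 (orthc (range P))
  (fun p : {i : 'I_k & 'I_(n i)} => Xi (tag p) (tagged p) a)).
have DE a : D a = Ad S' (Phi a).
  by rewrite PhiE Ad_comp; apply: bop_ext => x y; rewrite AdE !bop_compE !SS'.
have [||Q [QE Qp]] := nested_dominated fH ipi ineq (fun i => (nXi i).2.2) oG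
    (Theta := fun a => Ad S' (Psi a)).
- exact: cp_Ad.
- have := cp_Ad S' cpD; congr completely_positive; apply/funext => a.
  apply: bop_ext => x y; rewrite AdE -[(Phi - Psi) a _]/(Phi a (S' x) - Psi a (S' x)).
  rewrite -[X in _ = '[X, y]]/(D a x - Ad S' (Psi a) x) !innerBl DE !AdE.
  by [].
exists (S' \oB Q \oB S); split=> [a|x].
  apply: bop_ext => x y; rewrite AdE !bop_compE.
  have := congr1 (fun T : 'B(H) => '[T (S x), S y]) (QE a).
  by rewrite /= !AdE !S'S -/(D a) DE AdE.
rewrite !bop_compE => Qx Px.
have QSx : Q (S x) = 0 by rewrite -[LHS]SS' Qx bop0.
have D1 : D 1 (S x) = 0.
  by rewrite DE /Ad !bop_compE S'S Phi1 Px bop0.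
(* The blocks are unital, so [D 1] is the identity on the sum of the blocks and 0 on the complement
   of the range of [P]. *)
have DS : D 1 (S x) + prj (orthc (range P)) (S x) = S x.
  rewrite -[RHS](orthogonal_dsum_sum (S x) oG) big_option addrC; congr (_ + _).
  rewrite /D /dsum_op big_option bopDE [X in X + _](_ : _ = 0) ?add0r; last first.
    by rewrite bop_compE -[LHS]/(csubspace_incl (orthc (range P)) 0) bop0.
  rewrite bop_sumE; apply: eq_bigr => p _.
  by rewrite prjE !bop_compE -[extend_by0 _ _ _]/(Xi (tag p) (tagged p) 1) ((nXi (tag p)).2.1 (tagged p)).1.2.
by rewrite -[x]S'S -DS D1 add0r -Qp QSx !bop0.
Qed.

(** Each summand is dominated by [Phi], hence equals [Ad Q] of it, and [S j = Q T'] with [T'] the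
    inverse of [T j]. If [Q T' x = 0], evaluation at the unit gives [P x = 0]; since [T j] maps the
    kernel of [P] onto itself, [P (T' x) = 0], and so [T' x = 0]. *)
Lemma nested_form_extreme : CP_with_unit P Phi -> nested_pure_form P Phi -> cstar_extreme P Phi.
Proof.
move=> PhiP form; split=> // m Phis T m0 PhisP invT sT PhiE; have [cpPhi Phi1] := PhiP.
suff S_ j : exists S, invertible_op S /\ forall a, Phis j a = Ad S (Phi a).
  by exists (fun j => projT1 (cid (S_ j))) => j; exact: projT2 (cid (S_ j)).
have [T' [TT' T'T]] := invT j.
have {}TT' x : T j (T' x) = x by move/bop_eqP: TT' => /(_ x).
have {}T'T x : T' (T j x) = x by move/bop_eqP: T'T => /(_ x).
have cpPsi l : completely_positive (fun a => Ad (T l) (Phis l a)) by apply: cp_Ad; exact: (PhisP l).1.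
have [|Q [QE Q0]] := nested_form_dominated Phi1 form (cpPsi j).
  have := @cp_sum _ _ _ (index_enum 'I_m) (fun l => l != j) _ _ (fun l _ => cpPsi l); congr completely_positive; apply/funext => a.
  have E : Phi a = Ad (T j) (Phis j a) + \sum_(i | i != j) Ad (T i) (Phis i a).
    by rewrite PhiE (bigD1 j).
  by rewrite -[RHS]/(Phi a - Ad (T j) (Phis j a)) E [RHS]addrC addKr.
exists (Q \oB T'); split.
  apply: inj_invertible => // x; rewrite bop_compE => Qx.
  have PT'x : P (T' x) = 0.
    apply: (kernel_preimage TT' T'T (fun y => @positive_sum_kernel _ _ sT j y)).
    rewrite TT'; apply: positive_eq0 => //; rewrite -(PhisP j).2.
    have := congr1 (fun X : 'B(H) => '[X (T' x), T' x]) (QE 1).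
    by rewrite !AdE Qx bop0 inner0l TT'.
  by rewrite -[x]TT' (Q0 _ Qx PT'x) bop0.
move=> a; rewrite -Ad_comp -QE Ad_comp; apply: bop_ext => x y.
by rewrite AdE !bop_compE !TT'.
Qed.

End NestedExtreme.

Theorem theorem3p20 (R : realType) (H : hilbertType R) (A : cstarAlgType R)
    (P : 'B(H)) (Phi : A -> 'B(H))
    (finH : finite_dimensional H) (posP : positive_op P)
    (PhiP : CP_with_unit P Phi) :
  cstar_extreme P Phi <->
  exists (k : nat) (K : 'I_k -> hilbertType R)
    (pi : forall i, A -> 'B(K i)) (n : 'I_k -> nat)
    (G : forall i, 'I_(n i) -> csubspace H)
    (Psi : forall (i : 'I_k) (j : 'I_(n i)), A -> 'B(G i j)) (S : 'B(H)),
    [/\ (P = 0 -> k = 0%N)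
        /\ (forall i, irreducible (pi i))
        /\ (forall i i' : 'I_k, i != i' -> ~ equivalent (pi i) (pi i')),
        forall i, (0 < n i)%N
          /\ (forall j, UCP (Psi i j) /\ pure_map (Psi i j))
          /\ nested_compressions (Psi i) (pi i),
        orthogonal_dsum
          (extend_blocks (fun p : {i : 'I_k & 'I_(n i)} => G (tag p) (tagged p))
             (orthc (range P))),
        invertible_op S
      & forall a, Phi a = Ad S (dsum_op
          (extend_by0 (orthc (range P))
             (fun p : {i : 'I_k & 'I_(n i)} => Psi (tag p) (tagged p) a)))].
Proof.
by split; [exact: extreme_nested_form | exact: nested_form_extreme].
Qed.
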